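(* Let $S$ be a subset of a complete metric space and let $(B(k,X))_{k\in S}$ be a family of matrices of nuclear $\sigma$-modules which is uniformly $c$ log-convergent for some $0<c<\infty$. Then for every $\varepsilon>0$, the family of $L$-functions $L(B(k,X),T)$, $k\in S$, is uniformly meromorphic in the open disc $|T|_\pi<p^{c-\varepsilon}$. If in addition the family $L(B(k,X),T)$ is uniformly continuous (resp. essentially uniformly continuous) in the disc $|T|_\pi<p^{c-\varepsilon}$, then $L(B(k,X),T)$ is a strong family (resp. an essentially strong family) in the disc $|T|_\pi<p^{c-\varepsilon}$.
   Context: Let $p$ be a prime, $q$ a power of $p$, $K/\mathbf Q_p$ finite with residue field $\mathbf F_q$, uniformizer $\pi$, ring of integers $R$, $\mathrm{ord}_\pi\pi=1$, $|\pi|_\pi=1/p$. Fix $n\ge1$; $A_0=\{\sum_{u\in\mathbf Z^n}a_uX^u:a_u\in R,a_u\to0\text{ as }|u|=\sum|u_i|\to\infty\}$, $\sigma(X^u)=X^{qu}$ ($R$-linear). A nuclear $\sigma$-module is an $A_0$-module $M$ of all formal sums $\sum_{i\in I}a_ie_i$ ($a_i\in A_0$, $I$ at most countable) with norm $\max\|a_i\|$ (Gauss norm) and $\phi(\sum a_ie_i)=\sum\sigma(a_i)\phi(e_i)$, $\|\phi(e_i)\|\to0$; its matrix $B(X)$ is given by $\phi(e_j)=\sum_ib_{ij}e_i$. Its $L$-function is $L(B(X),T)=\prod_{\bar x}\det(I-B(x)B(x^q)\cdots B(x^{q^{d-1}})T^{d})^{-1}$ over closed points $\bar x$ of $\mathbf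 G_m^n/\mathbf F_q$, $d=\deg\bar x$, $x$ the Teichmüller lift (Fredholm determinants); it lies in $1+TR[[T]]$. Write $B(k,X)=\sum_uB_u(k)X^u$, $B_u(k)=(b_{w_1,w_2}(u,k))$ ($w_1$ row, $w_2$ column). The family is uniformly $c$ log-convergent if (i) $\liminf_{|u|\to\infty}\inf_k\mathrm{ord}_\pi B_u(k)/\log_q|u|\ge c$, and (ii) for every $C>0$ there is $N_C$ with $\mathrm{ord}_\pi b_{w_1,w_2}(u,k)\ge C$ for all $w_2>N_C$ and all $u,k,w_1$. For families $f(k,T)=\sum_{m\ge0}f_m(k)T^m$, $f_0=1$, $f_m(k)\in R$: uniformly continuous means each $f_m:S\to R$ is uniformly continuous; uniformly analytic in $|T|_\pi<p^{c'}$ means $\liminf_m\inf_k\mathrm{ord}_\pi f_m(k)/m\ge c'$; uniformly meromorphic means a quotient of two uniformly analytic families; a strong family is a quotient of two families each uniformly continuous and uniformly analytic. A family is essentially uniformly continuous in $|T|_\pi<p^{c'}$ if it equals $f_1(k,T)f_2(k,T)$ with $f_1$ uniformly continuous and each $f_2(k,T)$ analytic without zeros and of sup-norm 1 on $|T|_\pi\le p^{c'}$ (a 1-unit there); an essentially strong family is a quotient of two families each essentially uniformly continuous (with $f_1$ uniformly analytic) and uniformly analytic in $|T|_\pi<p^{c'}$. *)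

(* Defs.v *)
From HB Require Import structures.
From mathcomp Require Import all_boot all_order all_algebra all_field.
From mathcomp Require Import all_classical all_reals all_analysis.

Set Implicit Arguments.
Unset Strict Implicit.
Unset Printing Implicit Defensive.

Import Order.TTheory GRing.Theory Num.Theory.
Import numFieldNormedType.Exports.

Local Open Scope classical_set_scope.
Local Open Scope ring_scope.

Definition is_valuation (R : realType) (F : fieldType) (ord : F -> \bar R) :=
  [/\ forall x, ord x = +oo%E <-> x = 0,
      forall x, ord x != -oo%E,
      forall x y, ord (x * y) = (ord x + ord y)%E &
      forall x y, (Order.min (ord x) (ord y) <= ord (x + y)%R)%E].

Definition absv (R : realType) (F : fieldType) (p : nat) (ord : F -> \bar R)
    (x : F) : R :=
  if x == 0 then 0 else p%:R `^ (- fine (ord x)).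

Definition converges_to (R : realType) (F : fieldType) (p : nat)
    (ord : F -> \bar R) (u : nat -> F) (l : F) :=
  forall e : R, 0 < e ->
    exists N : nat, forall m, (N <= m)%N -> absv p ord (u m - l) < e.

Definition is_complete (R : realType) (F : fieldType) (p : nat)
    (ord : F -> \bar R) :=
  forall u : nat -> F,
    (forall e : R, 0 < e -> exists N : nat,
      forall m m', (N <= m)%N -> (N <= m')%N -> absv p ord (u m - u m') < e) ->
    exists l, converges_to p ord u l.

(* The limit of [u], and 0 when [u] diverges. *)
Definition vlim (R : realType) (F : fieldType) (p : nat) (ord : F -> \bar R)
    (u : nat -> F) : F :=
  xget 0 [set l | converges_to p ord u l].

(* [red] is only meaningful on the valuation ring [0 <= ord x]. *)
Definition is_residue_field (R : realType) (F : fieldType) (ord : F -> \bar R)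
    (k : fieldType) (red : F -> k) :=
  [/\ red 1 = 1,
      forall x y, (0 <= ord x)%E -> (0 <= ord y)%E ->
        red (x + y) = red x + red y /\ red (x * y) = red x * red y,
      forall z, exists2 x, (0 <= ord x)%E & red x = z &
      forall x, (0 <= ord x)%E -> (red x = 0 <-> (0 < ord x)%E)].

Definition padic_val (R : realType) (p : nat) (r : rat) : R :=
  (logn p `|numq r|)%:R - (logn p `|denq r|)%:R.

(* Q_p, up to isomorphism: the completion of Q for the p-adic valuation. *)
Definition is_Qp (R : realType) (p : nat) (Qp : fieldType)
    (ordp : Qp -> \bar R) :=
  [/\ is_valuation ordp,
      forall r : rat, r != 0 -> ordp (ratr r) = (padic_val R p r)%:E,
      is_complete p ordp &
      forall (x : Qp) (e : R), 0 < e ->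
        exists r : rat, absv p ordp (x - ratr r) < e].

(* C_p, up to isomorphism: complete and algebraically closed, with the
   algebraic closure of K dense. *)
Definition is_Cp (R : realType) (p : nat) (K : fieldType) (ord : K -> \bar R)
    (Cp : closedFieldType) (embC : K -> Cp) (ordC : Cp -> \bar R) :=
  [/\ is_valuation ordC,
      forall x, ordC (embC x) = ord x,
      is_complete p ordC &
      forall (x : Cp) (e : R), 0 < e ->
        exists2 y, algebraicOver embC y & absv p ordC (x - y) < e].

(* A finite extension K of Q_p with its normalized valuation [ord], uniformizer
   [unif] and residue field F_q.  C_p and its residue field [kbar] (an algebraic
   closure of F_q) carry the Teichmueller points and the points of the discs;
   both valuations are normalized by ord(unif) = 1 and |x| = p^(- ord x). *)
Record padic_setting (R : realType) := PadicSetting {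
  p : nat;
  q : nat;
  Qp : fieldType;
  ordp : Qp -> \bar R;
  K : fieldExtType Qp;
  ord : K -> \bar R;
  unif : K;
  Fq : finFieldType;
  redK : K -> Fq;
  Cp : closedFieldType;
  embC : {rmorphism K -> Cp};
  ordC : Cp -> \bar R;
  kbar : fieldType;
  red : Cp -> kbar;
  p_prime : prime p;
  q_power : exists2 a : nat, (0 < a)%N & q = (p ^ a)%N;
  Qp_axiom : is_Qp p ordp;
  ord_valuation : is_valuation ord;
  ord_extends : exists2 e : R, 0 < e &
    forall x : Qp, ord (x%:A) = (e%:E * ordp x)%E;
  ord_discrete : forall x : K, x != 0 -> exists z : int, ord x = (z%:~R)%:E;
  ord_unif : ord unif = 1%E;
  Fq_residue : is_residue_field ord redK;
  card_Fq : #|Fq| = q;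
  Cp_axiom : is_Cp p ord embC ordC;
  kbar_residue : is_residue_field ordC red
}.

Arguments ord {R} _ _.
Arguments ordC {R} _ _.
Arguments embC {R} _.
Arguments red {R} _ _.

(* Exponents are [u : 'rV[int]_n]; a formal series sum_u a_u X^u is the
   function u |-> a_u. *)
Definition l1 (n : nat) (u : 'rV[int]_n) : nat := (\sum_i `|u 0%R i|)%N.

Definition series_over (R : realType) (D : padic_setting R) (n : nat) :=
  'rV[int]_n -> K D.

Definition in_A0 (R : realType) (D : padic_setting R) (n : nat)
    (a : series_over D n) :=
  (forall u, (0 <= ord D (a u))%E) /\
  (forall e : R, 0 < e -> exists N : nat,
     forall u, (N <= l1 u)%N -> absv (p D) (ord D) (a u) < e).

Definition A0_mul (R : realType) (D : padic_setting R) (n : nat)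
    (a b : series_over D n) : series_over D n :=
  fun u => vlim (p D) (ord D)
    (fun N => \sum_(v \in [set v : 'rV[int]_n | (l1 v <= N)%N])
                 a v * b (u - v)).

Definition sigma (R : realType) (D : padic_setting R) (n : nat)
    (a : series_over D n) : series_over D n :=
  fun u => if [forall i, ((q D)%:Z %| u 0%R i)%Z]
           then a (\row_i (u 0%R i %/ (q D)%:Z)%Z) else 0.

(* A formal sum sum_(i in I) a_i e_i, with I a set of natural numbers, is the
   function i |-> a_i extended by 0 outside I. *)
Definition formal_sum (R : realType) (D : padic_setting R) (n : nat) :=
  nat -> series_over D n.

Definition in_module (R : realType) (D : padic_setting R) (n : nat)
    (I : set nat) (m : formal_sum D n) :=
  (forall i, I i -> in_A0 (m i)) /\ (forall i, ~ I i -> forall u, m i u = 0).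

Definition module_norm (R : realType) (D : padic_setting R) (n : nat)
    (m : formal_sum D n) : \bar R :=
  ereal_sup (range (fun iu : nat * 'rV[int]_n =>
    (absv (p D) (ord D) (m iu.1 iu.2))%:E)).

Definition basis_elt (R : realType) (D : padic_setting R) (n : nat)
    (j : nat) : formal_sum D n :=
  fun i u => ((i == j) && (u == 0))%:R.

(* [phi] is the Frobenius of a nuclear sigma-module with basis (e_i)_(i in I);
   the last clause is phi(sum a_j e_j) = sum sigma(a_j) phi(e_j). *)
Definition nuclear_sigma_module (R : realType) (D : padic_setting R) (n : nat)
    (I : set nat) (phi : formal_sum D n -> formal_sum D n) :=
  [/\ forall m, in_module I m -> in_module I (phi m),
      forall e : R, 0 < e -> exists N : nat, forall j, I j -> (N <= j)%N ->
        (module_norm (phi (@basis_elt R D n j)) < e%:E)%E &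
      forall a, in_module I a ->
        forall e : R, 0 < e -> exists N0 : nat, forall N, (N0 <= N)%N ->
        (module_norm (fun i u => (phi a i u -
           \sum_(j < N | (j : nat) \in I)
              A0_mul (sigma (a j)) (phi (@basis_elt R D n j) i) u)%R) < e%:E)%E].

(* [b i j u] is the coefficient of X^u in the entry at row i and column j,
   extended by 0 outside I x I. *)
Definition series_matrix (R : realType) (D : padic_setting R) (n : nat) :=
  nat -> nat -> series_over D n.

Definition sigma_matrix (R : realType) (D : padic_setting R) (n : nat)
    (I : set nat) (phi : formal_sum D n -> formal_sum D n) :
    series_matrix D n :=
  fun i j u => if j \in I then phi (@basis_elt R D n j) i u else 0.

Definition ps1 (F : fieldType) : nat -> F := fun m => (m == 0%N)%:R.

Definition psmul (F : fieldType) (f g : nat -> F) : nat -> F :=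
  fun m => \sum_(i < m.+1) f i * g (m - i)%N.

(* The inverse of [f], for [f 0] invertible. *)
Definition psinv (F : fieldType) (f : nat -> F) : nat -> F :=
  xget (fun=> 0) [set g | psmul f g = @ps1 F].

Definition pssubst (F : fieldType) (d : nat) (f : nat -> F) : nat -> F :=
  fun m => if (d %| m)%N then f (m %/ d)%N else 0.

Definition Teichmuller (R : realType) (D : padic_setting R) (z : kbar D) :
    Cp D :=
  xget 0 [set x | [/\ (0 <= ordC D x)%E, red D x = z &
                      exists2 d : nat, (0 < d)%N & x ^+ (q D ^ d) = x]].

Definition frob_pow (R : realType) (D : padic_setting R) (F : fieldType)
    (n e : nat) (x : 'rV[F]_n) : 'rV[F]_n :=
  map_mx (fun z => z ^+ (q D ^ e)) x.

Definition Gm_point_deg (R : realType) (D : padic_setting R) (n d : nat)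
    (x : 'rV[kbar D]_n) :=
  [/\ forall i, x 0 i != 0, (0 < d)%N, frob_pow D d x = x &
      forall e, (0 < e < d)%N -> frob_pow D e x <> x].

(* A closed point of degree d of G_m^n over F_q is a Galois orbit, of
   cardinality d, of geometric points. *)
Definition closed_points (R : realType) (D : padic_setting R) (n d : nat) :
    set (set 'rV[kbar D]_n) :=
  [set O | exists2 x, Gm_point_deg d x & O = range (fun e => frob_pow D e x)].

Definition eval_series (R : realType) (D : padic_setting R) (n : nat)
    (a : series_over D n) (x : 'rV[Cp D]_n) : Cp D :=
  vlim (p D) (ordC D)
    (fun N => \sum_(u \in [set u : 'rV[int]_n | (l1 u <= N)%N])
                 embC D (a u) * \prod_i (x 0 i) ^ (u 0 i)).

Definition inf_mul (R : realType) (D : padic_setting R)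
    (A B : nat -> nat -> Cp D) : nat -> nat -> Cp D :=
  fun i j => vlim (p D) (ordC D) (fun N => \sum_(l < N) A i l * B l j).

Definition inf_id (R : realType) (D : padic_setting R) : nat -> nat -> Cp D :=
  fun i j => (i == j)%:R.

(* The coefficients of the Fredholm determinant det(I - A T), the limit of
   the determinants of the finite truncations of A. *)
Definition fredholm (R : realType) (D : padic_setting R)
    (A : nat -> nat -> Cp D) : nat -> Cp D :=
  fun m => vlim (p D) (ordC D)
    (fun N => (\det (1%:M - 'X *: \matrix_(i < N, j < N) (A i j)%:P))`_m).

(* det(I - B(x) B(x^q) ... B(x^(q^(d-1))) T^d)^-1 *)
Definition euler_factor (R : realType) (D : padic_setting R) (n d : nat)
    (b : series_matrix D n) (x : 'rV[Cp D]_n) : nat -> Cp D :=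
  psinv (pssubst d (fredholm
    (\big[@inf_mul R D/@inf_id R D]_(e < d)
        (fun i j => eval_series (b i j) (frob_pow D e x))))).

Definition closed_point_lift (R : realType) (D : padic_setting R) (n : nat)
    (O : set 'rV[kbar D]_n) : 'rV[Cp D]_n :=
  map_mx (@Teichmuller R D) (xget 0 O).

(* Closed points of degree > m do not contribute to the coefficient of T^m. *)
Definition L_function_Cp (R : realType) (D : padic_setting R) (n : nat)
    (b : series_matrix D n) : nat -> Cp D :=
  fun m =>
    (\big[@psmul (Cp D)/@ps1 (Cp D)]_(1 <= d < m.+1)
       \big[@psmul (Cp D)/@ps1 (Cp D)]_(O \in @closed_points R D n d)
          euler_factor d b (closed_point_lift O)) m.

(* The Euler product, computed over C_p, has coefficients in K. *)
Definition L_function (R : realType) (D : padic_setting R) (n : nat)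
    (b : series_matrix D n) : nat -> K D :=
  fun m => xget 0 [set a | embC D a = L_function_Cp b m].

Definition ord_coef (R : realType) (D : padic_setting R) (n : nat)
    (b : series_matrix D n) (u : 'rV[int]_n) : \bar R :=
  ereal_inf (range (fun w : nat * nat => ord D (b w.1 w.2 u))).

(* The first clause is liminf_(|u| -> oo) inf_k ord B_u(k) / log_q |u| >= c. *)
Definition unif_log_convergent (R : realType) (D : padic_setting R) (n : nat)
    (E : Type) (S : set E) (b : E -> series_matrix D n) (c : R) :=
  (c%:E <= ereal_sup (range (fun N : nat =>
     ereal_inf [set ereal_inf
         [set (ord_coef (b k) u * ((ln (l1 u)%:R / ln (q D)%:R)^-1)%:E)%E
            | k in S]
       | u in [set u : 'rV[int]_n | (N <= l1 u)%N]])))%E /\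
  (forall C : R, 0 < C -> exists N : nat,
     forall w2, (N < w2)%N -> forall k, S k -> forall u w1,
       (C%:E <= ord D (b k w1 w2 u))%E).

Definition is_family (R : realType) (D : padic_setting R) (E : Type)
    (S : set E) (f : E -> nat -> K D) :=
  forall k, S k -> f k 0%N = 1 /\ forall m, (0 <= ord D (f k m))%E.

Definition unif_continuous_family (R : realType) (D : padic_setting R)
    (E : metricType R) (S : set E) (f : E -> nat -> K D) :=
  is_family S f /\
  forall m (e : R), 0 < e -> exists2 delta : R, 0 < delta &
    forall k k', S k -> S k' -> mdist k k' < delta ->
      absv (p D) (ord D) (f k m - f k' m) < e.

Definition unif_analytic (R : realType) (D : padic_setting R) (E : Type)
    (S : set E) (f : E -> nat -> K D) (c' : R) :=
  is_family S f /\
  (c'%:E <= limn_einf (fun m : nat =>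
     ereal_inf [set (ord D (f k m) * (m%:R^-1)%:E)%E | k in S]))%E.

Definition is_quotient (R : realType) (D : padic_setting R) (E : Type)
    (S : set E) (f g h : E -> nat -> K D) :=
  forall k, S k -> psmul (f k) (h k) = g k.

Definition unif_meromorphic (R : realType) (D : padic_setting R) (E : Type)
    (S : set E) (f : E -> nat -> K D) (c' : R) :=
  exists g h, [/\ unif_analytic S g c', unif_analytic S h c' &
                  is_quotient S f g h].

Definition strong_family (R : realType) (D : padic_setting R)
    (E : metricType R) (S : set E) (f : E -> nat -> K D) (c' : R) :=
  exists g h,
    [/\ unif_continuous_family S g /\ unif_analytic S g c',
        unif_continuous_family S h /\ unif_analytic S h c' &
        is_quotient S f g h].

Definition closed_disc (R : realType) (D : padic_setting R) (c' : R) :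
    set (Cp D) :=
  [set t | absv (p D) (ordC D) t <= (p D)%:R `^ c'].

Definition eval_ps (R : realType) (D : padic_setting R) (a : nat -> K D)
    (t : Cp D) : Cp D :=
  vlim (p D) (ordC D) (fun N => \sum_(m < N) embC D (a m) * t ^+ m).

(* Analyticity on |T| <= p^c' is |a_m| p^(c' m) -> 0; zeros and the sup-norm
   are taken over the points of the disc in C_p. *)
Definition one_unit (R : realType) (D : padic_setting R) (a : nat -> K D)
    (c' : R) :=
  [/\ (absv (p D) (ord D) (a m) * ((p D)%:R `^ c') ^+ m) @[m --> \oo] --> (0 : R),
      forall t, closed_disc c' t -> eval_ps a t != 0 &
      ereal_sup [set (absv (p D) (ordC D) (eval_ps a t))%:E
                   | t in @closed_disc R D c'] = 1%E].

Definition ess_factorization (R : realType) (D : padic_setting R)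
    (E : metricType R) (S : set E) (f f1 f2 : E -> nat -> K D) (c' : R) :=
  [/\ unif_continuous_family S f1,
      is_family S f2,
      forall k, S k -> one_unit (f2 k) c' &
      forall k, S k -> f k = psmul (f1 k) (f2 k)].

Definition ess_unif_continuous (R : realType) (D : padic_setting R)
    (E : metricType R) (S : set E) (f : E -> nat -> K D) (c' : R) :=
  exists f1 f2, ess_factorization S f f1 f2 c'.

Definition ess_strong_family (R : realType) (D : padic_setting R)
    (E : metricType R) (S : set E) (f : E -> nat -> K D) (c' : R) :=
  exists g h,
    [/\ unif_analytic S g c' /\
          (exists g1 g2, ess_factorization S g g1 g2 c' /\
                         unif_analytic S g1 c'),
        unif_analytic S h c' /\
          (exists h1 h2, ess_factorization S h h1 h2 c' /\
                         unif_analytic S h1 c') &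
        is_quotient S f g h].

(* Main.v *)
Require Import Defs.
From HB Require Import structures.
From mathcomp Require Import all_boot all_order all_algebra all_field.
From mathcomp Require Import all_classical all_reals all_analysis.
From mathcomp Require Import finmap fingroup perm cyclic ring lra zify.

(** By Dwork's trace formula, the sum of the traces of B over the points of G_m^n
    rational over F_(q^k) is (q^k - 1)^n Tr(F^k), where F is the infinite matrix
    (B_(qv-u))_(u,v).  Writing (delta f)(T) = f(T) / f(qT), this says that L is
    the n-fold delta of D^(+-1), where D(T) = det(I - F T) and the exponent is
    (-1)^(n-1).  The formula is proved exactly for truncations of B to finitely
    many columns and exponents, and L and D are limits of the truncated ones.

    Conjugating F by the weights c_2 log_q |u|, with c_2 < c, makes all but
    finitely many columns divisible by pi^(c - eps), uniformly in k and in the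
    truncation; hence D is uniformly analytic, and L is uniformly meromorphic.

    The operator delta is invertible on 1 + T R[[T]]: g(T) = f(T) g(qT) is
    solved by a recursion whose only denominators are the units 1 - q^m.  So the
    coefficients of D are Lipschitz in those of L, and continuity of L passes to
    the numerator and the denominator.  If only L = f_1 f_2 with f_1 continuous
    and f_2 a 1-unit, then the coefficients of f_2 satisfy ord >= (c - eps) m
    by the maximum principle, so the series D_1 attached to f_1 is still
    analytic, and L = (g_1 f_2) / h_1 with g_1 / h_1 = f_1. *)

Set Implicit Arguments.
Unset Strict Implicit.
Unset Printing Implicit Defensive.

Import Order.TTheory GRing.Theory Num.Theory.
Import numFieldNormedType.Exports.

Local Open Scope classical_set_scope.
Local Open Scope ring_scope.

(** The weights are logarithmic because the entry of F at (u,v) is B at qv - u: for u near qv, log_q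
    |u| and log_q |v| differ by about one, so the weight c_2 log_q gains c_2 in each such column,
    and log convergence pays for the other entries. This is where the radius p^c comes from. The
    gain fails in finitely many columns, so bounds are kept in the form ord f_m >= r m - A with A
    independent of k and of the truncation; this form passes to limits and products, and the liminf
    is taken only at the end.

    The infinite determinant D is never formed. Truncation makes the trace formula an identity of
    finite sums, and in characteristic 0 a series with constant term 1 is determined by T f'/f, so
    no exponential, with its denominators, enters. D is then read off from L by inverting delta.
    This respects congruences modulo pi^C, hence limits, and makes sense for any factor of L, as the
    essentially continuous case requires. *)

Definition vge (R : realType) (F : fieldType) (ord : F -> \bar R) (C : R)
    (x : F) := (C%:E <= ord x)%E.

(** * Valuations: estimates and limits *)

Section Valuation.
Variables (R : realType) (F : fieldType) (ord : F -> \bar R).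
Hypothesis ordP : is_valuation ord.

Local Notation vge := (vge ord).

Lemma vord0 : ord 0 = +oo%E.
Proof. by case: ordP => h _ _ _; apply/h. Qed.

Lemma ordM x y : ord (x * y) = (ord x + ord y)%E.
Proof. by case: ordP. Qed.

Lemma ord_fin x : x != 0 -> exists r : R, ord x = r%:E.
Proof.
move=> x0; case: ordP => h1 h2 _ _.
case E: (ord x) => [r||]; first by exists r.
  by move/h1: E x0 => ->; rewrite eqxx.
by move: (h2 x); rewrite E.
Qed.

Lemma vord1 : ord 1 = 0%E.
Proof.
have [r hr] := ord_fin (oner_neq0 F).
have := ordM 1 1; rewrite mulr1 hr -EFinD => -[e].
by congr (_%:E); lra.
Qed.

Lemma ordN1 : ord (-1) = 0%E.
Proof.
have [r hr] : exists r : R, ord (-1) = r%:E by apply: ord_fin; rewrite oppr_eq0 oner_neq0.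
have := ordM (-1) (-1); rewrite mulrNN mulr1 vord1 hr -EFinD => -[e].
by congr (_%:E); lra.
Qed.

Lemma ordN x : ord (- x) = ord x.
Proof. by rewrite -mulN1r ordM ordN1 add0e. Qed.

Lemma ordX x m r : ord x = r%:E -> ord (x ^+ m) = (m%:R * r)%:E.
Proof.
move=> xr; elim: m => [|m IH]; first by rewrite expr0 mul0r vord1.
by rewrite exprS ordM IH xr -EFinD -natr1 mulrDl mul1r addrC.
Qed.

Lemma ordV x r : x != 0 -> ord x = r%:E -> ord x^-1 = (- r)%:E.
Proof.
move=> x0 xr; have [s hs] : exists s : R, ord x^-1 = s%:E by apply: ord_fin; rewrite invr_eq0.
have := ordM x x^-1; rewrite divff// vord1 xr hs -EFinD => -[e].
by congr (_%:E); lra.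
Qed.

Lemma vge0 C : vge C 0.
Proof. by rewrite /vge vord0 leey. Qed.

Lemma vge1 : vge 0 1.
Proof. by rewrite /vge vord1. Qed.

Lemma vgeW C C' x : C' <= C -> vge C x -> vge C' x.
Proof. by move=> h; apply: le_trans; rewrite lee_fin. Qed.

Lemma vgeN C x : vge C (- x) = vge C x.
Proof. by rewrite /vge ordN. Qed.

Lemma vgeD C x y : vge C x -> vge C y -> vge C (x + y).
Proof.
case: ordP => _ _ _ h hx hy; apply: le_trans (h x y).
by rewrite le_min; apply/andP.
Qed.

Lemma vgeB C x y : vge C x -> vge C y -> vge C (x - y).
Proof. by move=> hx hy; apply: vgeD => //; rewrite vgeN. Qed.

Lemma vgeM C C' x y : vge C x -> vge C' y -> vge (C + C') (x * y).
Proof. by move=> hx hy; rewrite /vge ordM EFinD leeD. Qed.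

Lemma vgeMl C x y : vge 0 x -> vge C y -> vge C (x * y).
Proof. by move=> hx hy; rewrite -[C]add0r vgeM. Qed.

Lemma vgeMr C x y : vge C x -> vge 0 y -> vge C (x * y).
Proof. by move=> hx hy; rewrite -[C]addr0 vgeM. Qed.

Lemma vge_sum C (I : Type) (r : seq I) (P : pred I) (f : I -> F) :
  (forall i, P i -> vge C (f i)) -> vge C (\sum_(i <- r | P i) f i).
Proof. by move=> h; apply: (big_ind (fun x => vge C x)) => //; [exact: vge0|move=> *; exact: vgeD]. Qed.

Lemma vge_prod (I : Type) (r : seq I) (P : pred I) (f : I -> F) (C : I -> R) :
  (forall i, P i -> vge (C i) (f i)) ->
  vge (\sum_(i <- r | P i) C i) (\prod_(i <- r | P i) f i).
Proof.
move=> h; apply: (big_ind2 (fun x C => vge C x)) => //; first exact: vge1.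
by move=> *; exact: vgeM.
Qed.

Lemma vge_nat m : vge 0 m%:R.
Proof.
elim: m => [|m IH]; first exact: vge0.
by rewrite -natr1 vgeD // vge1.
Qed.

Lemma vgeX m x : vge 0 x -> vge 0 (x ^+ m).
Proof.
move=> hx; elim: m => [|m IH]; first by rewrite expr0 vge1.
by rewrite exprS vgeMl.
Qed.

Lemma vge_le_ord C x r : ord x = r%:E -> vge C x = (C <= r).
Proof. by move=> e; rewrite /vge e lee_fin. Qed.

Lemma vge_eq0 x : (forall C, vge C x) -> x = 0.
Proof.
move=> h; apply/eqP/negP => /negP x0; have [r hr] := ord_fin x0.
by have := h (r + 1); rewrite (vge_le_ord _ hr); lra.
Qed.

Lemma vge_unitMl C x y : ord x = 0%E -> vge C (x * y) -> vge C y.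
Proof. by move=> hx; rewrite /vge ordM hx add0e. Qed.

Lemma vge_trans C x y : vge C x -> vge C (x - y) -> vge C y.
Proof. by move=> hx hy; have := vgeB hx hy; rewrite subKr. Qed.

Lemma vge_closed r x : (forall C, C < r -> vge C x) -> vge r x.
Proof.
move=> h; have [-> | x0] := eqVneq x 0; first exact: vge0.
have [s hs] := ord_fin x0; rewrite (vge_le_ord _ hs) leNgt; apply/negP => sr.
have := h ((s + r) / 2); rewrite (vge_le_ord _ hs) => /(_ ltac:(lra)); lra.
Qed.

(** If [1 + x] were zero or of positive valuation, so would be [1 = (1 + x) - x]. *)
Lemma ord_1D x (e : R) : 0 < e -> vge e x -> ord (1 + x) = 0%E.
Proof.
move=> e0 hx.
have h1 : vge 0 (1 + x) by apply: vgeD; [exact: vge1|apply: vgeW hx; lra].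
have [z|nz] := eqVneq (1 + x) 0.
  have : vge e 1 by rewrite -[1](addrK x) z sub0r vgeN.
  by rewrite /vge vord1 lee_fin leNgt e0.
have [r hr] := ord_fin nz; move: h1; rewrite (vge_le_ord _ hr) => r0.
rewrite hr; congr (_%:E); apply/eqP; rewrite eq_le r0 andbT leNgt; apply/negP => rp.
pose s := Num.min r e; have s0 : 0 < s by rewrite lt_min rp e0.
have : vge s 1.
  rewrite -[1](addrK x); apply: vgeB; first by rewrite (vge_le_ord _ hr) ge_min lexx.
  by apply: vgeW hx; rewrite ge_min lexx orbT.
by rewrite /vge vord1 lee_fin leNgt s0.
Qed.

Variable p : nat.
Hypothesis p_gt1 : (1 < p)%N.

Let p1 : 1 < p%:R :> R. Proof. by rewrite ltr1n. Qed.
Let p0 : 0 < p%:R :> R. Proof. by rewrite ltr0n ltnW. Qed.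

Lemma absv_le e x : absv p ord x <= p%:R `^ (- e) <-> vge e x.
Proof.
rewrite /absv; case: eqVneq => [->|x0].
  by split=> _; [exact: vge0|exact: powR_ge0].
have [r hr] := ord_fin x0; rewrite (vge_le_ord _ hr) hr /=.
by rewrite /powR gt_eqF// ler_expR ler_pM2r ?ln_gt0// lerN2.
Qed.

Lemma vge_absv_lt e : 0 < e -> exists C, forall x, vge C x -> absv p ord x < e.
Proof.
move=> e0; exists (1 - ln e / ln p%:R) => x /absv_le h; apply: le_lt_trans h _.
have lp : 0 < ln (p%:R : R) by exact: ln_gt0.
rewrite -{2}(@lnK _ e) ?posrE// /powR gt_eqF// ltr_expR opprB mulrBl mul1r divfK ?gt_eqF//.
lra.
Qed.

Lemma absv_lt_vge C : exists2 e : R, 0 < e & forall x, absv p ord x < e -> vge C x.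
Proof.
exists (p%:R `^ (- C)); first exact: powR_gt0.
by move=> x /ltW /absv_le.
Qed.

Lemma converges_toP u l : converges_to p ord u l <->
  forall C, exists N : nat, forall m, (N <= m)%N -> vge C (u m - l).
Proof.
split=> [h C|h e e0].
  by have [e e0 he] := absv_lt_vge C; have [N hN] := h _ e0; exists N => m /hN /he.
by have [C hC] := vge_absv_lt e0; have [N hN] := h C; exists N => m /hN /hC.
Qed.

Lemma is_completeP : is_complete p ord <-> forall u,
  (forall C, exists N : nat, forall m m', (N <= m)%N -> (N <= m')%N -> vge C (u m - u m')) ->
  exists l, converges_to p ord u l.
Proof.
split=> h u hu; apply: h.
  move=> e e0; have [C hC] := vge_absv_lt e0; have [N hN] := hu C.
  by exists N => m m' hm hm'; apply/hC/hN.
move=> C; have [e e0 he] := absv_lt_vge C; have [N hN] := hu _ e0.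
by exists N => m m' hm hm'; apply/he/hN.
Qed.

Lemma vge_lim C u l N : converges_to p ord u l ->
  (forall m, (N <= m)%N -> vge C (u m)) -> vge C l.
Proof.
move=> /converges_toP /(_ C) [N' hN'] h.
apply: (@vge_trans _ (u (maxn N N'))); first by apply: h; rewrite leq_maxl.
by apply: hN'; rewrite leq_maxr.
Qed.

Lemma converges_toB u u' l l' : converges_to p ord u l -> converges_to p ord u' l' ->
  converges_to p ord (fun m => u m - u' m) (l - l').
Proof.
move=> /converges_toP h /converges_toP h'; apply/converges_toP => C.
have [N hN] := h C; have [N' hN'] := h' C.
exists (maxn N N') => m; rewrite geq_max => /andP[m1 m2].
have -> : u m - u' m - (l - l') = (u m - l) - (u' m - l') by ring.
by apply: vgeB; [exact: hN|exact: hN'].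
Qed.

Lemma converges_to_unique u l l' : converges_to p ord u l -> converges_to p ord u l' -> l = l'.
Proof.
move=> h h'; apply/eqP; rewrite -subr_eq0; apply/eqP/vge_eq0 => C.
apply: (vge_lim (N := 0) (converges_toB h h')) => m _.
by rewrite subrr; exact: vge0.
Qed.

Lemma vlimE u l : converges_to p ord u l -> vlim p ord u = l.
Proof.
move=> h; rewrite /vlim; case: xgetP => [y _ /= hy|/(_ l)//].
exact: converges_to_unique hy h.
Qed.

Lemma converges_to_const u l N : (forall m, (N <= m)%N -> u m = l) -> converges_to p ord u l.
Proof.
move=> h; apply/converges_toP => C; exists N => m /h ->.
by rewrite subrr; exact: vge0.
Qed.

Lemma vlim_const u l N : (forall m, (N <= m)%N -> u m = l) -> vlim p ord u = l.
Proof. by move=> h; apply/vlimE/(converges_to_const h). Qed.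

(* The partial sums, products, determinants considered below are all
   approximated modulo any [C] by eventually constant sequences. *)
Lemma complete_approx u : is_complete p ord ->
  (forall C, exists N l, forall m : nat, (N <= m)%N -> vge C (u m - l)) ->
  converges_to p ord u (vlim p ord u).
Proof.
move=> /is_completeP hc h; have [C|l hl] := hc u; last by rewrite (vlimE hl).
have [N [l hN]] := h C; exists N => m m' hm hm'.
have -> : u m - u m' = (u m - l) - (u m' - l) by ring.
by apply: vgeB; exact: hN.
Qed.

Lemma vge_vlim C u u' l l' : converges_to p ord u l -> converges_to p ord u' l' ->
  (forall m, vge C (u m - u' m)) -> vge C (l - l').
Proof.
by move=> h h' hu; apply: (vge_lim (N := 0) (converges_toB h h')) => m _.
Qed.

End Valuation.

(** * The ring of formal power series *)

Definition fps (F : fieldType) := nat -> F.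

Section PowerSeriesRing.
Variable F : fieldType.
Implicit Types f g h : nat -> F.

Lemma psmulC : commutative (@psmul F).
Proof.
move=> f g; apply/funext => m; rewrite /psmul (reindex_inj rev_ord_inj) /=.
by apply: eq_bigr => i _; rewrite mulrC subSS subKn // -ltnS.
Qed.

Definition trunc f m : {poly F} := \poly_(i < m.+1) f i.

Lemma coef_trunc f m i : (i <= m)%N -> (trunc f m)`_i = f i.
Proof. by rewrite coef_poly ltnS => ->. Qed.

Lemma psmul_trunc f g m i : (i <= m)%N -> psmul f g i = (trunc f m * trunc g m)`_i.
Proof.
move=> im; rewrite coefM; apply: eq_bigr => j _.
have ji : (j <= i)%N by rewrite -ltnS.
by rewrite !coef_trunc ?(leq_trans ji)// (leq_trans (leq_subr _ _)).
Qed.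

(** Up to degree [m] both sides are coefficients of products of truncations, so associativity is
    that of polynomials. *)
Lemma psmulA : associative (@psmul F).
Proof.
move=> f g h; apply/funext => m.
transitivity ((trunc f m * (trunc g m * trunc h m))`_m).
  rewrite coefM; apply: eq_bigr => j _; have jm : (j <= m)%N by rewrite -ltnS.
  by rewrite coef_trunc// (@psmul_trunc _ _ m) // leq_subr.
rewrite mulrA coefM; apply: eq_bigr => j _; have jm : (j <= m)%N by rewrite -ltnS.
by rewrite (@psmul_trunc _ _ m) // coef_trunc// leq_subr.
Qed.

Lemma psmul1 : left_id (@ps1 F) (@psmul F).
Proof.
move=> f; apply/funext => m; rewrite /psmul big_ord_recl /= subn0 mul1r big1 ?addr0// => i _.
by rewrite /ps1 /= mul0r.
Qed.

Lemma psmulDl : left_distributive (@psmul F) (fun f g m => f m + g m).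
Proof.
move=> f g h; apply/funext => m; rewrite /psmul -big_split /=.
by apply: eq_bigr => i _; rewrite mulrDl.
Qed.

Lemma ps1_neq0 : (@ps1 F : nat -> F) != (fun=> 0).
Proof. by apply/eqP => /(congr1 (@^~ 0%N)) /eqP; rewrite /ps1 /= oner_eq0. Qed.

HB.instance Definition _ := gen_eqMixin (fps F).
HB.instance Definition _ := gen_choiceMixin (fps F).

Let psaddA : associative (fun f g : fps F => (fun m => f m + g m) : fps F).
Proof. by move=> f g h; apply/funext => m; rewrite addrA. Qed.
Let psaddC : commutative (fun f g : fps F => (fun m => f m + g m) : fps F).
Proof. by move=> f g; apply/funext => m; rewrite addrC. Qed.
Let psadd0 : left_id ((fun=> 0) : fps F)
  (fun f g : fps F => (fun m => f m + g m) : fps F).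
Proof. by move=> f; apply/funext => m; rewrite add0r. Qed.
Let psaddN : left_inverse ((fun=> 0) : fps F) (fun f : fps F => (fun m => - f m) : fps F)
  (fun f g : fps F => (fun m => f m + g m) : fps F).
Proof. by move=> f; apply/funext => m; rewrite addNr. Qed.

HB.instance Definition _ := GRing.isZmodule.Build (fps F) psaddA psaddC psadd0 psaddN.
HB.instance Definition _ := GRing.Zmodule_isComNzRing.Build (fps F)
  psmulA psmulC psmul1 psmulDl ps1_neq0.

End PowerSeriesRing.

(** * Inverses, the operator delta and logarithmic derivatives *)

Section PowerSeries.
Variable F : fieldType.
Implicit Types f g h s t : fps F.

(** True by conversion: [fps F] is [nat -> F] with a ring structure whose product is [psmul], so
    [ring] and big products apply to the series of the statement. *)
Lemma psmulE f g : psmul f g = f * g. Proof. by []. Qed.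
Lemma psaddE f g m : (f + g) m = f m + g m. Proof. by []. Qed.
Lemma psoppE f m : (- f) m = - f m. Proof. by []. Qed.
Lemma coef1_ps m : (1 : fps F) m = (m == 0%N)%:R. Proof. by []. Qed.
Lemma coef0_ps m : (0 : fps F) m = 0. Proof. by []. Qed.
Lemma coefM_ps f g m : (f * g) m = \sum_(i < m.+1) f i * g (m - i)%N. Proof. by []. Qed.

Lemma coefM0_ps f g : (f * g) 0%N = f 0%N * g 0%N.
Proof. by rewrite coefM_ps big_ord1. Qed.

(* The series solving [f m = Phi m f] when [Phi m f] only depends on the
   coefficients of [f] of index < m. *)
Fixpoint prefix_rec (Phi : nat -> fps F -> F) m : fps F :=
  if m is m'.+1 then
    fun i => if i == m' then Phi m' (prefix_rec Phi m') else prefix_rec Phi m' i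
  else 0.

Definition solve_rec Phi : fps F := fun m => prefix_rec Phi m.+1 m.

Lemma solve_recE (Phi : nat -> fps F -> F) m :
  (forall m f g, (forall i, (i < m)%N -> f i = g i) -> Phi m f = Phi m g) ->
  solve_rec Phi m = Phi m (solve_rec Phi).
Proof.
move=> hPhi; rewrite /solve_rec /= eqxx; apply: (hPhi) => i.
elim: m => // m IH; rewrite ltnS leq_eqVlt => /orP[/eqP->|im] /=; first by rewrite eqxx.
by rewrite ltn_eqF// IH /= ?eqxx.
Qed.

(** The recursion never reads [f 0], so this is the inverse only for constant term 1. Being
    explicit, unlike [psinv], it lets integrality and congruences be proved by induction on the
    degree. *)
Definition psV f : fps F :=
  solve_rec (fun m g => if m is 0 then 1 else - \sum_(i < m) f i.+1 * g (m - i.+1)%N).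

Lemma psVE f m : psV f m =
  if m is 0 then 1 else - \sum_(i < m) f i.+1 * psV f (m - i.+1)%N.
Proof.
rewrite {1}/psV solve_recE// => -[//|k] g h e; congr (- _).
by apply: eq_bigr => i _; rewrite e// ltn_subrL.
Qed.

Lemma psV0 f : psV f 0%N = 1. Proof. by rewrite psVE. Qed.

Lemma mulpsV f : f 0%N = 1 -> f * psV f = 1.
Proof.
move=> f0; apply/funext => -[|m]; first by rewrite coefM0_ps f0 psV0 mulr1.
rewrite coefM_ps big_ord_recl subn0 f0 mul1r psVE coef1_ps /=.
by rewrite addNr.
Qed.

Lemma psV_unique f g : f 0%N = 1 -> f * g = 1 -> g = psV f.
Proof. by move=> f0 fg; rewrite -[g]mul1r -(mulpsV f0) mulrAC fg mul1r. Qed.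

Lemma psinvE f : f 0%N = 1 -> psinv f = psV f.
Proof.
move=> f0; rewrite /psinv; case: xgetP => [g _ /= hg|/(_ (psV f))].
  exact: psV_unique hg.
by move=> /=; rewrite psmulE mulpsV.
Qed.

Lemma psVM f g : f 0%N = 1 -> g 0%N = 1 -> psV (f * g) = psV f * psV g.
Proof.
move=> f0 g0; apply/esym/psV_unique; first by rewrite coefM0_ps f0 g0 mulr1.
by rewrite mulrACA !mulpsV// mulr1.
Qed.

Definition scale (a : F) f : fps F := fun m => a ^+ m * f m.

Lemma scale0 a f : scale a f 0%N = f 0%N. Proof. by rewrite /scale expr0 mul1r. Qed.

Lemma scaleM a f g : scale a (f * g) = scale a f * scale a g.
Proof.
apply/funext => m; rewrite /scale coefM_ps mulr_sumr [RHS]coefM_ps.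
apply: eq_bigr => i _; have im : (i <= m)%N by rewrite -ltnS.
by rewrite -{1}(subnKC im) exprD mulrACA.
Qed.

Lemma scale1 a : scale a 1 = 1.
Proof.
by apply/funext => -[|m]; rewrite /scale coef1_ps ?expr0 ?mul1r// mulr0.
Qed.

Definition delta (a : F) f : fps F := f * psV (scale a f).

Lemma delta0 a f : f 0%N = 1 -> delta a f 0%N = 1.
Proof. by move=> f0; rewrite /delta coefM0_ps f0 psV0 mulr1. Qed.

Lemma delta_scale a f : f 0%N = 1 -> delta a f * scale a f = f.
Proof. by move=> f0; rewrite /delta -mulrA [psV _ * _]mulrC mulpsV ?scale0// mulr1. Qed.

(* The inverse of [delta a]: the solution g of g(T) = f(T) g(aT), g(0) = 1. *)
Definition deltaV (a : F) f : fps F :=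
  solve_rec (fun m g => if m is 0 then 1 else
    (1 - a ^+ m)^-1 * \sum_(i < m) f i.+1 * (a ^+ (m - i.+1) * g (m - i.+1)%N)).

Lemma deltaVE a f m : deltaV a f m = if m is 0 then 1 else
  (1 - a ^+ m)^-1 * \sum_(i < m) f i.+1 * (a ^+ (m - i.+1) * deltaV a f (m - i.+1)%N).
Proof.
rewrite {1}/deltaV solve_recE// => -[//|k] g h e; congr (_ * _).
by apply: eq_bigr => i _; rewrite e// ltn_subrL.
Qed.

Lemma deltaV0 a f : deltaV a f 0%N = 1. Proof. by rewrite deltaVE. Qed.

Section Unit.
Variable a : F.
Hypothesis a_unit : forall m, 1 - a ^+ m.+1 != 0.

Lemma deltaV_scale f : f 0%N = 1 -> f * scale a (deltaV a f) = deltaV a f.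
Proof.
move=> f0; apply/funext => -[|m]; first by rewrite coefM0_ps f0 scale0 mul1r.
apply: (mulfI (a_unit m)); rewrite [in RHS]deltaVE mulrA mulfV// mul1r.
set s := (X in _ = X); have es : (1 - a ^+ m.+1) * deltaV a f m.+1 = s.
  by rewrite deltaVE mulrA mulfV// mul1r.
rewrite coefM_ps big_ord_recl subn0 f0 mul1r /scale -/s.
by rewrite mulrDr mulrCA es; ring.
Qed.

(** In degree [m + 1] the unknown coefficient occurs with the factor [1 - a ^+ m.+1], which can be
    cancelled; everything else involves lower degrees. *)
Lemma deltaV_unique f g : f 0%N = 1 -> g 0%N = 1 -> f * scale a g = g -> g = deltaV a f.
Proof.
move=> f0 g0 fg; apply/funext => m; elim/ltn_ind: m => -[|m] IH; first by rewrite deltaV0.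
have h (k : fps F) : f * scale a k = k ->
    (1 - a ^+ m.+1) * k m.+1 = \sum_(i < m.+1) f i.+1 * (a ^+ (m.+1 - i.+1) * k (m.+1 - i.+1)%N).
  move=> fk; rewrite mulrBl mul1r -{1}fk coefM_ps big_ord_recl subn0 f0 mul1r /scale.
  by rewrite addrAC subrr add0r.
apply: (mulfI (a_unit m)); rewrite h// h ?deltaV_scale//.
by apply: eq_bigr => i _; rewrite IH// ltn_subrL.
Qed.

Lemma deltaV_delta f : f 0%N = 1 -> deltaV a (delta a f) = f.
Proof.
by move=> f0; apply/esym/deltaV_unique => //; [exact: delta0|exact: delta_scale].
Qed.

Lemma delta_deltaV f : f 0%N = 1 -> delta a (deltaV a f) = f.
Proof.
move=> f0; have g0 := deltaV0 a f; have := deltaV_scale f0; set g := deltaV a f in g0 * => e.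
rewrite /delta -{1}e -mulrA mulpsV ?mulr1//.
by rewrite scale0.
Qed.

(** A consequence of uniqueness; it is what allows a 1-unit factor to be split off. *)
Lemma deltaVM f g : f 0%N = 1 -> g 0%N = 1 -> deltaV a (f * g) = deltaV a f * deltaV a g.
Proof.
move=> f0 g0; apply/esym/deltaV_unique; rewrite ?coefM0_ps ?f0 ?g0 ?deltaV0 ?mulr1//.
by rewrite scaleM mulrACA !deltaV_scale.
Qed.

Lemma iter_deltaV0 k f : f 0%N = 1 -> iter k (deltaV a) f 0%N = 1.
Proof. by case: k => // k _; rewrite iterS deltaV0. Qed.

Lemma iter_delta0 k f : f 0%N = 1 -> iter k (delta a) f 0%N = 1.
Proof. by move=> f0; elim: k => // k IH; rewrite iterS delta0. Qed.

Lemma iter_deltaVM k f g : f 0%N = 1 -> g 0%N = 1 ->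
  iter k (deltaV a) (f * g) = iter k (deltaV a) f * iter k (deltaV a) g.
Proof.
by move=> f0 g0; elim: k => // k IH; rewrite !iterS IH deltaVM// iter_deltaV0.
Qed.

Lemma iter_deltaVK k f : f 0%N = 1 -> iter k (deltaV a) (iter k (delta a) f) = f.
Proof.
by elim: k f => // k IH f f0; rewrite iterSr iterS deltaV_delta ?iter_delta0// IH.
Qed.

Lemma iter_deltaK k f : f 0%N = 1 -> iter k (delta a) (iter k (deltaV a) f) = f.
Proof.
by elim: k f => // k IH f f0; rewrite iterSr iterS delta_deltaV ?iter_deltaV0// IH.
Qed.

End Unit.

(* [iter k (delta a) w] as a quotient of products of the [scale (a ^+ i) w]. *)
Fixpoint delta_numden (a : F) (k : nat) (w : fps F) : fps F * fps F :=
  if k is k'.+1 then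
    let: (P, Q) := delta_numden a k' w in (P * scale a Q, Q * scale a P)
  else (w, 1).

Definition delta_num a k w := (delta_numden a k w).1.
Definition delta_den a k w := (delta_numden a k w).2.

Lemma delta_numS a k w :
  delta_num a k.+1 w = delta_num a k w * scale a (delta_den a k w).
Proof. by rewrite /delta_num /delta_den /=; case: delta_numden. Qed.

Lemma delta_denS a k w :
  delta_den a k.+1 w = delta_den a k w * scale a (delta_num a k w).
Proof. by rewrite /delta_num /delta_den /=; case: delta_numden. Qed.

(** Numerator and denominator arise from [w] and 1 by products and rescalings only, so any property
    stable under these is inherited. *)
Lemma delta_numden_ind (P : fps F -> Prop) a k w : P w -> P 1 ->
  (forall f g, P f -> P g -> P (f * g)) -> (forall f, P f -> P (scale a f)) ->
  P (delta_num a k w) /\ P (delta_den a k w).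
Proof.
move=> Pw P1 PM Ps; elim: k => [//|k [IHn IHd]].
by rewrite delta_numS delta_denS; split; apply: PM => //; apply: Ps.
Qed.

Lemma delta_numden_ind2 (P : fps F -> fps F -> Prop) a k v w : P v w -> P 1 1 ->
  (forall f g f' g', P f f' -> P g g' -> P (f * g) (f' * g')) ->
  (forall f f', P f f' -> P (scale a f) (scale a f')) ->
  P (delta_num a k v) (delta_num a k w) /\ P (delta_den a k v) (delta_den a k w).
Proof.
move=> Pw P1 PM Ps; elim: k => [//|k [IHn IHd]].
by rewrite !delta_numS !delta_denS; split; apply: PM => //; apply: Ps.
Qed.

Lemma delta_numdenE a k w : w 0%N = 1 ->
  iter k (delta a) w * delta_den a k w = delta_num a k w.
Proof.
move=> w0; elim: k => [|k IH]; first by rewrite /= mulr1.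
rewrite iterS delta_numS delta_denS -IH scaleM.
have := delta_scale a (iter_delta0 a k w0); set i := iter k _ w => e.
by rewrite -{3}e; ring.
Qed.

Lemma delta_numdenM a k v w :
  delta_num a k (v * w) = delta_num a k v * delta_num a k w /\
  delta_den a k (v * w) = delta_den a k v * delta_den a k w.
Proof.
elim: k => [|k [IHn IHd]]; first by rewrite /delta_num /delta_den /= mulr1.
by rewrite !delta_numS !delta_denS IHn IHd !scaleM; split; rewrite mulrACA.
Qed.

Lemma delta_numden1 a k : delta_num a k 1 = 1 /\ delta_den a k 1 = 1.
Proof.
apply: (delta_numden_ind (P := fun f => f = 1)) => // [f g -> ->|f ->].
  by rewrite mulr1.
by rewrite scale1.
Qed.

(* [logd f s] says that s = T f'/f. *)
Definition logd f s := forall m, m%:R * f m = (f * s) m.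

Lemma logdM f g s t : logd f s -> logd g t -> logd (f * g) (s + t).
Proof.
move=> fs gt m.
have -> : f * g * (s + t) = (f * s) * g + f * (g * t) by ring.
rewrite psaddE !coefM_ps -big_split mulr_sumr /=; apply: eq_bigr => i _.
have im : (i <= m)%N by rewrite -ltnS.
by rewrite -fs -gt -{1}(subnKC im) natrD; ring.
Qed.

Lemma logd1 : logd 1 0.
Proof.
by move=> m; rewrite [1 * 0]mulr0 coef1_ps coef0_ps; case: m => [|m]; rewrite ?mul0r ?mulr0.
Qed.

Lemma logd_prod (I : Type) (r : seq I) (P : pred I) (f s : I -> fps F) :
  (forall i, P i -> logd (f i) (s i)) ->
  logd (\prod_(i <- r | P i) f i) (\sum_(i <- r | P i) s i).
Proof.
by move=> h; apply: (big_ind2 logd) => //; [exact: logd1|move=> *; exact: logdM].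
Qed.

Lemma logdV f s : f 0%N = 1 -> logd f s -> logd (psV f) (- s).
Proof.
move=> f0 fs m.
suff e : (fun m => m%:R * psV f m) = psV f * - s :> fps F by rewrite -e.
set dg : fps F := (fun m => m%:R * psV f m).
(* With [g = psV f] this says [T (f g)' = 0]; multiplying by [g] then cancels [f]. *)
have : f * (dg + psV f * s) = 0.
  have -> : f * (dg + psV f * s) = f * dg + (f * s) * psV f by ring.
  apply/funext => k; rewrite psaddE !coefM_ps -big_split /=.
  transitivity (k%:R * (f * psV f) k); last by rewrite mulpsV// (logd1 k) [1 * 0]mulr0.
  rewrite coefM_ps mulr_sumr.
  apply: eq_bigr => i _; have im : (i <= k)%N by rewrite -ltnS.
  have ek : k%:R = i%:R + (k - i)%:R :> F by rewrite -natrD subnKC.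
  by rewrite -fs /dg ek; ring.
move=> /(congr1 ( *%R (psV f))); rewrite mulrA [psV f * f]mulrC mulpsV// mul1r mulr0.
by move=> /eqP; rewrite addr_eq0 mulrN => /eqP.
Qed.

Lemma logd_scale a f s : logd f s -> logd (scale a f) (scale a s).
Proof. by move=> fs m; rewrite -scaleM /scale mulrCA fs. Qed.

Lemma logd_delta a f s : f 0%N = 1 -> logd f s ->
  logd (delta a f) (fun m => (1 - a ^+ m) * s m).
Proof.
move=> f0 fs; rewrite (_ : (fun m => _) = s - scale a s).
  by apply: logdM => //; apply: logdV; rewrite ?scale0//; exact: logd_scale.
by apply/funext => m; rewrite psaddE psoppE /scale mulrBl mul1r.
Qed.

Lemma logd_iter_delta a k f s : f 0%N = 1 -> logd f s ->
  logd (iter k (delta a) f) (fun m => (1 - a ^+ m) ^+ k * s m).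
Proof.
move=> f0 fs; elim: k => [|k IH].
  by rewrite (_ : (fun _ => _) = s)//; apply/funext => m; rewrite expr0 mul1r.
have := logd_delta a (iter_delta0 a k f0) IH; congr (logd _ _).
by apply/funext => m; rewrite mulrA -exprS.
Qed.

(** Since [s 0 = 0], the relation expresses [m f_m] by lower coefficients, and [m] is invertible.
    The bound [M] is there because the Euler product for the coefficient of [T ^ M] omits the points
    of larger degree. *)
Lemma logd_unique f g s t M : (forall m, m.+1%:R != 0 :> F) ->
  f 0%N = 1 -> g 0%N = 1 -> logd f s -> logd g t ->
  (forall m, (m <= M)%N -> s m = t m) -> forall m, (m <= M)%N -> f m = g m.
Proof.
move=> ch f0 g0 fs gt st m.
elim/ltn_ind: m => -[|m] IH mM; first by rewrite f0 g0.
have s0 : s 0%N = 0 by have := fs 0%N; rewrite mul0r coefM0_ps f0 mul1r.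
apply: (mulfI (ch m)); rewrite fs gt !coefM_ps.
apply: eq_bigr => i _; rewrite st; last by rewrite (leq_trans (leq_subr _ _)).
case: (ltnP i m.+1) => im; first by rewrite IH// (leq_trans (ltnW im)).
have -> : (m.+1 - i = 0)%N by apply/eqP; rewrite subn_eq0.
by rewrite -st// s0 !mulr0.
Qed.

Lemma pssubstM d f g : (0 < d)%N ->
  pssubst d (f * g) = (pssubst d f : fps F) * pssubst d g :> fps F.
Proof.
move=> d0; apply/funext => m; rewrite [RHS]coefM_ps {1}/pssubst.
case: ifPn => [/dvdnP[k ->]|ndm]; last first.
  rewrite big1// => i _; have im : (i <= m)%N by rewrite -ltnS.
  rewrite /pssubst; case: ifP => di; last by rewrite mul0r.
  case: ifP => dmi; last by rewrite mulr0.
  by case/negP: ndm; have := dvdn_add di dmi; rewrite subnKC.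
rewrite mulnK// coefM_ps.
rewrite [RHS](bigID (fun i : 'I_(k * d).+1 => d %| i)%N) /= [X in _ = _ + X]big1 ?addr0; last first.
  by move=> i ndi; rewrite /pssubst (negbTE ndi) mul0r.
rewrite (reindex_onto (fun j : 'I_k.+1 => inord (j * d)%N : 'I_(k * d).+1)
   (fun i : 'I_(k * d).+1 => inord (i %/ d)%N : 'I_k.+1)) /=; last first.
  move=> i /dvdnP[j ij]; apply/val_inj => /=.
  have jk : (j < k.+1)%N by have := ltn_ord i; rewrite ltnS ij leq_pmul2r.
  by rewrite !inordK ij ?mulnK// ltnS leq_pmul2r.
apply: eq_big => [j|j _].
  have jk : (j <= k)%N by rewrite -ltnS.
  rewrite inordK ?ltnS ?leq_pmul2r// dvdn_mull//= mulnK//.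
  by apply/esym/eqP/val_inj; rewrite /= inordK.
have jk : (j <= k)%N by rewrite -ltnS.
rewrite /pssubst inordK ?ltnS ?leq_pmul2r// -mulnBl !dvdn_mull// !mulnK//.
Qed.

(** The chain rule. Its factor [d] will account for the [d] geometric points of a closed point. *)
Lemma logd_pssubst d f s : (0 < d)%N -> logd f s ->
  logd (pssubst d f) (fun m => d%:R * pssubst d s m).
Proof.
move=> d0 fs m; rewrite coefM_ps.
transitivity (d%:R * ((pssubst d f : fps F) * pssubst d s) m); last first.
  by rewrite coefM_ps mulr_sumr; apply: eq_bigr => i _; rewrite mulrCA.
rewrite -pssubstM// /pssubst; case: ifP => [/dvdnP[k ->]|_]; last by rewrite !mulr0.
by rewrite mulnK// -fs natrM; ring.
Qed.

End PowerSeries.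

(** * Congruences and growth of series over a valued field *)

Section ValuedSeries.
Variables (R : realType) (F : fieldType) (ord : F -> \bar R).
Hypothesis ordP : is_valuation ord.
Local Notation vge := (vge ord).
Implicit Types f g : fps F.

(** Integrality of both sides is part of the relation, which makes it stable under products without
    side conditions. *)
Definition vcong C (x y : F) := [/\ vge 0 x, vge 0 y & vge C (x - y)].

Lemma vcong_refl C x : vge 0 x -> vcong C x x.
Proof. by move=> hx; split=> //; rewrite subrr; exact: vge0. Qed.

Lemma vcongD C x y x' y' : vcong C x x' -> vcong C y y' -> vcong C (x + y) (x' + y').
Proof.
move=> [h1 h2 h3] [h4 h5 h6]; split; try exact: vgeD.
by rewrite opprD addrACA; exact: vgeD.
Qed.

Lemma vcongN C x x' : vcong C x x' -> vcong C (- x) (- x').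
Proof. by case=> h1 h2 h3; split; [rewrite vgeN|rewrite vgeN|rewrite -opprD vgeN]. Qed.

Lemma vcongM C x y x' y' : vcong C x x' -> vcong C y y' -> vcong C (x * y) (x' * y').
Proof.
move=> [h1 h2 h3] [h4 h5 h6]; split; try exact: vgeMl.
have -> : x * y - x' * y' = x * (y - y') + (x - x') * y' by ring.
by apply: vgeD => //; [exact: vgeMl|exact: vgeMr].
Qed.

Lemma vcong_sum C (I : Type) (r : seq I) (P : pred I) (f f' : I -> F) :
  (forall i, P i -> vcong C (f i) (f' i)) ->
  vcong C (\sum_(i <- r | P i) f i) (\sum_(i <- r | P i) f' i).
Proof.
move=> h; apply: (big_ind2 (vcong C)) => //; first by apply/vcong_refl/vge0.
by move=> *; exact: vcongD.
Qed.

Lemma vcong_prod C (I : Type) (r : seq I) (P : pred I) (f f' : I -> F) :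
  (forall i, P i -> vcong C (f i) (f' i)) ->
  vcong C (\prod_(i <- r | P i) f i) (\prod_(i <- r | P i) f' i).
Proof.
move=> h; apply: (big_ind2 (vcong C)) => //; first by apply/vcong_refl/vge1.
by move=> *; exact: vcongM.
Qed.

(** Integrality is asked in all degrees but congruence only up to [M], as uniform continuity
    controls finitely many coefficients at a time. *)
Definition scong C M f g :=
  (forall m, vge 0 (f m) /\ vge 0 (g m)) /\ forall m, (m <= M)%N -> vcong C (f m) (g m).

Lemma scong_refl C M f : (forall m, vge 0 (f m)) -> scong C M f f.
Proof. by move=> h; split=> [m|m _]; [split|exact: vcong_refl]. Qed.

Lemma scong1 C M : scong C M 1 1.
Proof. by apply: scong_refl => m; rewrite coef1_ps; exact: vge_nat. Qed.

Lemma integralM f g : (forall m, vge 0 (f m)) -> (forall m, vge 0 (g m)) ->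
  forall m, vge 0 ((f * g) m).
Proof. by move=> hf hg m; rewrite coefM_ps; apply: vge_sum => // i _; exact: vgeMl. Qed.

Lemma scongM C M f g f' g' : scong C M f f' -> scong C M g g' -> scong C M (f * g) (f' * g').
Proof.
move=> [h1 h2] [h3 h4]; split=> [m|m mM].
  by split; apply: integralM => i; [have [] := h1 i|have [] := h3 i|have [] := h1 i|have [] := h3 i].
rewrite !coefM_ps; apply: vcong_sum => i _; apply: vcongM.
  by apply: h2; rewrite (leq_trans _ mM)// -ltnS.
by apply: h4; rewrite (leq_trans (leq_subr _ _)).
Qed.

Lemma scong_prod C M (I : Type) (r : seq I) (P : pred I) (f f' : I -> fps F) :
  (forall i, P i -> scong C M (f i) (f' i)) ->
  scong C M (\prod_(i <- r | P i) f i) (\prod_(i <- r | P i) f' i).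
Proof.
move=> h; apply: (big_ind2 (scong C M)) => //; first exact: scong1.
by move=> *; exact: scongM.
Qed.

Lemma integralV f : (forall m, vge 0 (f m)) -> forall m, vge 0 (psV f m).
Proof.
move=> hf m; elim/ltn_ind: m => -[|m] IH; rewrite psVE; first exact: vge1.
by rewrite vgeN//; apply: vge_sum => // i _; apply: vgeMl => //; apply: IH; rewrite ltn_subrL.
Qed.

Lemma scongV C M f g : scong C M f g -> scong C M (psV f) (psV g).
Proof.
move=> [h1 h2]; split=> [m|m].
  by split; apply: integralV => i; have [] := h1 i.
elim/ltn_ind: m => -[|m] IH mM; rewrite !psVE; first by apply/vcong_refl/vge1.
apply: vcongN; apply: vcong_sum => i _; apply: vcongM; first by apply: h2; rewrite (leq_trans _ mM).
by apply: IH; rewrite ?ltn_subrL// (leq_trans (leq_subr _ _)).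
Qed.

Lemma scong_scale C M a f g : vge 0 a -> scong C M f g -> scong C M (scale a f) (scale a g).
Proof.
move=> ha [h1 h2]; split=> [m|m mM].
  by have [? ?] := h1 m; split; apply: vgeMl => //; exact: vgeX.
by apply: vcongM; [apply/vcong_refl/vgeX|exact: h2].
Qed.

Lemma scong_deltaV C M a f g : vge 0 a -> (forall m, ord (1 - a ^+ m.+1) = 0%E) ->
  scong C M f g -> scong C M (deltaV a f) (deltaV a g).
Proof.
move=> ha ua [h1 h2].
have hV m : vge 0 (1 - a ^+ m.+1)^-1.
  by rewrite /vge (@ordV _ _ _ ordP _ 0) ?oppr0//; apply/eqP => e; have := ua m; rewrite e vord0.
have hint h : (forall m, vge 0 (h m)) -> forall m, vge 0 (deltaV a h m).
  move=> hh m; elim/ltn_ind: m => -[|m] IH; rewrite deltaVE; first exact: vge1.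
  apply: vgeMl => //; apply: vge_sum => // i _; apply: vgeMl => //.
  by apply: vgeMl => //; [exact: vgeX|apply: IH; rewrite ltn_subrL].
split=> [m|m].
  by split; apply: hint => i; have [] := h1 i.
elim/ltn_ind: m => -[|m] IH mM; rewrite !deltaVE; first by apply/vcong_refl/vge1.
apply: vcongM; first exact: vcong_refl.
apply: vcong_sum => i _; apply: vcongM; first by apply: h2; rewrite (leq_trans _ mM).
apply: vcongM; first by apply/vcong_refl/vgeX.
by apply: IH; rewrite ?ltn_subrL// (leq_trans (leq_subr _ _)).
Qed.

Lemma scong_pssubst C M d f g : scong C M f g -> scong C M (pssubst d f) (pssubst d g).
Proof.
move=> [h1 h2]; split=> [m|m mM]; rewrite /pssubst; case: ifP => _ //.
- by split; exact: vge0.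
- by apply: h2; rewrite (leq_trans (leq_div _ _)).
- by apply/vcong_refl/vge0.
Qed.

(** A quantitative analyticity in |T| < p^r. The defects [A] add under products, and [A = 0]
    survives inversion ([growthV]). *)
Definition growth (r A : R) f := forall m, vge (r * m%:R - A) (f m).

Lemma growth1 r : growth r 0 1.
Proof.
move=> [|m]; rewrite coef1_ps /=; last exact: vge0.
by rewrite mulr0 subr0; exact: vge1.
Qed.

Lemma growthM r A B f g : growth r A f -> growth r B g -> growth r (A + B) (f * g).
Proof.
move=> hf hg m; rewrite coefM_ps; apply: vge_sum => // i _.
have im : (i <= m)%N by rewrite -ltnS.
apply: vgeW (vgeM ordP (hf i) (hg (m - i)%N)).
by rewrite natrB//; rewrite le_eqVlt; apply/orP; left; apply/eqP; ring.
Qed.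

Lemma growthW r A B f : A <= B -> growth r A f -> growth r B f.
Proof. by move=> AB hf m; apply: vgeW (hf m); lra. Qed.

Lemma growth_scale r A a f : vge 0 a -> growth r A f -> growth r A (scale a f).
Proof. by move=> ha hf m; apply: vgeMl => //; exact: vgeX. Qed.

Lemma growthV r f : growth r 0 f -> growth r 0 (psV f).
Proof.
move=> hf m; elim/ltn_ind: m => -[|m] IH; rewrite psVE.
  by rewrite mulr0 subr0; exact: vge1.
rewrite vgeN//; apply: vge_sum => // i _.
apply: vgeW (vgeM ordP (hf i.+1) (IH (m.+1 - i.+1)%N _)); last by rewrite ltn_subrL.
by rewrite natrB ?ltn_ord//; rewrite le_eqVlt; apply/orP; left; apply/eqP; ring.
Qed.

Lemma growth_deltaV r a f : vge 0 a -> (forall m, ord (1 - a ^+ m.+1) = 0%E) ->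
  growth r 0 f -> growth r 0 (deltaV a f).
Proof.
move=> ha ua hf.
have hV m : vge 0 (1 - a ^+ m.+1)^-1.
  by rewrite /vge (@ordV _ _ _ ordP _ 0) ?oppr0//; apply/eqP => e; have := ua m; rewrite e vord0.
move=> m; elim/ltn_ind: m => -[|m] IH; rewrite deltaVE.
  by rewrite mulr0 subr0; exact: vge1.
apply: vgeMl => //; apply: vge_sum => // i _; rewrite mulrCA.
apply: vgeMl => //; first exact: vgeX.
apply: vgeW (vgeM ordP (hf i.+1) (IH (m.+1 - i.+1)%N _)); last by rewrite ltn_subrL.
by rewrite natrB ?ltn_ord//; rewrite le_eqVlt; apply/orP; left; apply/eqP; ring.
Qed.

End ValuedSeries.

(** * Characteristic series of finite matrices *)

Section CharSeries.
Variable F : fieldType.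

Definition charps N (A : 'M[F]_N) : fps F :=
  fun m => (\det (1%:M - 'X *: map_mx polyC A))`_m.

Lemma charps0 N (A : 'M[F]_N) : charps A 0%N = 1.
Proof.
rewrite /charps -horner_coef0 -[_.[0]]/(horner_eval 0 _) -det_map_mx.
rewrite (_ : map_mx _ _ = 1%:M) ?det1//.
apply/matrixP => i j; rewrite !mxE /= /horner_eval hornerD hornerN hornerM hornerX mul0r subr0.
by case: (i == j); rewrite hornerE.
Qed.

(** [J] is the set of rows where the term with ['X] is chosen. In the other rows the identity matrix
    forces [s i = i], which is [perm_on J s]. *)
Lemma coef_prod_charps N (A : 'M[F]_N) (s : 'S_N) m :
  (\prod_i (1%:M - 'X *: map_mx polyC A) i (s i))`_m =
  \sum_(J : {set 'I_N} | (#|J| == m) && perm_on J s) (-1) ^+ m * \prod_(i in J) A i (s i).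
Proof.
pose G (i : 'I_N) := (i == s i)%:R : {poly F}.
rewrite (eq_bigr (fun i => - ('X * (A i (s i))%:P) + G i)); last first.
  by move=> i _; rewrite !mxE addrC.
rewrite bigA_distr coef_sum [RHS]big_mkcond /=; apply: eq_bigr => J _.
have -> : \prod_i (if i \in J then - ('X * (A i (s i))%:P) else G i) =
    ((-1) ^+ #|J| * \prod_(i in J) A i (s i))%:P * 'X^#|J| * \prod_(i | i \notin J) G i.
  rewrite (bigID (mem J)) /=; congr (_ * _); last by apply: eq_bigr => i /negbTE ->.
  transitivity (\prod_(i in J) (- 'X * (A i (s i))%:P)).
    by apply: eq_bigr => i ->; rewrite mulNr.
  by rewrite big_split /= prodr_const -rmorph_prod [(- 'X) ^+ _]exprNn polyCM polyC_exp polyCN polyC1 mulrAC.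
have -> : \prod_(i | i \notin J) G i = (perm_on J s)%:R.
  case: (boolP (perm_on J s)) => [Js|/subsetPn[x]].
    by rewrite big1// => i iJ; rewrite /G (out_perm Js)// eqxx.
  rewrite inE eq_sym => sx xJ; rewrite (bigD1 x) //= /G (negbTE sx) mul0r.
  by [].
case: (perm_on J s); last by rewrite mulr0 coef0 andbF.
rewrite mulr1 coefCM coefXn andbT eq_sym; case: eqP => [->|_]; first by rewrite mulr1.
by rewrite mulr0.
Qed.

(** The signed sum of the principal minors of size [m], left expanded so that weights attached to
    indices can cancel along each permutation. *)
Lemma charps_coef N (A : 'M[F]_N) m : charps A m =
  \sum_(s : 'S_N) (-1) ^+ s *
    \sum_(J : {set 'I_N} | (#|J| == m) && perm_on J s) (-1) ^+ m * \prod_(i in J) A i (s i).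
Proof.
rewrite /charps coef_sum; apply: eq_bigr => s _.
have -> : (-1) ^+ s = ((-1) ^+ s)%:P :> {poly F} by rewrite polyC_exp polyCN polyC1.
by rewrite coefCM coef_prod_charps.
Qed.

Lemma deriv_prod (I : finType) (f : I -> {poly F}) :
  (\prod_i f i)^`() = \sum_i (f i)^`() * \prod_(j | j != i) f j.
Proof.
suff h (r : seq I) : uniq r ->
    (\prod_(i <- r) f i)^`() = \sum_(i <- r) (f i)^`() * \prod_(j <- r | j != i) f j.
  by rewrite h ?index_enum_uniq.
elim: r => [|x r IH] /=; first by rewrite !big_nil -polyC1 derivC.
case/andP=> xr ur; rewrite !big_cons derivM IH// eqxx /=; congr (_ * _ + _).
  by rewrite [RHS]big_seq_cond [LHS]big_seq; apply: eq_bigl => j; case: eqP => [->|_]; rewrite ?(negbTE xr) ?andbT.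
rewrite mulr_sumr big_seq [RHS]big_seq; apply: eq_bigr => i ir.
rewrite big_cons ifT; first by rewrite mulrCA.
by apply/eqP => e; rewrite e ir in xr.
Qed.

(** Jacobi's formula: the determinant is linear in each row, so one row at a time is differentiated
    ([Mi]) and expanded along. *)
Lemma deriv_det N (M : 'M[{poly F}]_N) :
  (\det M)^`() = \sum_i \sum_j (M i j)^`() * cofactor M i j.
Proof.
pose Mi i : 'M[{poly F}]_N := \matrix_(k, j) if k == i then (M k j)^`() else M k j.
transitivity (\sum_i \det (Mi i)).
  rewrite [in RHS]/determinant exchange_big /= raddf_sum; apply: eq_bigr => s _.
  rewrite (_ : (-1) ^+ s * _ = ((-1) ^+ s)%:P * \prod_i M i (s i)); last first.
    by rewrite polyC_exp polyCN polyC1.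
  rewrite /= derivM derivC mul0r add0r deriv_prod mulr_sumr; apply: eq_bigr => i _.
  rewrite polyC_exp polyCN polyC1; congr (_ * _).
  rewrite [RHS](bigD1 i) //= mxE eqxx; congr (_ * _).
  by apply: eq_bigr => j ji; rewrite mxE (negbTE ji).
apply: eq_bigr => i _; rewrite (expand_det_row _ i); apply: eq_bigr => j _.
rewrite mxE eqxx; congr (_ * _); rewrite /cofactor; congr (_ * \det _).
by apply/matrixP => k l; rewrite !mxE eq_sym (negbTE (neq_lift _ _)).
Qed.

(** Newton's identities. The coefficients [G l] of the adjugate of [1 - TA] satisfy a linear
    recursion, solved by [GE], and Jacobi's formula turns the derivative of the determinant into the
    traces of [A * G l]. *)
Lemma logd_charps N (A : 'M[F]_N.+1) :
  logd (charps A) (fun k => if k is 0 then 0 else - \tr (A ^+ k)).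
Proof.
set M := 1%:M - 'X *: map_mx polyC A.
pose G l : 'M[F]_N.+1 := \matrix_(i, j) (\adj M i j)`_l.
have e i j : \adj M i j = (\det M) *+ (i == j) + 'X * \sum_k \adj M i k * (A k j)%:P.
  have := mul_adj_mx M => /matrixP/(_ i j); rewrite {2}/M mulmxBr mulmx1 !mxE => <-.
  rewrite (_ : 'X * _ = \sum_k \adj M i k * ('X *: map_mx polyC A) k j) ?subrK//.
  by rewrite mulr_sumr; apply: eq_bigr => k _; rewrite mulrCA !mxE.
have G0 : G 0%N = (charps A 0%N)%:M.
  by apply/matrixP => i j; rewrite mxE e [RHS]mxE coefD coefXM addr0 coefMn.
have GS l : G l.+1 = G l * A + (charps A l.+1)%:M.
  apply/matrixP => i j; rewrite mxE e coefD coefXM coefMn addrC coef_sum.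
  rewrite [RHS]mxE [X in _ = X + _]mxE [X in _ = _ + X]mxE; congr (_ + _).
  by apply: eq_bigr => k _; rewrite coefMC [G l i k]mxE.
have GE l : G l = \sum_(i < l.+1) charps A i *: A ^+ (l - i).
  elim: l => [|l IH]; first by rewrite big_ord1 G0 expr0 scalemx1.
  rewrite GS IH [RHS]big_ord_recr /= subnn expr0 scalemx1; congr (_ + _).
  rewrite mulr_suml; apply: eq_bigr => i _.
  by rewrite -scalerAl -exprSr subSn// -ltnS.
move=> [|l].
  by rewrite mul0r coefM0_ps mulr0.
have -> : l.+1%:R * charps A l.+1 = ((\det M)^`())`_l.
  by rewrite coef_deriv mulr_natl.
rewrite deriv_det coef_sum coefM_ps [RHS]big_ord_recr /= subnn mulr0 addr0.
transitivity (- \tr (A * G l)).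
  rewrite /mxtrace -sumrN; apply: eq_bigr => i _; rewrite coef_sum mxE -sumrN.
  apply: eq_bigr => j _; rewrite !mxE derivB derivMn -polyC1 derivC mul0rn derivM derivX derivC mulr0 addr0 mul1r.
  by rewrite sub0r mulNr coefN coefCM.
rewrite GE mulr_sumr [\tr _]raddf_sum /= -sumrN; apply: eq_bigr => i _.
have il : (i <= l)%N by rewrite -ltnS.
by rewrite -scalerAr mxtraceZ -exprS subSn// mulrN.
Qed.

End CharSeries.

(** * Valuations of coefficients of characteristic series *)

Section CharSeriesValued.
Variables (R : realType) (F : fieldType) (ord : F -> \bar R).
Hypothesis ordP : is_valuation ord.
Local Notation vge := (vge ord).

Lemma vge_sign (b : nat) : vge 0 ((-1) ^+ b).
Proof. by apply: vgeX => //; rewrite vgeN//; exact: vge1. Qed.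

Lemma charps_vge N (A : 'M[F]_N) B m :
  (forall (s : 'S_N) (J : {set 'I_N}), #|J| = m -> perm_on J s ->
     vge B (\prod_(i in J) A i (s i))) -> vge B (charps A m).
Proof.
move=> h; rewrite charps_coef; apply: vge_sum => // s _; apply: vgeMl => //; first exact: vge_sign.
apply: vge_sum => // J /andP[/eqP Jm Js]; apply: vgeMl => //; first exact: vge_sign.
exact: h.
Qed.

Lemma charps_scong N (A A' : 'M[F]_N) C M :
  (forall i j, vcong ord C (A i j) (A' i j)) -> scong ord C M (charps A) (charps A').
Proof.
move=> h; have hc m : vcong ord C (charps A m) (charps A' m).
  rewrite !charps_coef; apply: vcong_sum => // s _.
  apply: vcongM => //; first by apply: vcong_refl => //; exact: vge_sign.
  apply: vcong_sum => // J _.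
  apply: vcongM => //; first by apply: vcong_refl => //; exact: vge_sign.
  by apply: vcong_prod => // i _; exact: h.
by split=> [m|m _] //; have [] := hc m.
Qed.

(** The zero columns make [1 - 'X A] block lower triangular with an identity corner. *)
Lemma charps_block N k (A : nat -> nat -> F) : (forall i j, (N <= j)%N -> A i j = 0) ->
  charps (\matrix_(i < N + k, j < N + k) A i j) = charps (\matrix_(i < N, j < N) A i j).
Proof.
move=> h; apply/funext => m; rewrite /charps.
set M : 'M[{poly F}]_(N + k) := 1%:M - 'X *: map_mx polyC (\matrix_(i < N + k, j < N + k) A i j).
have hur : ursubmx M = 0.
  apply/matrixP => i j; rewrite !mxE h /= ?leq_addr// mulr0 subr0.
  by rewrite -val_eqE /= ltn_eqF// (leq_trans (ltn_ord i))// leq_addr.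
have hdr : drsubmx M = 1%:M.
  apply/matrixP => i j; rewrite !mxE h /= ?leq_addr// mulr0 subr0.
  by rewrite -val_eqE /= eqn_add2l.
rewrite -(submxK M) hur hdr det_lblock det1 mulr1.
rewrite (_ : ulsubmx M = 1%:M - 'X *: map_mx polyC (\matrix_(i < N, j < N) A i j))//.
by apply/matrixP => i j; rewrite !mxE.
Qed.

End CharSeriesValued.

(** * Completeness of K and descent from C_p *)

Section FiniteExtension.
Variables (R : realType) (D : padic_setting R).

Lemma p_gt1 : (1 < p D)%N. Proof. exact: prime_gt1 (p_prime D). Qed.

Lemma q_gt1 : (1 < q D)%N.
Proof.
have [a a0 ->] := q_power D.
by rewrite -(expn0 (p D)) ltn_exp2l// p_gt1.
Qed.

Lemma ordpP : is_valuation (@ordp R D). Proof. by have [] := Qp_axiom D. Qed.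
Lemma ordKP : is_valuation (ord D). Proof. exact: ord_valuation. Qed.
Lemma ordCP : is_valuation (ordC D). Proof. by have [] := Cp_axiom D. Qed.
Lemma Cp_complete : is_complete (p D) (ordC D). Proof. by have [] := Cp_axiom D. Qed.
Lemma ordC_emb x : ordC D (embC D x) = ord D x. Proof. by have [_ /(_ x)] := Cp_axiom D. Qed.

Lemma natK_alg m : m%:R = (m%:R : Qp D)%:A :> K D.
Proof. by rewrite scaler_nat. Qed.

Lemma natQp_ord m : (0 < m)%N -> @ordp R D m%:R = (logn (p D) m)%:R%:E.
Proof.
move=> m0; have [_ h _ _] := Qp_axiom D.
have := h m%:R; rewrite ratr_nat pnatr_eq0 -lt0n => /(_ m0) ->.
by rewrite /padic_val (_ : m%:R = m%:Z%:~R :> rat)// numq_int denq_int !absz_nat logn1 subr0.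
Qed.

Lemma natK_neq0 m : m.+1%:R != 0 :> K D.
Proof.
apply/eqP => e; have [r r0 h] := ord_extends D.
have := h m.+1%:R; rewrite -natK_alg e (vord0 ordKP) natQp_ord//.
Qed.

Lemma natC_neq0 m : m.+1%:R != 0 :> Cp D.
Proof. by rewrite -(rmorph_nat (embC D)) fmorph_eq0 natK_neq0. Qed.

Lemma ord_q : exists2 e : R, 0 < e & ord D (q D)%:R = e%:E.
Proof.
have [a a0 qe] := q_power D; have [r r0 h] := ord_extends D.
exists (r * a%:R); first by rewrite mulr_gt0// ltr0n.
by rewrite natK_alg h natQp_ord ?qe ?pfactorK ?p_prime// expn_gt0 prime_gt0 ?p_prime.
Qed.

Lemma vge_q : vge (ord D) 0 (q D)%:R. Proof. exact: vge_nat ordKP _. Qed.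

Lemma ord_1Bq m : ord D (1 - (q D)%:R ^+ m.+1) = 0%E.
Proof.
have [e e0 he] := ord_q.
apply: (ord_1D ordKP e0); rewrite vgeN; last exact: ordKP.
rewrite exprSr; apply: (vgeMl ordKP); first exact: vgeX ordKP _ _ vge_q.
by rewrite /vge he.
Qed.

Lemma q_unit m : 1 - (q D)%:R ^+ m.+1 != 0 :> K D.
Proof. by apply/eqP => e; have := ord_1Bq m; rewrite e (vord0 ordKP). Qed.

(** Finite dimension over the complete field Q_p, by induction on generators: when [v] is
    independent of [X], the coordinate along [v] of a Cauchy sequence is itself Cauchy. *)
Lemma span_complete (X : seq (K D)) (u : nat -> K D) :
  (forall m, u m \in <<X>>%VS) ->
  (forall C, exists N : nat, forall m m', (N <= m)%N -> (N <= m')%N -> vge (ord D) C (u m - u m')) ->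
  exists2 l, l \in <<X>>%VS & converges_to (p D) (ord D) u l.
Proof.
elim: X u => [|v X IH] u uX hu.
  exists 0; first exact: mem0v.
  apply: (converges_to_const ordKP p_gt1 (N := 0)) => m _.
  by have := uX m; rewrite span_nil memv0 => /eqP.
have [vX|vX] := boolP (v \in <<X>>%VS).
  have e : <<v :: X>>%VS = <<X>>%VS by rewrite span_cons; apply/addv_idPr.
  by rewrite e in uX *; exact: IH.
(* [v] keeps a positive distance from the span of [X]: otherwise a sequence of that span, complete
   by induction, would converge to [v]. *)
have [dl hdl] : exists dl : R, forall w, w \in <<X>>%VS -> ~ vge (ord D) dl (v - w).
  apply: contrapT => hn.
  have h (m : nat) : exists w, w \in <<X>>%VS /\ vge (ord D) m%:R (v - w).
    apply: contrapT => hm; apply: hn; exists m%:R => w wX hw.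
    by apply: hm; exists w.
  have [w hw] := choice h.
  have [//|C|l lX hl] := IH w; first by move=> m; have [] := hw m.
    exists (Num.truncn C).+1 => m m' hm hm'.
    have hC k : ((Num.truncn C).+1 <= k)%N -> vge (ord D) C (v - w k).
      move=> hk; have [_] := hw k; apply: vgeW.
      by apply: (le_trans (ltW (truncnS_gt C))); rewrite ler_nat.
    have -> : w m - w m' = (v - w m') - (v - w m) by ring.
    by apply: (vgeB ordKP); apply: hC.
  have vl : v = l.
    apply: (converges_to_unique ordKP p_gt1) hl.
    apply/(converges_toP ordKP p_gt1) => C; exists (Num.truncn C).+1 => m hm.
    rewrite -opprB (vgeN ordKP); have [_] := hw m; apply: vgeW.
    by apply: (le_trans (ltW (truncnS_gt C))); rewrite ler_nat.
  by rewrite vl lX in vX.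
have h m : exists aw : Qp D * K D, aw.2 \in <<X>>%VS /\ u m = aw.1 *: v + aw.2.
  have := uX m; rewrite span_cons => /memv_addP[x /vlineP[a ->] [w wX ->]].
  by exists (a, w).
have [aw haw] := choice h; pose a m := (aw m).1; pose w m := (aw m).2.
have wX m : w m \in <<X>>%VS by have [] := haw m.
have ue m : u m = a m *: v + w m by have [] := haw m.
have [e e0 he] := ord_extends D.
(* Dividing the difference by its coordinate along [v] leaves [v] minus an element of the span, of
   valuation below [dl]; so the coordinate carries the valuation up to [dl]. *)
have ha C m m' : vge (ord D) C (u m - u m') -> vge (ord D) (C - dl) (a m - a m')%:A.
  have [->|am] := eqVneq (a m - a m') 0; first by rewrite scale0r => _; exact: vge0 ordKP _.
  have -> : u m - u m' = (a m - a m')%:A * (v - (a m - a m')^-1 *: (w m' - w m)).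
    rewrite mulr_algl scalerBr scalerA mulfV// scale1r !ue scalerBl.
    by rewrite opprB opprD addrACA.
  have := hdl ((a m - a m')^-1 *: (w m' - w m)) _; rewrite memvZ ?memvB// => /(_ isT).
  set y := v - _; rewrite /vge (ordM ordKP) => /negP; rewrite -ltNge => hy.
  have [s hs] : exists s : R, ord D (a m - a m')%:A = s%:E.
    by apply: (ord_fin ordKP); rewrite scaler_eq0 negb_or am oner_eq0.
  have [t ht] : exists t : R, ord D y = t%:E.
    by apply: (ord_fin ordKP); apply/eqP => y0; move: hy; rewrite y0 (vord0 ordKP).
  by move: hy; rewrite hs ht -EFinD !lee_fin lte_fin; lra.
have [al hal] : exists l, converges_to (p D) (@ordp R D) a l.
  have [_ _ hc _] := Qp_axiom D.
  move/(is_completeP ordpP p_gt1): hc; apply => C.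
  (* [dl] compensates the loss in [ha], and [e] converts [ordp] into [ord]. *)
  have [N hN] := hu (e * C + dl); exists N => m m' hm hm'.
  have := ha _ _ _ (hN m m' hm hm'); rewrite addrK /vge he.
  have [->|am] := eqVneq (a m - a m') 0; first by rewrite (vord0 ordpP) leey.
  have [s hs] := ord_fin ordpP am.
  by rewrite hs -EFinM !lee_fin ler_pM2l.
have hav : converges_to (p D) (ord D) (fun m => a m *: v) (al *: v).
  have [->|v0] := eqVneq v 0.
    by apply: (converges_to_const ordKP p_gt1 (N := 0)) => m _; rewrite !scaler0.
  have [t ht] := ord_fin ordKP v0.
  apply/(converges_toP ordKP p_gt1) => C.
  move/(converges_toP ordpP p_gt1)/(_ ((C - t) / e)): hal => [N hN]; exists N => m /hN.
  rewrite -scalerBl -mulr_algl /vge (ordM ordKP) ht he.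
  have [->|am] := eqVneq (a m - al) 0.
    by rewrite (vord0 ordpP) gt0_muley ?lte_fin// addye// !leey.
  have [s hs] := ord_fin ordpP am.
  by rewrite hs -EFinM -EFinD !lee_fin ler_pdivrMr// lerBlDr mulrC.
have [C|l lX hl] := IH w wX.
  have [N hN] := hu C.
  move/(converges_toP ordKP p_gt1)/(_ C): hav => [N' hN'].
  exists (maxn N N') => m m'; rewrite !geq_max => /andP[m1 m2] /andP[m3 m4].
  have -> : w m - w m' = (u m - u m') - ((a m *: v - al *: v) - (a m' *: v - al *: v)).
    by rewrite !ue; ring.
  by apply: (vgeB ordKP); [exact: hN|apply: (vgeB ordKP); exact: hN'].
exists (al *: v + l).
  by rewrite span_cons memv_add// memvZ// memv_line.
have := converges_toB ordKP p_gt1 hav (converges_toB ordKP p_gt1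
  (converges_to_const ordKP p_gt1 (u := fun=> 0) (l := 0) (N := 0) (fun _ _ => erefl)) hl).
by rewrite sub0r opprK (_ : (fun m => _) = u)//; apply/funext => m; rewrite sub0r opprK -ue.
Qed.

Lemma K_complete : is_complete (p D) (ord D).
Proof.
apply/(is_completeP ordKP p_gt1) => u hu.
have [m|l _ hl] := span_complete (X := vbasis {:K D}) _ hu; last by exists l.
by rewrite (span_basis (vbasisP _)) memvf.
Qed.

(** Completeness makes K closed in C_p; this brings the coefficients of [L], limits of elements of K
    computed over C_p, back to K. *)
Lemma embC_lim (u : nat -> K D) y :
  converges_to (p D) (ordC D) (fun m => embC D (u m)) y ->
  exists2 x, y = embC D x & converges_to (p D) (ord D) u x.
Proof.
move=> hy; have [C|x hx] := (is_completeP ordKP p_gt1).1 K_complete u.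
  have [N hN] := (converges_toP ordCP p_gt1 _ _).1 hy C; exists N => m m' hm hm'.
  rewrite /vge -ordC_emb rmorphB.
  have -> : embC D (u m) - embC D (u m') = (embC D (u m) - y) - (embC D (u m') - y) by ring.
  by apply: (vgeB ordCP); exact: hN.
exists x => //; apply: (converges_to_unique ordCP p_gt1 hy).
apply/(converges_toP ordCP p_gt1) => C; have [N hN] := (converges_toP ordKP p_gt1 _ _).1 hx C.
by exists N => m hm; rewrite -rmorphB /vge ordC_emb; exact: hN.
Qed.

End FiniteExtension.

(** * Roots of unity and Teichmueller lifts in C_p *)

Section RootsOfUnity.
Variables (R : realType) (D : padic_setting R).
Local Notation CpP := (ordCP D).

Lemma sum_unity (F : fieldType) (w : F) N : w ^+ N = 1 ->
  \sum_(i < N) w ^+ i = if w == 1 then N%:R else 0.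
Proof.
move=> wN; case: eqP => [->|/eqP w1].
  by rewrite (eq_bigr (fun=> 1)) ?sumr_const ?card_ord// => i _; rewrite expr1n.
apply: (mulfI (_ : w - 1 != 0)); first by rewrite subr_eq0.
by rewrite -subrX1 wN subrr mulr0.
Qed.

Lemma prim_root_exists N : (0 < N)%N -> exists z : Cp D, N.-primitive_root z.
Proof.
pose P : {poly Cp D} := 'X^N - 1; have [r Dp] := closed_field_poly_normal P.
move=> n_gt0; rewrite (monicP _) ?monicXnsubC // scale1r in Dp.
have rn1: all N.-unity_root r by apply/allP=> z; rewrite -root_prod_XsubC -Dp.
have sz_r: (N < (size r).+1)%N.
  by rewrite -(size_prod_XsubC r id) -Dp size_XnsubC.
have [|z] := hasP (has_prim_root n_gt0 rn1 _ sz_r); last by exists z.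
rewrite -separable_prod_XsubC -Dp separable_Xn_sub_1 //.
by rewrite -(prednK n_gt0) natC_neq0.
Qed.

(** The reason for using roots of unity of order [q ^ j - 1]: the order is a p-adic unit, so
    averaging over them loses no valuation. *)
Lemma ordC_qB1 j : (0 < j)%N -> ordC D (q D ^ j - 1)%:R = 0%E.
Proof.
case: j => // j _.
have -> : (q D ^ j.+1 - 1)%:R = - embC D (1 - (q D)%:R ^+ j.+1).
  by rewrite rmorphB rmorph1 rmorphXn rmorph_nat opprB natrB ?natrX// expn_gt0 ltnW ?q_gt1.
by rewrite (ordN CpP) ordC_emb ord_1Bq.
Qed.

Lemma q_exp_gt1 j : (0 < j)%N -> (1 < q D ^ j)%N.
Proof. by move=> j0; rewrite -(expn0 (q D)) ltn_exp2l ?q_gt1. Qed.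

Lemma ordC_unity x N : (0 < N)%N -> x ^+ N = 1 -> ordC D x = 0%E.
Proof.
move=> N0 xN; have x0 : x != 0.
  by apply/eqP => x0; move/eqP: xN; rewrite x0 expr0n gtn_eqF// eq_sym oner_eq0.
have [r hr] := ord_fin CpP x0.
have := ordX CpP N hr; rewrite xN (vord1 CpP) => -[/esym/eqP].
by rewrite mulf_eq0 pnatr_eq0 gtn_eqF//= hr => /eqP ->.
Qed.

Lemma vge_unity x N : (0 < N)%N -> x ^+ N = 1 -> vge (ordC D) 0 x.
Proof. by move=> N0 /(ordC_unity N0) h; rewrite /vge h. Qed.

Lemma red1 : red D 1 = 1. Proof. by have [] := kbar_residue D. Qed.

Lemma redD x y : vge (ordC D) 0 x -> vge (ordC D) 0 y -> red D (x + y) = red D x + red D y.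
Proof. by move=> hx hy; have [_ h _ _] := kbar_residue D; have [] := h x y hx hy. Qed.

Lemma redM x y : vge (ordC D) 0 x -> vge (ordC D) 0 y -> red D (x * y) = red D x * red D y.
Proof. by move=> hx hy; have [_ h _ _] := kbar_residue D; have [] := h x y hx hy. Qed.

Lemma red_eq0 x : vge (ordC D) 0 x -> red D x = 0 <-> (0 < ordC D x)%E.
Proof. by move=> hx; have [_ _ _ h] := kbar_residue D; exact: h. Qed.

Lemma red0 : red D 0 = 0.
Proof. by apply/red_eq0; rewrite ?(vord0 CpP)//; exact: vge0 CpP _. Qed.

Lemma redX x m : vge (ordC D) 0 x -> red D (x ^+ m) = red D x ^+ m.
Proof.
move=> hx; elim: m => [|m IH]; first by rewrite !expr0 red1.
by rewrite !exprS redM ?IH//; exact: vgeX CpP _ _ hx.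
Qed.

Lemma red_sum N (f : nat -> Cp D) : (forall i, vge (ordC D) 0 (f i)) ->
  red D (\sum_(i < N) f i) = \sum_(i < N) red D (f i).
Proof.
move=> hf; elim: N => [|N IH]; first by rewrite !big_ord0 red0.
by rewrite !big_ord_recr /= redD ?IH//; apply: (vge_sum CpP).
Qed.

Lemma red_nat m : red D m%:R = m%:R.
Proof.
elim: m => [|m IH]; first exact: red0.
by rewrite -!natr1 redD ?IH ?red1//; [exact: vge_nat CpP _|exact: vge1 CpP].
Qed.

(** If [x] were not 1, the sum of its powers would vanish, whereas it reduces to [q ^ j - 1], which
    is nonzero in the residue field. *)
Lemma red_unity x j : (0 < j)%N -> x ^+ (q D ^ j - 1) = 1 -> red D x = 1 -> x = 1.
Proof.
move=> j0; set N := (q D ^ j - 1)%N => xN rx.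
have N0 : (0 < N)%N by rewrite subn_gt0 q_exp_gt1.
have hx := vge_unity N0 xN.
have := sum_unity xN; case: eqP => // _ h.
have := congr1 (red D) h; rewrite red0 red_sum; last by move=> i; exact: vgeX CpP _ _ hx.
rewrite (eq_bigr (fun=> 1)); last by move=> i _; rewrite redX// rx expr1n.
rewrite sumr_const card_ord -red_nat => /red_eq0; rewrite ordC_qB1// ltxx.
by move=> /(_ (vge_nat CpP _)).
Qed.

Lemma expr_q_unity (F : fieldType) (x : F) j : (0 < j)%N ->
  x ^+ (q D ^ j - 1) = 1 -> x ^+ (q D ^ j) = x.
Proof. by move=> j0 h; rewrite -(subnK (ltnW (q_exp_gt1 j0))) exprD h mul1r expr1. Qed.

Lemma expr_q_unityV (F : fieldType) (x : F) j : (0 < j)%N -> x != 0 ->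
  x ^+ (q D ^ j) = x -> x ^+ (q D ^ j - 1) = 1.
Proof.
move=> j0 x0 h; apply: (mulfI x0); rewrite -exprS subn1 prednK ?h ?mulr1//.
by rewrite ltnW// q_exp_gt1.
Qed.

Lemma expr_q_mul (F : fieldType) (x : F) j i : x ^+ (q D ^ j) = x -> x ^+ (q D ^ (j * i)) = x.
Proof.
move=> h; elim: i => [|i IH]; first by rewrite muln0 expn0 expr1.
by rewrite mulnS expnD exprM h IH.
Qed.

Section Teichmuller.
Variables (M : nat) (z : Cp D).
Hypothesis M_gt0 : (0 < M)%N.
Let Q := (q D ^ M - 1)%N.
Hypothesis z_prim : Q.-primitive_root z.

Lemma Q_gt0 : (0 < Q)%N. Proof. by rewrite subn_gt0 q_exp_gt1. Qed.

Lemma vge_z i : vge (ordC D) 0 (z ^+ i).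
Proof. exact: (vgeX CpP _ (vge_unity Q_gt0 (prim_expr_order z_prim))). Qed.

Lemma zX_neq0 i : z ^+ i != 0.
Proof.
rewrite expf_neq0//; apply/eqP => z0.
have /eqP := prim_expr_order z_prim.
by rewrite z0 expr0n gtn_eqF ?Q_gt0// eq_sym oner_eq0.
Qed.

Lemma redX_eq1 i : (red D z ^+ i == 1) = (z ^+ i == 1).
Proof.
rewrite -redX; last by rewrite -[z]expr1 vge_z.
apply/eqP/eqP => [h|->]; last exact: red1.
by apply: (red_unity M_gt0) h; rewrite exprAC (prim_expr_order z_prim) expr1n.
Qed.

Lemma red_prim : Q.-primitive_root (red D z).
Proof.
apply/andP; split; first exact: Q_gt0.
apply/forallP => i; rewrite unity_rootE redX_eq1.
by case/andP: z_prim => _ /forallP/(_ i); rewrite unity_rootE.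
Qed.

(** [z ^+ i] qualifies. Two candidates with periods [d] and [M] have a quotient that is a root of
    unity of order dividing [q ^ (d * M) - 1] and reduces to 1, so [red_unity] gives uniqueness. *)
Lemma Teichmuller_red i : @Teichmuller R D (red D z ^+ i) = z ^+ i.
Proof.
have hz : vge (ordC D) 0 z by rewrite -[z]expr1 vge_z.
have zq : (z ^+ i) ^+ (q D ^ M) = z ^+ i.
  by apply: expr_q_unity M_gt0 _; rewrite exprAC (prim_expr_order z_prim) expr1n.
have e : red D (z ^+ i) = red D z ^+ i by rewrite redX.
rewrite /Teichmuller; case: xgetP => [x _ [hx rx [d d0 xd]]|/(_ (z ^+ i))]; last first.
  by case; split=> //; [exact: vge_z|exists M].
have zi0 := zX_neq0 i.
have hzi : ordC D (z ^+ i) = 0%E.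
  by apply: (ordC_unity Q_gt0); rewrite exprAC (prim_expr_order z_prim) expr1n.
have hziV : vge (ordC D) 0 (z ^+ i)^-1 by rewrite /vge (ordV CpP zi0 hzi) oppr0.
have rzi : red D (z ^+ i) != 0.
  by apply/eqP => /red_eq0; rewrite hzi ltxx => /(_ (vge_z i)).
suff : x / z ^+ i = 1 by move/(congr1 ( *%R^~ (z ^+ i))); rewrite divfK// mul1r.
have x0 : x != 0 by apply/eqP => x0; move: rzi; rewrite e -rx x0 red0 eqxx.
apply: (@red_unity _ (d * M)); first by rewrite muln_gt0 d0.
  apply: expr_q_unityV; rewrite ?muln_gt0 ?d0 ?mulf_neq0 ?invr_eq0//.
  by rewrite exprMn exprVn expr_q_mul// mulnC expr_q_mul.
apply: (mulfI rzi); rewrite mulr1 -redM//; last exact: vgeMl CpP _ _ _ _ _.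
  by rewrite mulrC divfK// rx e.
exact: vge_z.
Qed.

End Teichmuller.

Lemma ordC_int (i : int) : exists2 y : Cp D, y != 0 & ordC D y = i%:~R%:E.
Proof.
have hu : ordC D (embC D (@unif R D)) = 1%:E by rewrite ordC_emb ord_unif.
have u0 : embC D (@unif R D) != 0 by apply/eqP => e; move: hu; rewrite e (vord0 CpP).
case: i => m.
  exists (embC D (@unif R D) ^+ m); first exact: expf_neq0.
  by rewrite (ordX CpP m hu) mulr1.
have um := expf_neq0 m.+1 u0.
exists (embC D (@unif R D) ^+ m.+1)^-1; first by rewrite invr_eq0.
by rewrite (ordV CpP um (ordX CpP m.+1 hu)) mulr1 NegzE mulrNz.
Qed.

(** An [m]-th root, in the algebraically closed field, of a power of the uniformizer; it supplies
    circles whose radius has any rational exponent. *)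
Lemma ordC_ratio (i : int) (m : nat) : (0 < m)%N ->
  exists2 y : Cp D, y != 0 & ordC D y = (i%:~R / m%:R)%:E.
Proof.
move=> m0; have [y y0 hy] := ordC_int i.
have [x hx] := @solve_monicpoly (Cp D) m (fun i => if i == 0%N then y else 0) m0.
have xm : x ^+ m = y.
  rewrite hx -(prednK m0) big_ord_recl /= expr0 mulr1 big1 ?addr0// => j _.
  by rewrite mul0r.
have x0 : x != 0 by apply/eqP => x0; move: y0; rewrite -xm x0 expr0n gtn_eqF// eqxx.
exists x => //; have [r hr] := ord_fin CpP x0.
have := ordX CpP m hr; rewrite xm hy hr => -[->].
by congr (_%:E); rewrite mulrC mulKf// pnatr_eq0 gtn_eqF.
Qed.

(* Averaging a polynomial of degree < N against the N-th roots of unity isolates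
   a coefficient: this is the maximum principle on a circle of C_p. *)
Lemma root_unity_average j (b : nat -> Cp D) m : (0 < j)%N -> (m < q D ^ j - 1)%N ->
  (forall x, x ^+ (q D ^ j - 1) = 1 ->
     vge (ordC D) 0 (\sum_(l < q D ^ j - 1) b l * x ^+ l)) ->
  vge (ordC D) 0 (b m).
Proof.
move=> j0; set N := (q D ^ j - 1)%N => mN hb.
have [z zp] := prim_root_exists (leq_trans (ltn0Sn _) mN).
have zN := prim_expr_order zp.
apply: (vge_unitMl CpP (ordC_qB1 j0)); rewrite -/N.
(* The exponent [N - m] stands for [- m], as [z ^+ N = 1]. *)
suff -> : N%:R * b m = \sum_(i < N) z ^+ (i * (N - m)) * (\sum_(l < N) b l * (z ^+ i) ^+ l).
  apply: (vge_sum CpP) => i _; apply: (vgeMl CpP).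
    by apply: (vge_unity (leq_trans (ltn0Sn _) mN)); rewrite exprAC zN expr1n.
  by apply: hb; rewrite exprAC zN expr1n.
transitivity (\sum_(l < N) b l * \sum_(i < N) (z ^+ (N - m + l)) ^+ i).
  rewrite (bigD1 (Ordinal mN)) //= [X in _ + X]big1 ?addr0 => [|l lm].
    by rewrite subnK ?(ltnW mN)// zN sum_unity ?expr1n// eqxx mulrC.
  rewrite sum_unity; last by rewrite exprAC zN expr1n.
  rewrite -(prim_order_dvd zp) ifF ?mulr0//; apply/negP => /dvdnP[k hk].
  move/eqP: lm; apply; apply/val_inj => /=.
  have := ltn_ord l; move: hk; case: k => [|[|k]] hk lN; first lia.
    lia.
  have : (N + N <= k.+2 * N)%N by rewrite !mulSn; lia.
  lia.
under [RHS]eq_bigr do rewrite mulr_sumr.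
rewrite exchange_big /=; apply: eq_bigr => l _; rewrite mulr_sumr.
by apply: eq_bigr => i _; rewrite mulrCA -!exprM -exprD -mulnDr mulnC.
Qed.

End RootsOfUnity.

(** * Coefficients of 1-units *)

Section OneUnit.
Variables (R : realType) (D : padic_setting R).
Local Notation CpP := (ordCP D).
Local Notation p1 := (p_gt1 D).

Lemma partial_sums_cvg (b : nat -> Cp D) :
  (forall C, exists N, forall l, (N <= l)%N -> vge (ordC D) C (b l)) ->
  forall y, vlim (p D) (ordC D) (fun N => \sum_(l < N) b l) = y ->
  forall C N, (forall l, (N <= l)%N -> vge (ordC D) C (b l)) ->
  vge (ordC D) C (y - \sum_(l < N) b l).
Proof.
have hd C N : (forall l, (N <= l)%N -> vge (ordC D) C (b l)) ->
    forall m, (N <= m)%N -> vge (ordC D) C (\sum_(l < m) b l - \sum_(l < N) b l).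
  move=> h m Nm.
  have -> : \sum_(l < m) b l = \sum_(l < N) b l + \sum_(N <= l < m) b l.
    by rewrite -!(big_mkord xpredT b) -big_cat_nat.
  rewrite addrAC subrr add0r big_nat_cond.
  by apply: (vge_sum CpP) => i /andP[/andP[? _] _]; exact: h.
move=> hb y <- C N hN.
have hc := complete_approx CpP p1 (u := fun N => \sum_(l < N) b l) (@Cp_complete R D).
have {hc} hc : converges_to (p D) (ordC D) (fun N => \sum_(l < N) b l)
    (vlim (p D) (ordC D) (fun N => \sum_(l < N) b l)).
  by apply: hc => C'; have [N' hN'] := hb C'; exists N', (\sum_(l < N') b l); exact: hd.
have h0 : converges_to (p D) (ordC D) (fun=> \sum_(l < N) b l) (\sum_(l < N) b l).
  by apply: (converges_to_const CpP p1 (N := 0)).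
by apply: (vge_lim CpP p1 (N := N) (converges_toB CpP p1 hc h0)) => m Nm; exact: hd.
Qed.

Lemma closed_discE (c' : R) t : closed_disc c' t <-> vge (ordC D) (- c') t.
Proof. by rewrite /closed_disc /= -{1}[c']opprK; exact: (absv_le CpP p1). Qed.

(** On the circle through [s] the values are bounded by the sup-norm 1; averaging over the points
    [x * s], with [x] a root of unity of large order, isolates one coefficient. *)
Lemma one_unit_coef (a : nat -> K D) (c' rho : R) (s : Cp D) m : one_unit a c' ->
  s != 0 -> ordC D s = (- rho)%:E -> rho <= c' -> vge (ordC D) 0 (embC D (a m) * s ^+ m).
Proof.
move=> [hcv _ hsup] s0 hs rc.
pose b l := embC D (a l) * s ^+ l.
have pc : 0 < (p D)%:R `^ c' by apply: powR_gt0; rewrite ltr0n ltnW// p1.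
have hb C : exists N, forall l, (N <= l)%N -> vge (ordC D) C (b l).
  have /cvgr0Pnorm_lt/(_ ((p D)%:R `^ (- C))) := hcv.
  case=> [|N _ hN]; first by apply: powR_gt0; rewrite ltr0n ltnW// p1.
  exists N => l /hN /=; rewrite /b.
  have [->|al] := eqVneq (a l) 0; first by rewrite rmorph0 mul0r => _; exact: vge0 CpP _.
  have [t ht] := ord_fin (ordKP D) al.
  rewrite /vge (ordM CpP) ordC_emb ht (ordX CpP l hs) -EFinD lee_fin.
  have P1 : 1 < (p D)%:R :> R by rewrite ltr1n p1.
  have a0 : 0 <= absv (p D) (ord D) (a l) by rewrite /absv; case: ifP => // _; exact: powR_ge0.
  rewrite ger0_norm; last by rewrite mulr_ge0// exprn_ge0// ltW.
  rewrite /absv (negbTE al) ht /= -powR_mulrn ?powR_ge0// -powRrM.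
  rewrite -powRD; last by apply/implyP => _; rewrite gt_eqF// (lt_trans ltr01 P1).
  rewrite /powR gt_eqF ?(lt_trans ltr01 P1)// ltr_expR ltr_pM2r ?ln_gt0// => h.
  have : rho * l%:R <= c' * l%:R by rewrite ler_wpM2r.
  by rewrite mulrN; lra.
have [N hN] := hb 0.
(* The order [q ^ j - 1] must exceed [m], and also [N], beyond which all terms are integral, so that
   the series may be cut to a polynomial. *)
have [j j0 hj] : exists2 j, (0 < j)%N & (maxn N m < q D ^ j - 1)%N.
  exists (maxn N m).+2 => //; have := ltn_expl (maxn N m).+2 (q_gt1 D).
  by lia.
apply: (root_unity_average (b := b) j0); first by rewrite (leq_ltn_trans _ hj)// leq_maxr.
move=> x xN; set Q := (q D ^ j - 1)%N in hj xN *.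
have Q0 : (0 < Q)%N by apply: leq_trans hj.
have hx := ordC_unity Q0 xN.
have hxv := vge_unity Q0 xN.
pose t := x * s.
have ht : closed_disc c' t.
  by apply/closed_discE; rewrite /t /vge (ordM CpP) hx add0e hs lee_fin lerN2.
pose y := eval_ps a t.
have hy : vge (ordC D) 0 y.
  apply/(absv_le CpP p1); rewrite oppr0 powRr0 -lee_fin.
  by rewrite -[leRHS]/1%E -hsup; apply: ereal_sup_ubound; exists t.
have ey : eval_ps a t = vlim (p D) (ordC D) (fun N => \sum_(l < N) b l * x ^+ l).
  congr (vlim _ _ _); apply/funext => M; apply: eq_bigr => l _.
  by rewrite /b /t exprMn mulrCA mulrC.
apply: (vge_trans CpP hy); rewrite /y.
apply: (partial_sums_cvg (b := fun l => b l * x ^+ l)) => //.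
  move=> C; have [N' hN'] := hb C; exists N' => l /hN' h.
  by apply: (vgeMr CpP) => //; exact: vgeX CpP _ _ hxv.
move=> l Ql; apply: (vgeMr CpP); last exact: vgeX CpP _ _ hxv.
by apply: hN; apply: leq_trans Ql; apply: leq_trans (ltnW hj); exact: leq_maxl.
Qed.

(** The disc need not contain points of valuation exactly [- c'], so rational exponents approach
    [c'] from below and [vge_closed] gives the bound in the limit. *)
Lemma one_unit_growth (a : nat -> K D) (c' : R) : one_unit a c' -> growth (ord D) c' 0 a.
Proof.
move=> ha m; rewrite subr0; apply: (vge_closed (ordKP D)) => C hC.
have [->|am] := eqVneq (a m) 0; first exact: vge0 (ordKP D) _.
have [t ht] := ord_fin (ordKP D) am.
rewrite (vge_le_ord _ ht).
(* Rounding [c'] to a multiple of [1 / B] costs at most [m / B] in degree [m]; [B] makes this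
   smaller than the margin [c' * m - C]. *)
pose B := (Num.truncn (m%:R / (c' * m%:R - C))).+1.
have B0 : 0 < B%:R :> R by rewrite ltr0n.
have hB : m%:R / B%:R < c' * m%:R - C.
  by rewrite ltr_pdivrMr// mulrC -ltr_pdivrMr ?subr_gt0// truncnS_gt.
have [s s0 hs] := @ordC_ratio R D (Num.ceil (- c' * B%:R)) B isT.
have h1 : - c' * B%:R <= (Num.ceil (- c' * B%:R))%:~R by exact: ceil_ge.
have h2 : (Num.ceil (- c' * B%:R))%:~R < - c' * B%:R + 1 by have := ceilB1_lt (- c' * B%:R); rewrite intrB ltrBlDr.
set r := (Num.ceil _)%:~R / B%:R in hs.
have r1 : - c' <= r by rewrite /r ler_pdivlMr.
have r2 : r <= - c' + B%:R^-1.
  by rewrite /r ler_pdivrMr// mulrDl mulVf ?gt_eqF// ltW.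
have := one_unit_coef (s := s) (rho := - r) m ha s0; rewrite opprK hs => /(_ erefl).
rewrite lerNl => /(_ r1).
rewrite /vge (ordM CpP) ordC_emb ht (ordX CpP m hs) -EFinD lee_fin.
have : m%:R * r <= m%:R * (- c' + B%:R^-1) by rewrite ler_wpM2l.
by rewrite mulrDr mulrN; lra.
Qed.

End OneUnit.

(** * Points of G_m^n as vectors of exponents *)

Section Points.
Variables (R : realType) (D : padic_setting R) (n M : nat) (z : Cp D).
Hypothesis M_gt0 : (0 < M)%N.
Local Notation Q := (q D ^ M - 1)%N.
Hypothesis z_prim : Q.-primitive_root z.

Local Notation Q0 := (Q_gt0 D M_gt0).
Local Notation zr_prim := (red_prim M_gt0 z_prim).

(* The point (zeta^(a_i))_i of G_m^n over C_p, resp. over its residue field. *)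
Definition lift_pt (a : {ffun 'I_n -> 'I_Q}) : 'rV[Cp D]_n := \row_i z ^+ a i.
Definition red_pt (a : {ffun 'I_n -> 'I_Q}) : 'rV[kbar D]_n := \row_i red D z ^+ a i.

(** Frobenius seen on exponents is multiplication by q modulo Q; orbits become subsets of a finite
    type. *)
Definition frob_exp (a : {ffun 'I_n -> 'I_Q}) : {ffun 'I_n -> 'I_Q} :=
  [ffun i => Ordinal (ltn_pmod (q D * a i) Q0)].

Lemma frob_powS (F : fieldType) e (x : 'rV[F]_n) :
  frob_pow D e.+1 x = frob_pow D e (frob_pow D 1 x).
Proof. by apply/rowP => i; rewrite !mxE -exprM expnS expn1. Qed.

Lemma frob_pow0 (F : fieldType) (x : 'rV[F]_n) : frob_pow D 0 x = x.
Proof. by apply/rowP => i; rewrite !mxE expn0 expr1. Qed.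

Lemma lift_frob k a : lift_pt (iter k frob_exp a) = frob_pow D k (lift_pt a).
Proof.
elim: k a => [|k IH] a; first by rewrite frob_pow0.
rewrite iterSr IH frob_powS; congr frob_pow; apply/rowP => i.
by rewrite !mxE ffunE /= (prim_expr_mod z_prim) -exprM mulnC expn1.
Qed.

Lemma red_frob k a : red_pt (iter k frob_exp a) = frob_pow D k (red_pt a).
Proof.
elim: k a => [|k IH] a; first by rewrite frob_pow0.
rewrite iterSr IH frob_powS; congr frob_pow; apply/rowP => i.
by rewrite !mxE ffunE /= (prim_expr_mod zr_prim) -exprM mulnC expn1.
Qed.

Lemma red_pt_inj : injective red_pt.
Proof.
move=> a b /rowP h; apply/ffunP => i; apply/val_inj.
have := h i; rewrite !mxE => /eqP; rewrite (eq_prim_root_expr zr_prim).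
by rewrite !modn_small// => /eqP.
Qed.

Lemma Teichmuller_pt a : map_mx (@Teichmuller R D) (red_pt a) = lift_pt a.
Proof. by apply/rowP => i; rewrite !mxE (Teichmuller_red M_gt0 z_prim). Qed.

Lemma ordC_lift_pt a i : ordC D (lift_pt a 0 i) = 0%E.
Proof.
by rewrite mxE; apply: (ordC_unity Q0); rewrite exprAC (prim_expr_order z_prim) expr1n.
Qed.

Lemma frob_exp_period a : iter M frob_exp a = a.
Proof.
apply: red_pt_inj; rewrite red_frob; apply/rowP => i; rewrite !mxE.
by apply: expr_q_unity => //; rewrite exprAC (prim_expr_order zr_prim) expr1n.
Qed.

Lemma iter_frob_inj k : injective (iter k frob_exp).
Proof.
have inj1 : injective frob_exp.
  move=> a b h; rewrite -[a]frob_exp_period -[b]frob_exp_period.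
  have e c : iter M frob_exp c = iter M.-1 frob_exp (frob_exp c) by rewrite -iterSr prednK.
  by rewrite !e h.
by elim: k => // k IH a b /= /inj1 /IH.
Qed.

Lemma frob_exp_mod k a : iter (k %% M) frob_exp a = iter k frob_exp a.
Proof.
rewrite {2}(divn_eq k M) addnC iterD; congr iter.
by elim: (k %/ M)%N => // j IH; rewrite mulSn iterD -IH frob_exp_period.
Qed.

Definition has_deg d a :=
  (iter d frob_exp a == a) && [forall e : 'I_d, (0 < e)%N ==> (iter e frob_exp a != a)].

Definition orb a : {set {ffun 'I_n -> 'I_Q}} := [set iter (e : 'I_M) frob_exp a | e in 'I_M].

Lemma orbP a b : reflect (exists e, b = iter e frob_exp a) (b \in orb a).
Proof.
apply: (iffP imsetP) => [[e _ ->]|[e ->]]; first by exists e.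
by exists (Ordinal (ltn_pmod e M_gt0)); rewrite //= frob_exp_mod.
Qed.

Lemma orb_sym a b : b \in orb a -> a \in orb b.
Proof.
case/orbP=> e ->; apply/orbP; exists (M * e - e)%N.
rewrite -iterD subnK; last by rewrite leq_pmull.
by rewrite -frob_exp_mod modnMr.
Qed.

Lemma orb_trans a b c : b \in orb a -> c \in orb b -> c \in orb a.
Proof.
by case/orbP=> e -> /orbP[e' ->]; apply/orbP; exists (e' + e)%N; rewrite iterD.
Qed.

Lemma orb_eq a b : (orb b == orb a) = (b \in orb a).
Proof.
apply/eqP/idP => [<-|h]; first by apply/orbP; exists 0%N.
apply/setP => c; apply/idP/idP => hc; first exact: orb_trans hc.
by apply: orb_trans hc; exact: orb_sym.
Qed.

Lemma has_deg_orb d a b : b \in orb a -> has_deg d b = has_deg d a.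
Proof.
case/orbP=> e ->; rewrite /has_deg.
have h k : (iter k frob_exp (iter e frob_exp a) == iter e frob_exp a) = (iter k frob_exp a == a).
  by rewrite -iterD addnC iterD (inj_eq (@iter_frob_inj e)).
rewrite h; congr (_ && _); apply: eq_forallb => k; rewrite h.
by [].
Qed.

Lemma has_deg_mod d a k : has_deg d a -> iter (k %% d) frob_exp a = iter k frob_exp a.
Proof.
case/andP=> /eqP h _; rewrite {2}(divn_eq k d) addnC iterD; congr iter.
by elim: (k %/ d)%N => // j IH; rewrite mulSn iterD -IH h.
Qed.

Lemma has_deg_dvd d a k : (0 < d)%N -> has_deg d a -> (iter k frob_exp a == a) = (d %| k)%N.
Proof.
move=> d0 hd; rewrite -(has_deg_mod k hd) /dvdn.
case/andP: (hd) => _ /forallP/(_ (Ordinal (ltn_pmod k d0))) /=.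
by case: (k %% d)%N => [|j] /=; [rewrite eqxx|move/negbTE].
Qed.

Lemma card_orb d a : (0 < d)%N -> has_deg d a -> #|orb a| = d.
Proof.
move=> d0 hd.
have -> : orb a = [set iter (e : 'I_d) frob_exp a | e in 'I_d]%SET.
  apply/setP => b; apply/orbP/imsetP => [[e ->]|[e _ ->]]; last by exists e.
  by exists (Ordinal (ltn_pmod e d0)); rewrite //= has_deg_mod.
rewrite card_imset ?card_ord// => e e'.
wlog le : e e' / (e <= e')%N => [hw h|].
  by case: (leqP e e') => [|/ltnW] /hw; [apply|move/(_ (esym h))].
move=> h; apply/val_inj/eqP; rewrite eqn_leq le /= -subn_eq0; apply/eqP.
have : iter (e' - e) frob_exp a == a.
  by apply/eqP; apply: (@iter_frob_inj e); rewrite -iterD subnKC// h.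
rewrite (has_deg_dvd _ d0 hd) => /dvdnP[k hk].
have := leq_ltn_trans (leq_subr e e') (ltn_ord e'); rewrite hk.
by case: k hk => [|k] //; rewrite mulSn; lia.
Qed.

Definition orbs d : {set {set {ffun 'I_n -> 'I_Q}}} := [set orb a | a in has_deg d].

Definition pts (C : {set {ffun 'I_n -> 'I_Q}}) : set 'rV[kbar D]_n := red_pt @` [set` C].

Lemma pts_inj : injective pts.
Proof.
move=> A B h; apply/setP => a; apply/idP/idP => ha.
  have : pts B (red_pt a) by rewrite -h; exists a.
  by case=> b hb /red_pt_inj <-.
have : pts A (red_pt a) by rewrite h; exists a.
by case=> b hb /red_pt_inj <-.
Qed.

Lemma pts_orb a : pts (orb a) = range (fun e => frob_pow D e (red_pt a)).
Proof.
apply/seteqP; split=> [_ [b /= /orbP[e ->] <-]|_ [e _ <-]].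
  by exists e; rewrite // red_frob.
by exists (iter e frob_exp a); rewrite ?red_frob //=; apply/orbP; exists e.
Qed.

(** As [d] divides [M], the coordinates of a point of degree [d] are [Q]-th roots of unity, hence
    powers of the primitive root [red D z]. *)
Lemma closed_pointsE d : (0 < d)%N -> (d %| M)%N ->
  @closed_points R D n d = pts @` [set` orbs d].
Proof.
move=> d0 dM; apply/seteqP; split=> [X [x [x0 _ xd xm] ->]|_ [C /= /imsetP[a ha ->] <-]].
  have hx i : exists j : 'I_Q, x 0 i = red D z ^+ j.
    have : x 0 i ^+ Q = 1.
      apply: expr_q_unityV => //; have := congr1 (fun y : 'rV_n => y 0 i) xd.
      by rewrite mxE => h; rewrite -(divnK dM) mulnC; exact: expr_q_mul.
    by move/(prim_rootP zr_prim) => [j ->]; exists j.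
  have [g hg] := choice hx; pose a := [ffun i => g i].
  have xa : x = red_pt a by apply/rowP => i; rewrite mxE ffunE hg.
  exists (orb a); last by rewrite pts_orb xa.
  apply/imsetP; exists a => //; apply/andP; split.
    by apply/eqP/red_pt_inj; rewrite red_frob -xa.
  apply/forallP => e; apply/implyP => e0; apply/eqP => he.
  by apply: (xm e); rewrite ?e0 ?ltn_ord// xa -red_frob he.
exists (red_pt a); last by rewrite pts_orb.
case/andP: ha => /eqP h1 /forallP h2; split=> //.
- by move=> i; rewrite mxE expf_neq0//; apply/eqP => e;
    have /eqP := prim_expr_order zr_prim; rewrite e expr0n gtn_eqF ?Q0// eq_sym oner_eq0.
- by rewrite -red_frob h1.
- move=> e /andP[e0 ed]; rewrite -red_frob => /red_pt_inj /eqP.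
  by apply/negP; have := h2 (Ordinal ed); rewrite e0.
Qed.

Lemma big_closed_points d (f : set 'rV[kbar D]_n -> fps (Cp D)) : (0 < d)%N -> (d %| M)%N ->
  \big[@psmul (Cp D)/@ps1 (Cp D)]_(O \in @closed_points R D n d) f O =
  \prod_(C in orbs d) f (pts C).
Proof.
move=> d0 dM; rewrite closed_pointsE//.
transitivity (\big[@GRing.mul (fps (Cp D))/1]_(O \in pts @` [set` orbs d]) f O) => //.
rewrite fsbig_image; last by move=> A B _ _; exact: pts_inj.
rewrite -big_enum /= [RHS]fsbig_seq ?enum_uniq// (_ : [set` enum (orbs d)] = [set` orbs d])//.
by apply/seteqP; split=> C /=; rewrite mem_enum.
Qed.

(** The representative picked by [xget] is unknown; only its membership in the orbit can be used. *)
Lemma closed_point_lift_pts d C : C \in orbs d ->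
  exists a, [/\ has_deg d a, orb a = C & closed_point_lift (pts C) = lift_pt a].
Proof.
case/imsetP=> a ha ->; rewrite /closed_point_lift.
case: xgetP => [x _ [b /= hb <-]|/(_ (red_pt a))]; last first.
  by case; exists a => //=; apply/orbP; exists 0%N.
exists b; rewrite Teichmuller_pt (has_deg_orb _ hb); split=> //.
by apply/eqP; rewrite orb_eq.
Qed.

(** The multiplicity [d] is the cardinality of the orbit. *)
Lemma sum_orbs d (V : zmodType) (g : {ffun 'I_n -> 'I_Q} -> V)
    (h : {set {ffun 'I_n -> 'I_Q}} -> V) : (0 < d)%N ->
  (forall C a, C \in orbs d -> a \in C -> g a = h C) ->
  \sum_(C in orbs d) h C *+ d = \sum_(a | has_deg d a) g a.
Proof.
move=> d0 gh; rewrite [RHS](partition_big orb (mem (orbs d))); last first.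
  by move=> a ha; apply/imsetP; exists a.
apply: eq_bigr => C hC; case/imsetP: (hC) => a ha Ca.
rewrite -{1}(card_orb d0 ha) -Ca -sumr_const; apply: eq_big => [b|b bC]; last by rewrite (gh C).
rewrite Ca orb_eq; case: (boolP (b \in orb a)) => hb; last by rewrite andbF.
by rewrite (has_deg_orb _ hb) (ha : has_deg d a).
Qed.

End Points.

(** * Finite boxes of exponents *)

Section Box.
Variable n : nat.
Implicit Types u v : 'rV[int]_n.

Lemma l1_coord u i : (`|u 0%R i| <= l1 u)%N.
Proof. by rewrite /l1 (bigD1 i) //= leq_addr. Qed.

Lemma finite_ball N : finite_set [set u : 'rV[int]_n | (l1 u <= N)%N].
Proof.
pose g (f : {ffun 'I_n -> 'I_(N + N).+1}) : 'rV[int]_n := \row_i ((f i)%:Z - N%:Z).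
apply: (@sub_finite_set _ _ (g @` setT)); last by apply: finite_image; exact: finite_finset.
move=> u /= hu; exists [ffun i => inord `|u 0%R i + N%:Z|] => //.
apply/rowP => i; rewrite mxE ffunE; have := leq_trans (l1_coord u i) hu => h.
by rewrite inordK; lia.
Qed.

Definition box N : seq 'rV[int]_n := fset_set [set u : 'rV[int]_n | (l1 u <= N)%N].

Lemma mem_box N u : (u \in box N) = (l1 u <= N)%N.
Proof.
rewrite /box in_fset_set; last exact: finite_ball.
by apply/idP/idP => [/set_mem//|h]; exact: mem_set.
Qed.

Lemma uniq_box N : uniq (box N). Proof. exact: fset_uniq. Qed.

Lemma sum_ball (V : zmodType) N (f : 'rV[int]_n -> V) :
  \sum_(u \in [set u : 'rV[int]_n | (l1 u <= N)%N]) f u = \sum_(u <- box N) f u.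
Proof. by rewrite fsbig_finite//; exact: finite_ball. Qed.

Lemma sum_box (V : zmodType) N m (f : 'rV[int]_n -> V) : (N <= m)%N ->
  \sum_(u <- box m) f u =
  \sum_(u <- box N) f u + \sum_(u <- box m | (N < l1 u)%N) f u.
Proof.
move=> Nm; rewrite (bigID (fun u => l1 u <= N)%N) /=; congr (_ + _).
  rewrite -big_filter; apply: perm_big; apply: uniq_perm; rewrite ?filter_uniq ?uniq_box//.
  move=> u; rewrite mem_filter !mem_box; case: (leqP (l1 u) N) => //= h.
  by rewrite (leq_trans h).
by apply: eq_bigl => u; rewrite -ltnNge.
Qed.

Lemma l1D u v : (l1 (u + v)%R <= l1 u + l1 v)%N.
Proof. by rewrite /l1 -big_split; apply: leq_sum => i _; rewrite mxE /=; lia. Qed.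

Lemma l1N u : l1 (- u)%R = l1 u.
Proof. by apply: eq_bigr => i _; rewrite mxE abszN. Qed.

Lemma l1B u v : (l1 (u - v)%R <= l1 u + l1 v)%N.
Proof. by rewrite -[in X in (_ <= X)%N](l1N v) l1D. Qed.

Lemma l1Mn u m : l1 (u *+ m)%R = (m * l1 u)%N.
Proof.
rewrite /l1 big_distrr; apply: eq_bigr => i _ /=.
by rewrite mulmxnE -mulr_natl abszM natz absz_nat.
Qed.

Lemma l1_0 : l1 (0 : 'rV[int]_n) = 0%N.
Proof. by apply: big1 => i _; rewrite mxE. Qed.

End Box.

(** * Continuity of L in the matrix B *)

Section LContinuity.
Variables (R : realType) (D : padic_setting R) (n : nat).
Local Notation CpP := (ordCP D).
Local Notation KP := (ordKP D).
Local Notation p1 := (p_gt1 D).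
Local Notation vgeC := (vge (ordC D)).
Local Notation vgeK := (vge (ord D)).
Local Notation vcongC := (vcong (ordC D)).

Lemma vcong_lim C u u' l l' : converges_to (p D) (ordC D) u l ->
  converges_to (p D) (ordC D) u' l' -> (forall m : nat, vcongC C (u m) (u' m)) -> vcongC C l l'.
Proof.
move=> hu hu' h; split.
- by apply: (vge_lim CpP p1 (N := 0) hu) => m _; have [] := h m.
- by apply: (vge_lim CpP p1 (N := 0) hu') => m _; have [] := h m.
- by apply: (vge_vlim CpP p1 hu hu') => m; have [] := h m.
Qed.

Definition mono (x : 'rV[Cp D]_n) (u : 'rV[int]_n) : Cp D := \prod_i (x 0 i) ^ (u 0 i).

Lemma ordC_exprz (y : Cp D) (i : int) : ordC D y = 0%E -> ordC D (y ^ i) = 0%E.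
Proof.
move=> hy; have y0 : y != 0 by apply/eqP => e; move: hy; rewrite e (vord0 CpP).
have h m : ordC D (y ^+ m) = 0%E by rewrite (ordX CpP m hy) mulr0.
case: i => m; first exact: h.
by rewrite NegzE -exprnN (ordV CpP _ (h m.+1)) ?oppr0 ?expf_neq0.
Qed.

Definition unit_pt (x : 'rV[Cp D]_n) := forall i, ordC D (x 0 i) = 0%E.

Lemma vge_mono x u : unit_pt x -> vgeC 0 (mono x u).
Proof.
move=> hx; apply: (big_ind (vgeC 0)) => [|y y' hy hy'|i _]; first exact: vge1 CpP.
  exact: (vgeMl CpP).
by rewrite /vge ordC_exprz.
Qed.

Lemma eval_series_cvg (a : series_over D n) x : unit_pt x ->
  (forall C, exists N : nat, forall u, (N <= l1 u)%N -> vgeK C (a u)) ->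
  converges_to (p D) (ordC D) (fun N => \sum_(u <- box n N) embC D (a u) * mono x u)
    (eval_series a x).
Proof.
move=> hx ha; rewrite /eval_series.
rewrite (_ : (fun N : nat => _) = (fun N => \sum_(u <- box n N) embC D (a u) * mono x u)); last first.
  by apply/funext => N; rewrite sum_ball.
apply: (complete_approx CpP p1 (@Cp_complete R D)) => C.
have [N hN] := ha C; exists N, (\sum_(u <- box n N) embC D (a u) * mono x u) => m Nm.
rewrite (sum_box _ Nm) addrAC subrr add0r; apply: (vge_sum CpP) => u /ltnW /hN h.
by apply: (vgeMr CpP); [rewrite /vge ordC_emb|exact: vge_mono].
Qed.

Lemma eval_series_fin (a : series_over D n) x N : unit_pt x ->
  (forall u, (N < l1 u)%N -> a u = 0) ->
  eval_series a x = \sum_(u <- box n N) embC D (a u) * mono x u.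
Proof.
move=> hx ha; rewrite /eval_series; apply: (vlim_const CpP p1 (N := N)) => m Nm.
rewrite sum_ball (sum_box _ Nm) [X in _ + X]big1 ?addr0// => u /ha ->.
by rewrite rmorph0 mul0r.
Qed.

Definition nuclear_mx (A : nat -> nat -> Cp D) :=
  (forall i j, vgeC 0 (A i j)) /\
  forall C, exists N : nat, forall j, (N <= j)%N -> forall i, vgeC C (A i j).

Lemma inf_mul_cvg (A B : nat -> nat -> Cp D) i j : nuclear_mx A -> (forall i j, vgeC 0 (B i j)) ->
  converges_to (p D) (ordC D) (fun N => \sum_(l < N) A i l * B l j) (inf_mul A B i j).
Proof.
move=> [_ hA] hB; apply: (complete_approx CpP p1 (@Cp_complete R D)) => C.
have [N hN] := hA C; exists N, (\sum_(l < N) A i l * B l j) => m Nm.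
rewrite -!(big_mkord xpredT (fun l => A i l * B l j)) (@big_cat_nat _ _ _ N 0 m) //=.
rewrite addrAC subrr add0r big_nat_cond; apply: (vge_sum CpP) => l /andP[/andP[Nl _] _].
by apply: (vgeMr CpP) => //; exact: hN.
Qed.

Lemma inf_mul_nuclear A B : nuclear_mx A -> nuclear_mx B -> nuclear_mx (@inf_mul R D A B).
Proof.
move=> hA [hB0 hB]; have [hA0 _] := hA; split=> [i j|C].
  apply: (vge_lim CpP p1 (N := 0) (inf_mul_cvg i j hA hB0)) => m _.
  by apply: (vge_sum CpP) => l _; exact: (vgeMl CpP).
have [N hN] := hB C; exists N => j Nj i.
apply: (vge_lim CpP p1 (N := 0) (inf_mul_cvg i j hA hB0)) => m _.
by apply: (vge_sum CpP) => l _; apply: (vgeMl CpP) => //; exact: hN.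
Qed.

Lemma inf_mul_cong C A B A' B' : nuclear_mx A -> nuclear_mx A' ->
  (forall i j, vcongC C (A i j) (A' i j)) -> (forall i j, vcongC C (B i j) (B' i j)) ->
  forall i j, vcongC C (@inf_mul R D A B i j) (@inf_mul R D A' B' i j).
Proof.
move=> hA hA' hAA hBB i j.
have hB k l : vgeC 0 (B k l) by have [] := hBB k l.
have hB' k l : vgeC 0 (B' k l) by have [] := hBB k l.
apply: (vcong_lim (inf_mul_cvg i j hA hB) (inf_mul_cvg i j hA' hB')) => m.
by apply: (vcong_sum CpP) => l _; apply: (vcongM CpP).
Qed.

Lemma inf_mul_id A : @inf_mul R D A (@inf_id R D) = A.
Proof.
apply/funext => i; apply/funext => j; apply: (vlim_const CpP p1 (N := j.+1)) => m jm.
rewrite (bigD1 (Ordinal jm)) //= /inf_id eqxx mulr1 big1 ?addr0// => l.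
by rewrite -val_eqE /= => /negbTE ->; rewrite mulr0.
Qed.

(** At least one factor is required: the identity matrix is not nuclear. *)
Lemma big_inf_mul_nuclear d (A : nat -> nat -> nat -> Cp D) :
  (forall e, nuclear_mx (A e)) ->
  nuclear_mx (\big[@inf_mul R D/@inf_id R D]_(e < d.+1) A e).
Proof.
elim: d A => [|d IH] A hA; first by rewrite big_ord_recl big_ord0 inf_mul_id.
by rewrite big_ord_recl; apply: inf_mul_nuclear => //; exact: (IH (fun e => A e.+1)).
Qed.

Lemma big_inf_mul_cong C d (A A' : nat -> nat -> nat -> Cp D) :
  (forall e, nuclear_mx (A e)) -> (forall e, nuclear_mx (A' e)) ->
  (forall e i j, vcongC C (A e i j) (A' e i j)) ->
  forall i j, vcongC C ((\big[@inf_mul R D/@inf_id R D]_(e < d.+1) A e) i j)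
                       ((\big[@inf_mul R D/@inf_id R D]_(e < d.+1) A' e) i j).
Proof.
elim: d A A' => [|d IH] A A' hA hA' hAA i j; first by rewrite !big_ord_recl !big_ord0 !inf_mul_id.
rewrite [X in vcongC _ (X _ _)]big_ord_recl [X in vcongC _ _ (X _ _)]big_ord_recl.
apply: inf_mul_cong => // k l.
exact: (IH (fun e => A e.+1) (fun e => A' e.+1)).
Qed.

Definition blockmx N (A : nat -> nat -> Cp D) : 'M[Cp D]_N := \matrix_(i < N, j < N) A i j.

Lemma fredholmE A m : fredholm A m = vlim (p D) (ordC D) (fun N => charps (blockmx N A) m).
Proof.
rewrite /fredholm; congr (vlim _ _ _); apply/funext => N; rewrite /charps.
by congr ((\det (1%:M - _) : {poly _})`_m); congr (_ *: _); apply/matrixP => i j; rewrite !mxE.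
Qed.

Lemma fredholm_fin N A m : (forall i j, (N <= j)%N -> A i j = 0) ->
  fredholm A m = charps (blockmx N A) m.
Proof.
move=> hA; rewrite fredholmE; apply: (vlim_const CpP p1 (N := N)) => k Nk.
by rewrite -(subnKC Nk) /blockmx charps_block.
Qed.

Lemma fredholm0 A : @fredholm R D A 0%N = 1.
Proof.
by rewrite fredholmE; apply: (vlim_const CpP p1 (N := 0)) => k _; rewrite charps0.
Qed.

(** Modulo [C] the columns from [N] on may be replaced by zero, and then the determinants no longer
    depend on the size. *)
Lemma fredholm_cvg A m : nuclear_mx A ->
  converges_to (p D) (ordC D) (fun N => charps (blockmx N A) m) (fredholm A m).
Proof.
move=> [hA0 hA]; rewrite fredholmE; apply: (complete_approx CpP p1 (@Cp_complete R D)) => C.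
have [N hN] := hA C.
pose A' i j := if (j < N)%N then A i j else 0.
exists N, (charps (blockmx N A') m) => k Nk.
have hA' i j : (N <= j)%N -> A' i j = 0 by move=> Nj; rewrite /A' ltnNge Nj.
rewrite /blockmx -(charps_block (k - N) hA') subnKC//.
have [_ /(_ m (leqnn m))[]//] : scong (ordC D) C m (charps (\matrix_(i < k, j < k) A i j))
    (charps (\matrix_(i < k, j < k) A' i j)).
apply: (charps_scong CpP) => i j; rewrite !mxE /A'; case: ltnP => h.
  exact: (vcong_refl CpP).
by split; rewrite ?subr0//; [exact: vge0 CpP _|exact: hN].
Qed.

Lemma fredholm_scong C M A A' : nuclear_mx A -> nuclear_mx A' ->
  (forall i j, vcongC C (A i j) (A' i j)) ->
  scong (ordC D) C M (fredholm A) (fredholm A').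
Proof.
move=> hA hA' hAA.
have h m : vcongC C (fredholm A m) (fredholm A' m).
  apply: (vcong_lim (fredholm_cvg m hA) (fredholm_cvg m hA')) => N.
  have [_] : scong (ordC D) C m (charps (blockmx N A)) (charps (blockmx N A')).
    by apply: (charps_scong CpP) => i j; rewrite !mxE.
  by apply.
by split=> [m|m _] //; have [] := h m.
Qed.

(** The qualitative part of log convergence, sufficient to approximate [L] by truncations; the rate
    of decay matters only for growth. *)
Definition log_nuclear (b : series_matrix D n) :=
  [/\ forall i j u, vgeK 0 (b i j u),
      forall C, exists N : nat, forall j, (N <= j)%N -> forall i u, vgeK C (b i j u) &
      forall C, exists N : nat, forall u, (N <= l1 u)%N -> forall i j, vgeK C (b i j u)].

Definition eval_mx (b : series_matrix D n) (x : 'rV[Cp D]_n) (e : nat) i j :=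
  eval_series (b i j) (frob_pow D e x).

Lemma unit_frob x e : unit_pt x -> unit_pt (frob_pow D e x).
Proof. by move=> hx i; rewrite mxE (ordX CpP _ (hx i)) mulr0. Qed.

Lemma eval_mx_cvg b x e i j : log_nuclear b -> unit_pt x ->
  converges_to (p D) (ordC D)
    (fun N => \sum_(u <- box n N) embC D (b i j u) * mono (frob_pow D e x) u) (eval_mx b x e i j).
Proof.
move=> [_ _ hb] hx; apply: eval_series_cvg; first exact: unit_frob.
by move=> C; have [N hN] := hb C; exists N => u /hN.
Qed.

Lemma eval_mx_nuclear b x e : log_nuclear b -> unit_pt x -> nuclear_mx (eval_mx b x e).
Proof.
move=> hb hx; have [hb0 hbj _] := hb; split=> [i j|C].
  apply: (vge_lim CpP p1 (N := 0) (eval_mx_cvg e i j hb hx)) => m _.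
  apply: (vge_sum CpP) => u _; apply: (vgeMr CpP); first by rewrite /vge ordC_emb; exact: hb0.
  by apply: vge_mono; exact: unit_frob.
have [N hN] := hbj C; exists N => j Nj i.
apply: (vge_lim CpP p1 (N := 0) (eval_mx_cvg e i j hb hx)) => m _.
apply: (vge_sum CpP) => u _; apply: (vgeMr CpP); first by rewrite /vge ordC_emb; exact: hN.
by apply: vge_mono; exact: unit_frob.
Qed.

Lemma eval_mx_cong C b b' x e : log_nuclear b -> log_nuclear b' -> unit_pt x ->
  (forall i j u, vcong (ord D) C (b i j u) (b' i j u)) ->
  forall i j, vcongC C (eval_mx b x e i j) (eval_mx b' x e i j).
Proof.
move=> hb hb' hx hbb i j.
apply: (vcong_lim (eval_mx_cvg e i j hb hx) (eval_mx_cvg e i j hb' hx)) => m.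
apply: (vcong_sum CpP) => u _; apply: (vcongM CpP).
  by have [h1 h2 h3] := hbb i j u; split; rewrite /vge -?rmorphB ordC_emb.
by apply: (vcong_refl CpP); apply: vge_mono; exact: unit_frob.
Qed.

Lemma euler_factorE d b x : euler_factor d b x =
  psV (pssubst d (fredholm (\big[@inf_mul R D/@inf_id R D]_(e < d) eval_mx b x e))).
Proof.
by rewrite /euler_factor psinvE//; rewrite /pssubst dvdn0 div0n fredholm0.
Qed.

Lemma euler_factor_scong C M d b b' x : (0 < d)%N -> log_nuclear b -> log_nuclear b' ->
  unit_pt x -> (forall i j u, vcong (ord D) C (b i j u) (b' i j u)) ->
  scong (ordC D) C M (euler_factor d b x) (euler_factor d b' x).
Proof.
case: d => // d _ hb hb' hx hbb; rewrite !euler_factorE.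
apply: (scongV CpP); apply: (scong_pssubst CpP); apply: fredholm_scong.
- by apply: big_inf_mul_nuclear => e; exact: eval_mx_nuclear.
- by apply: big_inf_mul_nuclear => e; exact: eval_mx_nuclear.
- by apply: big_inf_mul_cong => e; [exact: eval_mx_nuclear|exact: eval_mx_nuclear|exact: eval_mx_cong].
Qed.

Lemma L_function_CpE (b : series_matrix D n) m M z (M0 : (0 < M)%N)
    (zp : (q D ^ M - 1)%N.-primitive_root z) :
  (forall d, (0 < d <= m)%N -> (d %| M)%N) ->
  L_function_Cp b m =
    (\prod_(1 <= d < m.+1) \prod_(C in @orbs R D n M M0 d)
       (euler_factor d b (closed_point_lift (@pts R D n M z C)) : fps (Cp D))) m.
Proof.
move=> hM; rewrite /L_function_Cp.
congr (_ m); apply: eq_big_nat => d dm.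
apply: (big_closed_points M0 zp (fun O => euler_factor d b (closed_point_lift O))).
  by case/andP: dm.
by apply: hM; case/andP: dm => -> /=.
Qed.

(** [m!] makes all points of degree at most [m] rational over one field, F_(q^M). *)
Lemma exists_root_unity m : exists M (z : Cp D), [/\ (0 < M)%N,
  (q D ^ M - 1)%N.-primitive_root z & forall d, (0 < d <= m)%N -> (d %| M)%N].
Proof.
have M0 : (0 < m`!)%N by exact: fact_gt0.
have [z zp] := prim_root_exists D (Q_gt0 D M0).
by exists m`!, z; split=> // d; exact: dvdn_fact.
Qed.

Lemma L_function_Cp_cong C b b' m : log_nuclear b -> log_nuclear b' ->
  (forall i j u, vcong (ord D) C (b i j u) (b' i j u)) ->
  vcongC C (L_function_Cp b m) (L_function_Cp b' m).
Proof.
move=> hb hb' hbb; have [M [z [M0 zp hM]]] := exists_root_unity m.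
pose f b0 : fps (Cp D) := \prod_(1 <= d < m.+1) \prod_(Y in @orbs R D n M M0 d)
       (euler_factor d b0 (closed_point_lift (@pts R D n M z Y)) : fps (Cp D)).
suff [_ /(_ m (leqnn m)) h] : scong (ordC D) C m (f b) (f b').
  by rewrite (L_function_CpE b M0 zp hM) (L_function_CpE b' M0 zp hM).
rewrite /f [X in scong _ _ _ X]big_nat [X in scong _ _ _ _ X]big_nat; apply: (scong_prod CpP) => d /andP[d0 dm].
apply: (scong_prod CpP) => Y hY; apply: euler_factor_scong => //.
have [a [_ _ ->]] := closed_point_lift_pts zp hY.
by move=> i; exact: (ordC_lift_pt M0 zp).
Qed.

End LContinuity.

(** * Matrices indexed by a finite type *)

Section FinMatrix.
Variables (F : fieldType) (T : finType) (r : nat) (io : 'I_r.+1 -> T).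
Hypothesis io_bij : bijective io.

Definition fmx (A : T -> T -> F) : 'M[F]_r.+1 := \matrix_(i, j) A (io i) (io j).

Fixpoint fpow (A : T -> T -> F) k : T -> T -> F :=
  if k is k'.+1 then fun x y => \sum_t A x t * fpow A k' t y
  else fun x y => (x == y)%:R.

Lemma fmxX A k : fmx A ^+ k = fmx (fpow A k).
Proof.
elim: k => [|k IH].
  by apply/matrixP => i j; rewrite expr0 !mxE /= (inj_eq (bij_inj io_bij)).
rewrite exprS IH; apply/matrixP => i j; rewrite !mxE /= [RHS](reindex io) /=; last exact: onW_bij.
by apply: eq_bigr => k' _; rewrite !mxE.
Qed.

Lemma tr_fmx A : \tr (fmx A) = \sum_t A t t.
Proof.
rewrite [RHS](reindex io) /=; last exact: onW_bij.
by apply: eq_bigr => i _; rewrite !mxE.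
Qed.

End FinMatrix.

Lemma finType_ord_bij (T : finType) (t : T) : exists r (io : 'I_r.+1 -> T), bijective io.
Proof.
have e : #|T|.-1.+1 = #|T| by rewrite prednK//; apply/card_gt0P; exists t.
exists #|T|.-1, (fun i => enum_val (cast_ord e i)).
apply: (bij_comp (f := enum_val) (h := cast_ord e)); first exact: enum_val_bij.
by exists (cast_ord (esym e)) => i; apply/val_inj.
Qed.

(** * Traces of powers of the truncated matrix F *)

Section TraceFormula.
Variables (R : realType) (D : padic_setting R) (n N : nat).
Variable Bt : 'rV[int]_n -> 'M[K D]_N.+1.
Hypothesis Bt0 : forall u, (N < l1 u)%N -> Bt u = 0.

Local Notation q := (q D).

(* The expansion of B(X) B(X^q) ... B(X^(q^(k-1))) as a list of monomials. *)
Fixpoint terms k : seq ('rV[int]_n * 'M[K D]_N.+1) :=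
  if k is k'.+1 then
    [seq (a + t.1 *+ q, Bt a * t.2) | a <- box n N, t <- terms k']
  else [:: (0, 1)].

Definition Beval (x : 'rV[Cp D]_n) : 'M[Cp D]_N.+1 :=
  \sum_(u <- box n N) mono x u *: map_mx (embC D) (Bt u).

Lemma unit_pt_neq0 (x : 'rV[Cp D]_n) i : unit_pt x -> x 0 i != 0.
Proof. by move=> /(_ i) h; apply/eqP => e; move: h; rewrite e (vord0 (ordCP D)). Qed.

Lemma monoD (x : 'rV[Cp D]_n) u v : unit_pt x -> mono x (u + v) = mono x u * mono x v.
Proof.
move=> hx; rewrite /mono -big_split; apply: eq_bigr => i _.
by rewrite mxE expfzDr// unit_pt_neq0.
Qed.

Lemma mono_frob (x : 'rV[Cp D]_n) u : mono (frob_pow D 1 x) u = mono x (u *+ q).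
Proof.
apply: eq_bigr => i _; rewrite mxE mulmxnE expn1 -[x 0 i ^+ q]/(x 0 i ^ q%:Z) exprz_exp.
by rewrite -mulr_natr natz mulrC.
Qed.

Lemma terms_eval k (x : 'rV[Cp D]_n) : unit_pt x ->
  \prod_(e < k) Beval (frob_pow D e x) =
  \sum_(t <- terms k) mono x t.1 *: map_mx (embC D) t.2.
Proof.
elim: k x => [|k IH] x hx.
  rewrite big_ord0 big_seq1 /= map_mx1 (_ : mono x 0 = 1) ?scale1r//.
  by apply: big1 => i _; rewrite mxE expr0z.
rewrite big_ord_recl frob_pow0 big_allpairs_dep.
have -> : \prod_(i < k) Beval (frob_pow D (lift ord0 i) x) =
    \prod_(e < k) Beval (frob_pow D e (frob_pow D 1 x)).
  by apply: eq_bigr => e _; rewrite /= /bump /= add1n frob_powS.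
rewrite IH; last exact: unit_frob.
rewrite /Beval mulr_suml; apply: eq_bigr => a _; rewrite mulr_sumr; apply: eq_bigr => t _ /=.
by rewrite mono_frob monoD// map_mxM -scalerAl -scalerAr scalerA.
Qed.

(** Exponents of size at most [N] are scaled by 1, q, ..., q^(k-1), and this geometric sum is at
    most [q ^ k - 1] because [q >= 2]. *)
Lemma terms_l1 k t : t \in terms k -> (l1 t.1 <= N * (q ^ k - 1))%N.
Proof.
elim: k t => [|k IH] t; first by rewrite inE => /eqP -> /=; rewrite l1_0.
case/allpairsP=> [[a s] /= [ha hs ->]] /=; move: ha; rewrite mem_box => ha.
apply: leq_trans (l1D _ _) _; rewrite l1Mn.
have := IH _ hs => h; have q2 := q_gt1 D.
apply: (@leq_trans (N + q * (N * (q ^ k - 1)))); first by rewrite leq_add// leq_mul2l h orbT.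
have qk : (0 < q ^ k)%N by rewrite expn_gt0 ltnW.
rewrite expnS mulnCA -mulnS leq_mul2l; apply/orP; right.
by rewrite mulnBr muln1; nia.
Qed.

Definition coef_terms k w := \sum_(t <- terms k | t.1 == w) t.2.

Definition bidx := ('I_(size (box n N)) * 'I_N.+1)%type.
Definition bvec (x : bidx) : 'rV[int]_n := nth 0 (box n N) x.1.

Definition Fmx (x y : bidx) : K D := Bt (bvec y *+ q - bvec x) x.2 y.2.

Lemma l1_bvec x : (l1 (bvec x) <= N)%N.
Proof. by rewrite -mem_box mem_nth. Qed.

Lemma sum_bidx (V : zmodType) (f : 'rV[int]_n -> 'I_N.+1 -> V) :
  \sum_(x : bidx) f (bvec x) x.2 = \sum_(v <- box n N) \sum_j f v j.
Proof.
rewrite (big_nth 0) big_mkord pair_bigA /=.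
by apply: eq_bigr => x _.
Qed.

Lemma sum_box_pred1 (V : zmodType) (v0 : 'rV[int]_n) (f : 'rV[int]_n -> V) :
  \sum_(v <- box n N | v == v0) f v = if (l1 v0 <= N)%N then f v0 else 0.
Proof.
case: ifP => h; first by rewrite -big_filter filter_pred1_uniq ?big_seq1 ?mem_box ?uniq_box.
rewrite big_seq_cond big1// => v /andP[hv /eqP e].
by move: hv; rewrite mem_box e h.
Qed.

(** Restricting F to the box loses nothing: a nonzero entry at [(u, w)] with [|u| <= N] has
    [q |w| <= 2 N], so [w] is in the box since [q >= 2]. *)
Lemma fpow_coef k x y : fpow Fmx k x y = coef_terms k (bvec y *+ q ^ k - bvec x) x.2 y.2.
Proof.
elim: k x y => [|k IH] x y /=.
  have -> w : coef_terms 0 w = if w == 0 then 1 else 0.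
    by rewrite /coef_terms big_mkcond big_seq1 /= eq_sym.
  rewrite expn0 mulr1n subr_eq0 /bvec nth_uniq ?uniq_box//.
  case: x y => [x1 x2] [y1 y2] /=; rewrite xpair_eqE eq_sym val_eqE.
  by case: eqP => _ /=; rewrite !mxE.
transitivity ((\sum_(w <- box n N) Bt (w *+ q - bvec x) * coef_terms k (bvec y *+ q ^ k - w)) x.2 y.2).
  rewrite summxE.
  transitivity (\sum_(w <- box n N) \sum_j
      Bt (w *+ q - bvec x) x.2 j * coef_terms k (bvec y *+ q ^ k - w) j y.2).
    by rewrite -sum_bidx; apply: eq_bigr => t _; rewrite IH.
  by apply: eq_bigr => w _; rewrite mxE.
congr (fun_of_matrix _ x.2 y.2); set Y := bvec y *+ q ^ k; set U := _ - bvec x.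
have UY w : (Y - w) *+ q - bvec x = U - w *+ q.
  by rewrite /U /Y mulrnBl -mulrnA -expnSr addrAC.
transitivity (\sum_(t <- terms k) Bt (U - t.1 *+ q) * t.2).
  transitivity (\sum_(t <- terms k) \sum_(w <- box n N | w == Y - t.1) Bt (w *+ q - bvec x) * t.2).
    rewrite (exchange_big_dep xpredT) //=; apply: eq_bigr => w _; rewrite mulr_sumr.
    by apply: eq_bigl => t; apply/eqP/eqP => ->; rewrite subKr.
  apply: eq_bigr => t _; rewrite sum_box_pred1 UY; case: leqP => // h.
  rewrite Bt0 ?mul0r// -UY.
  have := l1B ((Y - t.1) *+ q - bvec x) (- bvec x); rewrite opprK subrK l1N l1Mn => h2.
  have := l1_bvec x => h3; have q2 := q_gt1 D.
  have : (2 * l1 (Y - t.1)%R <= q * l1 (Y - t.1)%R)%N by rewrite leq_mul2r q2 orbT.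
  by lia.
rewrite /coef_terms [RHS]big_mkcond /= big_allpairs_dep exchange_big /=.
apply: eq_bigr => t _; rewrite -big_mkcond /=.
rewrite (eq_bigl (fun a => a == U - t.1 *+ q)); last by move=> a; rewrite [RHS]eq_sym subr_eq eq_sym.
by rewrite sum_box_pred1; case: leqP => // h; rewrite Bt0 ?mul0r.
Qed.

(** The diagonal entry at [v] reads the exponent [(q ^ k - 1) v], so the trace collects the
    exponents divisible by [q ^ k - 1]; [terms_l1] ensures that the quotient [v] is in the box. *)
Lemma tr_fpow k : (0 < k)%N -> \sum_x fpow Fmx k x x =
  \sum_(t <- terms k) (if [forall i, ((q ^ k - 1)%N%:Z %| t.1 0%R i)%Z] then \tr t.2 else 0).
Proof.
move=> k0; transitivity (\sum_(v <- box n N) \tr (coef_terms k (v *+ (q ^ k - 1)))).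
  rewrite /mxtrace -sum_bidx; apply: eq_bigr => x _; rewrite fpow_coef.
  by rewrite mulrnBr ?mulr1n// expn_gt0 ltnW// q_gt1.
transitivity (\sum_(t <- terms k) \sum_(v <- box n N | t.1 == v *+ (q ^ k - 1)) \tr t.2).
  rewrite [RHS](exchange_big_dep xpredT) //=; apply: eq_bigr => v _.
  by rewrite /coef_terms raddf_sum.
rewrite big_seq [RHS]big_seq; apply: eq_bigr => t ht.
have r0 : (0 < q ^ k - 1)%N by rewrite subn_gt0 q_exp_gt1.
have := terms_l1 ht; set r := (q ^ k - 1)%N in r0 *; case: forallP => hr htr.
  pose v0 : 'rV[int]_n := \row_i (t.1 0%R i %/ r%:Z)%Z.
  have tv : t.1 = v0 *+ r.
    apply/rowP => i; rewrite mulmxnE mxE -mulr_natr natz.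
    by apply/esym/divzK; exact: hr.
  rewrite (eq_bigl (fun v => v == v0)); last first.
    move=> v; rewrite tv; apply/eqP/eqP => [/rowP h|->//]; apply/rowP => i.
    have := h i; rewrite !mulmxnE -(mulr_natr (v0 _ _)) -(mulr_natr (v _ _)) => e.
    by apply/esym; apply: mulIf e; rewrite natz eqz_nat gtn_eqF.
  rewrite sum_box_pred1 ifT//; move: htr; rewrite tv l1Mn mulnC leq_pmul2r//.
rewrite big1// => v /eqP tv; case: hr => i; rewrite tv mulmxnE -mulr_natr natz.
exact: dvdz_mull.
Qed.

End TraceFormula.

(** * Character sums and the trace formula *)

Section CharacterSum.
Variables (R : realType) (D : padic_setting R) (n N M : nat) (z : Cp D).
Hypothesis M_gt0 : (0 < M)%N.
Local Notation Q := (q D ^ M - 1)%N.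
Hypothesis z_prim : Q.-primitive_root z.
Variables (k : nat).
Hypotheses (k_gt0 : (0 < k)%N) (kM : (k %| M)%N).
Local Notation r := (q D ^ k - 1)%N.

Lemma r_dvd_Q : (r %| Q)%N.
Proof.
rewrite -(divnK kM) mulnC expnM !subn1; exact: dvdn_pred_predX.
Qed.

Lemma prim_exprz (F : fieldType) (w : F) j (u : int) : j.-primitive_root w ->
  (w ^ u == 1) = (j%:Z %| u)%Z.
Proof.
move=> wp; case: u => m; first by rewrite -[w ^ Posz m]/(w ^+ m) -(prim_order_dvd wp).
by rewrite NegzE -exprnN invr_eq1 -(prim_order_dvd wp) dvdzE abszN.
Qed.

(** The [r]-th roots of unity are the powers of [z ^+ g] with [g = Q / r]; the rest is orthogonality
    of characters. *)
Lemma char_sum1 (u : int) :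
  \sum_(j < Q | (z ^+ j) ^+ r == 1) (z ^+ j) ^ u = if (r%:Z %| u)%Z then r%:R else 0.
Proof.
have rQ := r_dvd_Q; set g := (Q %/ r)%N.
have r0 : (0 < r)%N := Q_gt0 D k_gt0.
have Qg : Q = (r * g)%N by rewrite mulnC divnK.
have g0 : (0 < g)%N by have := Q_gt0 D M_gt0; rewrite {1}Qg muln_gt0 => /andP[].
have wp : r.-primitive_root (z ^+ g) by exact: dvdn_prim_root.
have hlt (l : 'I_r) : (l * g < Q)%N by rewrite {1}Qg ltn_pmul2r.
have hlt' (j : 'I_Q) : (j %/ g < r)%N by rewrite ltn_divLR// -Qg.
have hdvd (x : nat) : (Q %| x * r)%N = (g %| x)%N.
  by rewrite {1}Qg mulnC dvdn_pmul2r.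
rewrite (reindex_onto (fun l => Ordinal (hlt l)) (fun j => Ordinal (hlt' j))) /=; last first.
  move=> j; rewrite -exprM -(prim_order_dvd z_prim) hdvd => gj.
  by apply/val_inj; rewrite /= divnK.
rewrite (eq_big xpredT (fun l : 'I_r => ((z ^+ g) ^ u) ^+ l)); last 2 first.
- move=> l; rewrite -exprM -(prim_order_dvd z_prim) hdvd dvdn_mull//=.
  by apply/eqP/val_inj; rewrite /= mulnK.
- move=> l _; rewrite mulnC exprM -[_ ^+ l]/(_ ^ l%:Z) -[in RHS]/(_ ^ l%:Z) exprzAC.
  by [].
rewrite sum_unity -?prim_exprz//; first by rewrite (prim_exprz _ wp).
by rewrite -[_ ^+ _]/(_ ^ r%:Z) exprzAC -[_ ^ r%:Z]/(_ ^+ r) (prim_expr_order wp) exp1rz.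
Qed.

Lemma frob_fixE (a : {ffun 'I_n -> 'I_Q}) :
  (iter k (frob_exp M_gt0) a == a) = [forall i, (z ^+ a i) ^+ r == 1].
Proof.
apply/eqP/forallP => [h i|h].
  have := congr1 (fun b => lift_pt z b 0 i) h; rewrite (lift_frob M_gt0 z_prim) !mxE => e.
  by apply/eqP; apply: expr_q_unityV e => //; exact: (zX_neq0 M_gt0 z_prim).
apply: (red_pt_inj M_gt0 z_prim); rewrite (red_frob M_gt0 z_prim).
apply/rowP => i; rewrite !mxE; apply: expr_q_unity => //.
have := h i; rewrite -!exprM -(prim_order_dvd z_prim) => /dvdnP[j ->].
by rewrite mulnC exprM (prim_expr_order (red_prim M_gt0 z_prim)) expr1n.
Qed.

Lemma char_sum (u : 'rV[int]_n) :
  \sum_(a | iter k (frob_exp M_gt0) a == a) mono (lift_pt z a) u =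
  if [forall i, (r%:Z %| u 0%R i)%Z] then r%:R ^+ n else 0.
Proof.
transitivity (\prod_i (if (r%:Z %| u 0%R i)%Z then r%:R else 0 : Cp D)).
  under [RHS]eq_bigr do rewrite -char_sum1.
  rewrite bigA_distr_big; apply: eq_big => [a|a _].
    by rewrite frob_fixE; apply/forallP/ffun_onP.
  by apply: eq_bigr => i _; rewrite mxE.
case: forallP => [h|/forallP].
  rewrite (eq_bigr (fun=> r%:R)); last by move=> i _; rewrite h.
  by rewrite prodr_const card_ord.
by rewrite negb_forall => /existsP[i hi]; rewrite (bigD1 i) //= (negbTE hi) mul0r.
Qed.

Variable Bt : 'rV[int]_n -> 'M[K D]_N.+1.
Hypothesis Bt0 : forall u, (N < l1 u)%N -> Bt u = 0.

(** Summing the monomials over rational points keeps the exponents divisible by [q ^ k - 1], exactly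
    those collected by the trace of the [k]-th power of F. *)
Lemma trace_formula :
  \sum_(a | iter k (frob_exp M_gt0) a == a)
     \tr (\prod_(e < k) Beval Bt (frob_pow D e (lift_pt z a))) =
  r%:R ^+ n * embC D (\sum_x fpow (Fmx Bt) k x x).
Proof.
rewrite tr_fpow// rmorph_sum mulr_sumr.
transitivity (\sum_(a | iter k (frob_exp M_gt0) a == a)
    \sum_(t <- terms Bt k) mono (lift_pt z a) t.1 * embC D (\tr t.2)).
  apply: eq_bigr => a _; rewrite terms_eval; last by move=> i; exact: (ordC_lift_pt M_gt0 z_prim).
  rewrite raddf_sum /=; apply: eq_bigr => t _.
  by rewrite mxtraceZ trace_map_mx.
rewrite exchange_big /=; apply: eq_bigr => t _; rewrite -mulr_suml char_sum.
by case: ifP => _ //; rewrite mul0r rmorph0 mulr0.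
Qed.

End CharacterSum.

(** * Products of B along Frobenius cycles *)

Section Cycles.
Variables (R : realType) (D : padic_setting R) (n N M : nat) (z : Cp D).
Hypothesis M_gt0 : (0 < M)%N.
Local Notation Q := (q D ^ M - 1)%N.
Hypothesis z_prim : Q.-primitive_root z.
Variable Bt : 'rV[int]_n -> 'M[K D]_N.+1.
Local Notation phi := (@frob_exp R D n M M_gt0).

Definition cycle_prod (a : {ffun 'I_n -> 'I_Q}) k : 'M[Cp D]_N.+1 :=
  \prod_(e < k) Beval Bt (lift_pt z (iter e phi a)).

Lemma cycle_prodE a k : cycle_prod a k = \prod_(e < k) Beval Bt (frob_pow D e (lift_pt z a)).
Proof. by apply: eq_bigr => e _; rewrite (lift_frob M_gt0 z_prim). Qed.

Lemma cycle_prodS a k : cycle_prod a k.+1 = Beval Bt (lift_pt z a) * cycle_prod (phi a) k.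
Proof.
rewrite /cycle_prod big_ord_recl; congr (_ * _); apply: eq_bigr => e _.
by rewrite lift0 iterSr.
Qed.

Lemma cycle_prodD a i j : cycle_prod a (i + j) = cycle_prod a i * cycle_prod (iter i phi a) j.
Proof.
elim: i a => [|i IH] a; first by rewrite [cycle_prod a 0]big_ord0 mul1r.
by rewrite addSn !cycle_prodS IH mulrA -iterSr.
Qed.

Lemma cycle_prodX a d l : iter d phi a = a -> cycle_prod a (l * d) = cycle_prod a d ^+ l.
Proof.
move=> h; elim: l => [|l IH]; first by rewrite mul0n [LHS]big_ord0.
by rewrite mulSn cycle_prodD h IH exprS.
Qed.

(** Passing to the Frobenius image rotates the factors, so the trace does not depend on the
    representative of a closed point. *)
Lemma tr_cycle_prod a k : iter k phi a = a -> \tr (cycle_prod (phi a) k) = \tr (cycle_prod a k).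
Proof.
case: k => [|k] h; first by rewrite /cycle_prod !big_ord0.
have -> : cycle_prod (phi a) k.+1 = cycle_prod (phi a) k * Beval Bt (lift_pt z a).
  rewrite -[k.+1 in LHS]addn1 cycle_prodD -iterSr h; congr (_ * _).
  by rewrite cycle_prodS [cycle_prod _ 0]big_ord0 mulr1.
by rewrite [in RHS]cycle_prodS -!mulmxE mxtrace_mulC.
Qed.

Lemma tr_cycle_orb a b k : iter k phi a = a -> b \in orb M_gt0 a ->
  \tr (cycle_prod b k) = \tr (cycle_prod a k).
Proof.
move=> h /(orbP M_gt0 z_prim)[e ->]; elim: e => // e IH.
by rewrite iterS tr_cycle_prod ?IH// -iterD addnC iterD h.
Qed.

Lemma deg_exists a k : (0 < k)%N -> iter k phi a = a ->
  exists2 d, (0 < d <= k)%N & has_deg M_gt0 d a.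
Proof.
move=> k0 h.
have ex : exists d, (0 < d)%N && (iter d phi a == a) by exists k; rewrite k0 h eqxx.
exists (ex_minn ex).
  by case: ex_minnP => d /andP[-> _] /(_ k) /=; apply; rewrite k0 h eqxx.
case: ex_minnP => d /andP[d0 hd] hmin; apply/andP; split=> //.
apply/forallP => e; apply/implyP => e0; apply/negP => he.
by have := hmin e; rewrite e0 he leqNgt ltn_ord => /(_ isT).
Qed.

Lemma sum_degs a k m (c : Cp D) : (0 < k <= m)%N -> iter k phi a = a ->
  \sum_(1 <= d < m.+1 | has_deg M_gt0 d a) c = c.
Proof.
move=> /andP[k0 km] h; have [d /andP[d0 dk] hd] := deg_exists k0 h.
have hdin : d \in index_iota 1 m.+1 by rewrite mem_index_iota d0 ltnS (leq_trans dk).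
rewrite -big_filter (_ : [seq i <- index_iota 1 m.+1 | has_deg M_gt0 i a] = [:: d]) ?big_seq1//.
rewrite -(filter_pred1_uniq (iota_uniq _ _) hdin); apply: eq_in_filter => d'.
rewrite mem_index_iota => /andP[d0' _]; apply/idP/eqP => [hd'|->//].
apply/eqP; rewrite eqn_dvd -(has_deg_dvd d d0' hd') -(has_deg_dvd d' d0 hd).
by case/andP: hd => -> _; case/andP: hd' => -> _.
Qed.

End Cycles.

(** * The L-function of a truncated matrix *)

Section Truncation.
Variables (R : realType) (D : padic_setting R) (n N : nat).
Local Notation CpP := (ordCP D).
Local Notation p1 := (p_gt1 D).
Local Notation qK := ((q D)%:R : K D).

(** Nuclearity makes columns, not rows, tend to 0, so only columns and exponents are cut. With
    finitely many nonzero columns, the Fredholm determinant is that of a square corner. *)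
Definition trunc_mx (b : series_matrix D n) : series_matrix D n :=
  fun i j u => if (j <= N)%N && (l1 u <= N)%N then b i j u else 0.

Definition coefmx (b : series_matrix D n) u : 'M[K D]_N.+1 :=
  \matrix_(i, j) trunc_mx b i j u.

Lemma coefmx0 b u : (N < l1 u)%N -> coefmx b u = 0.
Proof.
by move=> h; apply/matrixP => i j; rewrite !mxE /trunc_mx [(l1 u <= N)%N]leqNgt h andbF.
Qed.

Lemma inf_mul_fin (A B : nat -> nat -> Cp D) i j : (forall i j, (N < j)%N -> A i j = 0) ->
  inf_mul A B i j = \sum_(l < N.+1) A i l * B l j.
Proof.
move=> hA; apply: (vlim_const CpP p1 (N := N.+1)) => m Nm.
rewrite -!(big_mkord xpredT (fun l => A i l * B l j)) (@big_cat_nat _ _ _ N.+1 0 m) //=.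
rewrite [X in _ + X]big_nat_cond [X in _ + X]big1 ?addr0// => l /andP[/andP[Nl _] _].
by rewrite hA ?mul0r.
Qed.

(** As the later columns vanish, the corner of a product is the product of the corners. *)
Lemma blockmx_big d (A : nat -> nat -> nat -> Cp D) :
  (forall e i j, (N < j)%N -> A e i j = 0) ->
  blockmx N.+1 (\big[@inf_mul R D/@inf_id R D]_(e < d) A e) = \prod_(e < d) blockmx N.+1 (A e).
Proof.
elim: d A => [|d IH] A hA.
  by rewrite !big_ord0; apply/matrixP => i j; rewrite !mxE.
rewrite big_ord_recl [RHS]big_ord_recl /= -(IH (fun e => A e.+1)); last by move=> e; exact: hA.
by apply/matrixP => i j; rewrite !mxE inf_mul_fin; [apply: eq_bigr => l _; rewrite !mxE|exact: hA].
Qed.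

Lemma big_inf_mul_col0 d (A : nat -> nat -> nat -> Cp D) :
  (forall e i j, (N < j)%N -> A e i j = 0) ->
  forall i j, (N < j)%N -> (\big[@inf_mul R D/@inf_id R D]_(e < d.+1) A e) i j = 0.
Proof.
elim: d A => [|d IH] A hA i j Nj; first by rewrite big_ord_recl big_ord0 inf_mul_id hA.
rewrite big_ord_recl inf_mul_fin; last exact: hA.
by rewrite big1// => l _; rewrite (IH (fun e => A e.+1)) ?mulr0// => e; exact: hA.
Qed.

Lemma euler_trunc d b x : (0 < d)%N -> unit_pt x ->
  euler_factor d (trunc_mx b) x =
  psV (pssubst d (charps (\prod_(e < d) Beval (coefmx b) (frob_pow D e x)))).
Proof.
case: d => // d _ hx; rewrite euler_factorE; congr (psV (pssubst _ _)).
have h0 e i j : (N < j)%N -> eval_mx (trunc_mx b) x e i j = 0.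
  move=> Nj; rewrite /eval_mx (@eval_series_fin _ _ _ _ _ N); last 2 first.
  - exact: unit_frob.
  - by move=> u Nu; rewrite /trunc_mx leqNgt Nj.
  by rewrite big1// => u _; rewrite /trunc_mx leqNgt Nj /= rmorph0 mul0r.
apply/funext => m; rewrite (fredholm_fin (N := N.+1)); last exact: big_inf_mul_col0.
congr (charps _ m); rewrite blockmx_big//; apply: eq_bigr => e _.
apply/matrixP => i j; rewrite summxE mxE /eval_mx (@eval_series_fin _ _ _ _ _ N).
- by apply: eq_bigr => u _; rewrite !mxE mulrC.
- exact: unit_frob.
- by move=> u Nu; rewrite /trunc_mx [(l1 u <= N)%N]leqNgt Nu andbF.
Qed.

Lemma logd_euler_trunc d b x : (0 < d)%N -> unit_pt x ->
  logd (euler_factor d (trunc_mx b) x) (fun k => if (0 < k)%N && (d %| k)%N then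
     \tr ((\prod_(e < d) Beval (coefmx b) (frob_pow D e x)) ^+ (k %/ d)) *+ d else 0).
Proof.
move=> d0 hx; rewrite euler_trunc//; set A := \prod_(e < d) _.
have := logdV _ (logd_pssubst d0 (logd_charps A)).
rewrite {1}/pssubst dvdn0 div0n charps0 => /(_ erefl).
congr (logd _ _); apply/funext => k; rewrite psoppE /pssubst.
case: (posnP k) => [->|k0]; first by rewrite dvdn0 div0n mulr0 oppr0.
case: ifP => dk /=; last by rewrite mulr0 oppr0.
rewrite mulr_natl; case E : (k %/ d)%N => [|l]; last by rewrite mulNrn opprK.
by move: k0; rewrite -(divnK dk) E.
Qed.

Lemma ps_prod0 (F : fieldType) (I : Type) (s : seq I) (P : pred I) (f : I -> fps F) :
  (forall i, P i -> f i 0%N = 1) -> (\prod_(i <- s | P i) f i) 0%N = 1.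
Proof.
move=> h; apply: (big_ind (fun g : fps F => g 0%N = 1)) => // g g' hg hg'.
by rewrite coefM0_ps hg hg' mulr1.
Qed.

Lemma coef_ps_sum (F : fieldType) (I : Type) (s : seq I) (P : pred I) (f : I -> fps F) k :
  (\sum_(i <- s | P i) f i) k = \sum_(i <- s | P i) f i k.
Proof. by apply: (big_morph (fun g : fps F => g k)). Qed.

Lemma logd_map (f s : fps (K D)) : logd f s ->
  logd (fun m => embC D (f m)) (fun m => embC D (s m)).
Proof.
move=> h m; rewrite -(rmorph_nat (embC D)) -rmorphM h !coefM_ps rmorph_sum.
by apply: eq_bigr => i _; rewrite rmorphM.
Qed.

Variables (b : series_matrix D n) (r : nat) (io : 'I_r.+1 -> bidx n N).
Hypothesis io_bij : bijective io.

Definition dwork_series : fps (K D) := charps (fmx io (Fmx (coefmx b))).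

(** Points are counted by (q^k - 1)^n, whereas the n-fold delta yields (1 - q^k)^n and det(I - FT)
    has logarithmic derivative - Tr F^k: the sign (-1)^(n-1) remains. *)
Definition signed (f : fps (K D)) := if odd n then f else psV f.

(** Both series have constant term 1, so it suffices to compare logarithmic derivatives up to degree
    [m]. On the side of the Euler product these become sums over geometric points, evaluated by the
    trace formula. *)
Lemma L_trunc m : L_function_Cp (trunc_mx b) m =
  embC D (iter n (delta qK) (signed dwork_series) m).
Proof.
have [M [z [M0 zp hM]]] := exists_root_unity D m.
rewrite (L_function_CpE _ M0 zp hM).
pose T k : K D := \sum_x fpow (Fmx (coefmx b)) k x x.
pose s : fps (K D) := fun k => if k is 0 then 0 else (q D ^ k - 1)%N%:R ^+ n * T k.
have D0 : dwork_series 0%N = 1 by exact: charps0.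
have S0 : signed dwork_series 0%N = 1 by rewrite /signed; case: ifP => // _; rewrite psV0.
have hs : logd (iter n (delta qK) (signed dwork_series)) s.
  have hD := logd_charps (fmx io (Fmx (coefmx b))).
  have hS : logd (signed dwork_series) (fun k => if k is 0 then 0 else (-1) ^+ n * T k).
    rewrite /signed -signr_odd; case: odd => /=.
      move: hD; congr (logd _ _); apply/funext => -[//|k].
      by rewrite expr1 mulN1r fmxX// tr_fmx.
    have := logdV D0 hD; congr (logd _ _); apply/funext => -[|k]; rewrite psoppE ?oppr0//.
    by rewrite expr0 mul1r opprK fmxX// tr_fmx.
  have := logd_iter_delta qK n S0 hS; congr (logd _ _); apply/funext => -[|k] /=.
    by rewrite mulr0.
  rewrite mulrA -exprMn; congr (_ ^+ n * _).
  by rewrite natrB ?expn_gt0 ?(ltnW (q_gt1 D))// natrX; ring.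
have orbU d C : C \in orbs D n M0 d -> unit_pt (closed_point_lift (@pts R D n M z C)).
  move=> hC; have [a [_ _ ->]] := closed_point_lift_pts zp hC.
  by move=> i; exact: (ordC_lift_pt M0 zp).
pose h d k (C : {set {ffun 'I_n -> 'I_(q D ^ M - 1)}}) :=
  if (0 < k)%N && (d %| k)%N then
    \tr ((\prod_(e < d) Beval (coefmx b) (frob_pow D e (closed_point_lift (@pts R D n M z C)))) ^+ (k %/ d))
  else 0.
pose t : fps (Cp D) := \sum_(1 <= d < m.+1) \sum_(C in orbs D n M0 d) ((fun k => h d k C *+ d) : fps (Cp D)).
apply: (logd_unique (g := fun k => embC D (iter n (delta qK) (signed dwork_series) k))
  (s := t) (t := fun k => embC D (s k)) (M := m)) => //.
- exact: natC_neq0.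
- rewrite big_nat; apply: ps_prod0 => d /andP[d0 _]; apply: ps_prod0 => C hC.
  by rewrite euler_factorE psV0.
- by rewrite iter_delta0// rmorph1.
- rewrite /t big_nat [X in logd _ X]big_nat; apply: logd_prod => d /andP[d0 _].
  apply: logd_prod => C hC.
  have := logd_euler_trunc b d0 (orbU d C hC); congr (logd _ _).
  by apply/funext => k; rewrite /h; case: ifP => // _; rewrite mul0rn.
- exact: logd_map.
move=> k km; rewrite /t coef_ps_sum.
case: (posnP k) km => [->|k0] km.
  rewrite rmorph0 big1// => d _; rewrite coef_ps_sum big1// => C _.
  by rewrite /h /= mul0rn.
have kM : (k %| M)%N by apply: hM; rewrite k0.
pose g (a : {ffun 'I_n -> 'I_(q D ^ M - 1)}) : Cp D :=
  if iter k (frob_exp M0) a == a then \tr (cycle_prod z M0 (coefmx b) a k) else 0.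
(* The geometric points of an orbit share the same trace, which absorbs the factor [d]. *)
transitivity (\sum_(1 <= d < m.+1) \sum_(a | has_deg M0 d a) g a).
  rewrite big_nat [RHS]big_nat; apply: eq_bigr => d /andP[d0 _]; rewrite coef_ps_sum.
  apply: (sum_orbs zp d0) => C a hC aC.
  have [a0 [ha0 oa0 ea0]] := closed_point_lift_pts zp hC.
  have aa0 : a \in orb M0 a0 by rewrite oa0.
  have hda : has_deg M0 d a by rewrite (has_deg_orb zp _ aa0).
  rewrite /g /h k0 /= (has_deg_dvd _ d0 hda); case: ifP => // dk.
  have fix_k : iter k (frob_exp M0) a0 = a0.
    by apply/eqP; rewrite (has_deg_dvd _ d0 ha0).
  rewrite (tr_cycle_orb zp _ fix_k aa0) ea0 -{1}(divnK dk) cycle_prodX.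
    by rewrite (cycle_prodE M0 zp).
  by case/andP: ha0 => /eqP.
(* A point fixed by the [k]-th power of Frobenius has exactly one degree, and it is at most
   [k <= m]. *)
transitivity (\sum_a g a).
  under eq_bigr do rewrite big_mkcond /=.
  rewrite exchange_big /=; apply: eq_bigr => a _; rewrite -big_mkcond /=.
  rewrite /g; case: eqP => ha; last by rewrite big1.
  by apply: (sum_degs (k := k)) ha; rewrite k0.
rewrite -big_mkcond /=.
under eq_bigr do rewrite (cycle_prodE M0 zp).
rewrite (trace_formula M0 zp k0 kM (@coefmx0 b)) /s; case: k k0 {km kM g h t} => // k _.
by rewrite rmorphM rmorphXn rmorph_nat.
Qed.

End Truncation.

(** * Uniform growth of det(I - FT) *)

Section Growth.
Variables (R : realType) (D : padic_setting R) (n : nat) (E : Type) (S : set E).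
Variables (b : E -> series_matrix D n) (c : R).
Hypothesis b_int : forall k, S k -> forall i j u, vge (ord D) 0 (b k i j u).
Hypothesis b_log : unif_log_convergent S b c.
Local Notation KP := (ordKP D).
Local Notation lnq := (ln (q D)%:R : R).

Lemma lnq_gt0 : 0 < lnq. Proof. by apply: ln_gt0; rewrite ltr1n q_gt1. Qed.

Lemma log_bound c1 : c1 < c -> exists2 N : nat, (1 < N)%N &
  forall u, (N <= l1 u)%N -> forall k, S k -> forall i j,
    vge (ord D) (c1 * (ln (l1 u)%:R / lnq)) (b k i j u).
Proof.
move=> c1c; have [h _] := b_log.
have hc : (c1%:E < c%:E)%E by rewrite lte_fin.
have /ereal_sup_gt[_ [N _ <-] hN] := lt_le_trans hc h.
(* From 2 on, the logarithm by which one divides is positive. *)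
exists (maxn 2 N) => [|u]; first by rewrite leq_max.
rewrite geq_max => /andP[u2 uN] k Sk i j.
have l0 : 0 < ln (l1 u)%:R / lnq.
  by rewrite divr_gt0 ?lnq_gt0// ln_gt0// ltr1n.
set l := ln _ / _ in l0 *.
have h1 : (c1%:E <= ord_coef (b k) u * (l^-1)%:E)%E.
  apply: (le_trans (ltW hN)); apply: (@le_trans _ _ (ereal_inf
         [set (ord_coef (b k) u * (l^-1)%:E)%E | k in S])).
    by apply: ereal_inf_lbound; exists u.
  by apply: ereal_inf_lbound; exists k.
have h2 : (ord_coef (b k) u <= ord D (b k i j u))%E.
  by apply: ereal_inf_lbound; exists (i, j).
have [->|b0] := eqVneq (b k i j u) 0; first exact: vge0 KP _.
have [t ht] := ord_fin KP b0; rewrite (vge_le_ord _ ht).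
have : (c1%:E <= (t * l^-1)%:E)%E.
  apply: (le_trans h1); rewrite EFinM -ht; apply: lee_wpmul2r => //.
  by rewrite lee_fin invr_ge0 ltW.
by rewrite lee_fin ler_pdivlMr.
Qed.

(** log_q, with [maxn 1] giving the exponent 0 the weight 0. *)
Definition wt (x : nat) : R := ln (maxn 1 x)%:R / lnq.

Lemma wt_ge0 x : 0 <= wt x.
Proof. by rewrite divr_ge0 ?(ltW lnq_gt0)// ln_ge0// ler1n leq_maxl. Qed.

Lemma wt_le x y : (x <= y)%N -> wt x <= wt y.
Proof.
move=> xy; rewrite ler_pM2r ?invr_gt0 ?lnq_gt0// ler_ln ?posrE ?ltr0n ?leq_maxl//.
by rewrite ler_nat; lia.
Qed.

Lemma truncn_ge (x : R) (m : nat) : ((Num.truncn x).+1 <= m)%N -> x <= m%:R.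
Proof. by move=> h; apply: (le_trans (ltW (truncnS_gt x))); rewrite ler_nat. Qed.

(* Either |u| is almost q|v|, and then the weight grows by r from v to u, or
   |qv - u| is comparable with |v|, and then the coefficient itself is small. *)
Lemma entry_bound r c2 c1 : 0 < r -> r < c2 -> c2 < c1 -> c1 < c ->
  exists2 V : nat, (0 < V)%N & forall u v, (V <= l1 v)%N -> forall k, S k -> forall i j,
    vge (ord D) (r + c2 * wt (l1 v) - c2 * wt (l1 u)) (b k i j (v *+ q D - u)).
Proof.
move=> r0 rc2 c21 c1c; have [N1 N12 hN1] := log_bound c1c.
have c20 : 0 < c2 by exact: lt_trans rc2.
have q1 : 1 < (q D)%:R :> R by rewrite ltr1n q_gt1.
have q0 : 0 < (q D)%:R :> R by exact: lt_trans q1.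
(* [th = q ^ (r / c2)]: from [|u| = th |v|] on, the weight [c2 log_q] of [u] exceeds that of [v] by
   at least [r]. As [r < c2], [th] is below [q] and [ka] is positive. *)
pose th : R := expR (r / c2 * lnq); pose ka := (q D)%:R - th.
have th0 : 0 < th by exact: expR_gt0.
have ka0 : 0 < ka.
  rewrite subr_gt0 /th -[ltRHS]lnK ?posrE// ltr_expR -[ltRHS]mul1r ltr_pM2r ?lnq_gt0//.
  by rewrite ltr_pdivrMr// mul1r.
(* For [|v| >= X] one has [c1 log_q (ka |v|) >= r + c2 log_q |v|]: the gap between [c1] and [c2]
   absorbs the constant [ka]. *)
pose X : R := expR ((r * lnq - c1 * ln ka) / (c1 - c2)).
exists (maxn 1 (maxn (Num.truncn (N1%:R / ka)).+1 (Num.truncn X).+1)); first by rewrite leq_max.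
move=> u v; rewrite !geq_max => /and3P[v1 vN vX] k Sk i j.
have v0 : 0 < (l1 v)%:R :> R by rewrite ltr0n.
have hwv : wt (l1 v) = ln (l1 v)%:R / lnq by rewrite /wt; congr (ln _%:R / _); lia.
have [hu|hu] := leP (th * (l1 v)%:R) (l1 u)%:R.
  have u0 : 0 < (l1 u)%:R :> R by apply: lt_le_trans hu; exact: mulr_gt0.
  have hwu : wt (l1 u) = ln (l1 u)%:R / lnq.
    by rewrite /wt; congr (ln _%:R / _); move: u0; rewrite ltr0n; lia.
  apply: vgeW (b_int Sk i j _).
  have : ln (th * (l1 v)%:R) <= ln (l1 u)%:R by rewrite ler_ln ?posrE// mulr_gt0.
  rewrite lnM ?posrE// /th expRK => h.
  have : r + c2 * wt (l1 v) <= c2 * wt (l1 u).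
    rewrite hwv hwu -(ler_pM2r lnq_gt0) mulrDl -!mulrA !mulVf ?gt_eqF ?lnq_gt0// !mulr1.
    have := ler_wpM2l (ltW c20) h; rewrite mulrDr.
    by rewrite (_ : c2 * (r / c2 * lnq) = r * lnq)// mulrA mulrCA divff ?gt_eqF// mulr1.
  by move=> ?; lra.
have hx : ka * (l1 v)%:R <= (l1 (v *+ q D - u)%R)%:R.
  have := l1B (v *+ q D - u) (- u); rewrite opprK subrK l1N l1Mn => h.
  have : (q D)%:R * (l1 v)%:R <= (l1 (v *+ q D - u)%R)%:R + (l1 u)%:R :> R.
    by rewrite -natrM -natrD ler_nat.
  by rewrite /ka mulrBl; lra.
have kv0 : 0 < ka * (l1 v)%:R by exact: mulr_gt0.
have xN : (N1 <= l1 (v *+ q D - u)%R)%N.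
  rewrite -(ler_nat R); apply: le_trans hx; rewrite mulrC -ler_pdivrMr//.
  exact: truncn_ge.
apply: vgeW (hN1 _ xN k Sk i j).
have hl : ln (ka * (l1 v)%:R) <= ln (l1 (v *+ q D - u)%R)%:R.
  by rewrite ler_ln ?posrE//; exact: lt_le_trans hx.
have hX : (r * lnq - c1 * ln ka) / (c1 - c2) <= ln (l1 v)%:R.
  rewrite -[leLHS]expRK ler_ln ?posrE ?expR_gt0//; exact: truncn_ge.
move: hl hX; rewrite lnM ?posrE// ler_pdivrMr ?subr_gt0// => hl hX.
have h1 : r + c2 * wt (l1 v) <= c1 * (ln (l1 (v *+ q D - u)%R)%:R / lnq).
  rewrite hwv -(ler_pM2r lnq_gt0) mulrDl -!mulrA !mulVf ?gt_eqF ?lnq_gt0// !mulr1.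
  have c10 : 0 < c1 by exact: lt_trans c21.
  have := ler_wpM2l (ltW c10) hl; rewrite mulrDr.
  by move: hX; rewrite mulrBr; lra.
have := mulr_ge0 (ltW c20) (wt_ge0 (l1 u)).
by lra.
Qed.

(** A permutation product over [m] indices has valuation at least [r m], less [c3] for each bad
    column, since the weights cancel. The number of bad columns is bounded independently of [k] and
    [N], hence so is [A]. *)
Lemma dwork_growth r : r < c -> exists2 A, 0 <= A & forall k, S k ->
  forall N r' (io : 'I_r'.+1 -> bidx n N), bijective io ->
  growth (ord D) r A (dwork_series (b k) io).
Proof.
(* For [r <= 0] integrality of the coefficients is enough. *)
move=> rc; have [r0|r0] := leP r 0.
  exists 0 => // k Sk N r' io _ m; rewrite subr0.
  apply: (@vgeW _ _ _ 0); first by rewrite mulr_le0_ge0.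
  apply: (charps_vge KP) => s J _ _.
  apply: (big_ind (vge (ord D) 0)) => [|x y hx hy|i _]; [exact: vge1 KP|exact: (vgeMl KP)|].
  rewrite mxE /Fmx mxE /trunc_mx; case: ifP => _; first exact: b_int.
  exact: vge0 KP _.
pose c1 := (r + 3 * c) / 4; pose c2 := (r + c) / 2.
have [V V0 hV] := @entry_bound r c2 c1 r0 ltac:(rewrite /c2; lra) ltac:(rewrite /c1 /c2; lra)
  ltac:(rewrite /c1; lra).
have c20 : 0 < c2 by rewrite /c2; lra.
(* The most by which an integral entry in a column with [|v| < V] can miss the weighted bound.
   Columns of index beyond [J0] have valuation at least [c3], so they do not miss it. *)
pose c3 := r + c2 * wt V.
have c30 : 0 < c3 by rewrite /c3 ltr_pwDl// mulr_ge0 ?wt_ge0 ?ltW.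
have [_ /(_ c3 c30)[J0 hJ0]] := b_log.
pose B := ((size (box n V)).+1 * J0.+1)%N.
exists (c3 * B%:R); first by rewrite mulr_ge0 ?ltW.
move=> k Sk N r' io io_bij m.
pose bad (y : bidx n N) := (l1 (bvec y) < V)%N && (y.2 <= J0)%N.
pose w (y : bidx n N) := c2 * wt (l1 (bvec y)).
have entry x y : vge (ord D) (r - c3 * (bad y)%:R + w y - w x) (Fmx (coefmx N (b k)) x y).
  rewrite /Fmx mxE /trunc_mx; case: ifP => _; last exact: vge0 KP _.
  have wx : 0 <= w x by rewrite mulr_ge0 ?wt_ge0 ?ltW.
  rewrite /bad; case: ltnP => hv /=; last by rewrite mulr0 subr0; exact: hV.
  have wy : w y <= c2 * wt V by apply: ler_wpM2l; [exact: ltW|apply: wt_le; exact: ltnW].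
  case: leqP => hj; last first.
    by rewrite mulr0 subr0; apply: vgeW (hJ0 _ hj k Sk _ _); rewrite /c3; lra.
  by rewrite mulr1; apply: vgeW (b_int Sk _ _ _); rewrite /c3; lra.
have card_bad : (#|[set y | bad y]%SET| <= B)%N.
  pose f (y : bidx n N) : 'I_(size (box n V)).+1 * 'I_J0.+1 :=
    (inord (index (bvec y) (box n V)), inord y.2).
  rewrite -(card_in_imset (f := f)).
    by apply: leq_trans (max_card _) _; rewrite card_prod !card_ord.
  move=> y y'; rewrite !inE => /andP[h1 h2] /andP[h3 h4] [e1 e2].
  have mb (y0 : bidx n N) : (l1 (bvec y0) < V)%N -> bvec y0 \in box n V.
    by move=> h; rewrite mem_box ltnW.
  move: e1 => /(congr1 val); rewrite /= !inordK; last 2 first.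
  - by rewrite ltnS ltnW// index_mem mb.
  - by rewrite ltnS ltnW// index_mem mb.
  move=> e1; have e3 : bvec y = bvec y'.
    by rewrite -(nth_index 0 (mb _ h1)) e1 nth_index// mb.
  move: e2 => /(congr1 val); rewrite /= !inordK// => e2.
  case: y y' e2 e3 {e1 h1 h2 h3 h4} => [y1 y2] [y1' y2'] /= e2 /eqP.
  rewrite /bvec /= nth_uniq ?uniq_box// => /eqP e3.
  by congr pair; exact: val_inj.
apply: (charps_vge KP) => s J Jm Js.
apply: (@vgeW _ _ _ (\sum_(i in J)
   (r - c3 * (bad (io (s i)))%:R + w (io (s i)) - w (io i)))); last first.
  by apply: (vge_prod KP) => i _; rewrite mxE.
(* [s] maps [J] onto itself, so row weights and column weights have the same sum. *)
have shift (g : bidx n N -> R) : \sum_(i in J) g (io (s i)) = \sum_(i in J) g (io i).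
  rewrite [RHS](reindex_inj (@perm_inj _ s)); apply: eq_bigl => i.
  by rewrite (perm_closed _ Js).
have -> : \sum_(i in J) (r - c3 * (bad (io (s i)))%:R + w (io (s i)) - w (io i)) =
    r * m%:R - c3 * \sum_(i in J) (bad (io i))%:R.
  rewrite !big_split /= !sumrN (shift w) addrK (shift (fun y => c3 * (bad y)%:R)).
  by rewrite -mulr_sumr sumr_const Jm mulr_natr.
rewrite lerB// ler_wpM2l ?(ltW c30)//.
have h1 : \sum_(i in J) (bad (io i))%:R <= \sum_i (bad (io i))%:R :> R.
  by rewrite big_mkcond; apply: ler_sum => i _; case: ifP.
apply: (le_trans h1).
have -> : \sum_i (bad (io i))%:R = \sum_y (bad y)%:R :> R.
  by rewrite [RHS](reindex io)//; exact: onW_bij.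
rewrite -natr_sum ler_nat; apply: leq_trans card_bad.
by rewrite -sum1_card [leqRHS]big_mkcond; apply: leq_sum => y _; rewrite inE; case: (bad y).
Qed.

End Growth.

(** * Passage to the limit over truncations *)

Section Limit.
Variables (R : realType) (D : padic_setting R) (n : nat) (b : series_matrix D n).
Hypothesis b_nuc : log_nuclear b.
Local Notation KP := (ordKP D).
Local Notation CpP := (ordCP D).
Local Notation p1 := (p_gt1 D).
Local Notation qK := ((q D)%:R : K D).

Lemma trunc_nuclear N : log_nuclear (trunc_mx N b).
Proof.
have [h1 h2 h3] := b_nuc.
have h i j u C : vge (ord D) C (b i j u) -> vge (ord D) C (trunc_mx N b i j u).
  by rewrite /trunc_mx; case: ifP => // _ _; exact: vge0 KP _.
split=> [i j u|C|C]; first exact/h/h1.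
- by have [N' hN'] := h2 C; exists N' => j Nj i u; exact/h/hN'.
- by have [N' hN'] := h3 C; exists N' => u Nu i j; exact/h/hN'.
Qed.

Lemma trunc_cong C : exists N0 : nat, forall N, (N0 <= N)%N -> forall i j u,
  vcong (ord D) C (b i j u) (trunc_mx N b i j u).
Proof.
have [h1 h2 h3] := b_nuc; have [N1 hN1] := h2 C; have [N2 hN2] := h3 C.
exists (maxn N1 N2) => N; rewrite geq_max => /andP[NN1 NN2] i j u.
rewrite /trunc_mx; case: ifP => [_|]; first exact: (vcong_refl KP).
move=> /negbT; rewrite negb_and -!ltnNge => hh.
split; [exact: h1|exact: vge0 KP _|rewrite subr0].
case/orP: hh => hh; first by apply: hN1; exact: leq_trans NN1 (ltnW hh).
by apply: hN2; exact: leq_trans NN2 (ltnW hh).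
Qed.

Lemma scong_iter_deltaV C M m f g : scong (ord D) C M f g ->
  scong (ord D) C M (iter m (deltaV qK) f) (iter m (deltaV qK) g).
Proof.
move=> h; elim: m => // m IH; rewrite !iterS; apply: (scong_deltaV KP) => //.
  exact: vge_q.
exact: ord_1Bq.
Qed.

Lemma scong_signed C M f g : scong (ord D) C M f g ->
  scong (ord D) C M (signed n f) (signed n g).
Proof. by move=> h; rewrite /signed; case: ifP => // _; exact: (scongV KP). Qed.

Lemma signed0 (f : fps (K D)) : f 0%N = 1 -> signed n f 0%N = 1.
Proof. by rewrite /signed; case: ifP => // _ _; rewrite psV0. Qed.

Lemma signedK (f : fps (K D)) : f 0%N = 1 -> signed n (signed n f) = f.
Proof.
rewrite /signed; case: odd => // f0; apply/esym/psV_unique; first exact: psV0.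
by rewrite mulrC mulpsV.
Qed.

(** Truncated L-functions lie in K and converge uniformly in the degree, so [L] descends to K.
    Inverting delta preserves congruences, which transfers the uniform growth bound to the limit. *)
Lemma L_function_props (A r : R) :
  (forall N r' (io : 'I_r'.+1 -> bidx n N), bijective io ->
     growth (ord D) r A (dwork_series b io)) ->
  [/\ L_function b 0%N = 1, forall m, vge (ord D) 0 (L_function b m) &
      growth (ord D) r A (signed n (iter n (deltaV qK) (L_function b)))].
Proof.
move=> hA.
have hN N : exists f : fps (K D), [/\ f 0%N = 1, growth (ord D) r A f &
    forall m, L_function_Cp (trunc_mx N b) m = embC D (iter n (delta qK) (signed n f) m)].
  have z0 : (0 < size (box n N))%N.
    by have := mem_box N (0 : 'rV[int]_n); rewrite l1_0 leq0n; case: (box n N).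
  have [r' [io hio]] := finType_ord_bij ((Ordinal z0, ord0) : bidx n N).
  exists (dwork_series b io); split; [exact: charps0|exact: hA|exact: L_trunc].
have [f hf] := choice hN.
pose LN N := iter n (delta qK) (signed n (f N)).
have f0 N : f N 0%N = 1 by have [] := hf N.
have LN0 N : LN N 0%N = 1 by apply: iter_delta0; exact: signed0.
have hc C : exists N0 : nat, forall N, (N0 <= N)%N -> forall m,
    vcong (ordC D) C (L_function_Cp b m) (embC D (LN N m)).
  have [N0 hN0] := trunc_cong C; exists N0 => N /hN0 h m.
  have [_ _ <-] := hf N; apply: L_function_Cp_cong => //; exact: trunc_nuclear.
have hx m : exists2 x, L_function_Cp b m = embC D x &
    converges_to (p D) (ord D) (fun N => LN N m) x.
  apply: embC_lim; apply/(converges_toP CpP p1) => C; have [N0 hN0] := hc C.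
  by exists N0 => N /hN0 /(_ m)[_ _]; rewrite -opprB (vgeN CpP).
have hL m : embC D (L_function b m) = L_function_Cp b m.
  have [x ex _] := hx m; rewrite /L_function.
  by case: xgetP => [y _ //|/(_ x)]; rewrite /= ex.
have hs C : exists N0 : nat, forall N, (N0 <= N)%N -> forall M,
    scong (ord D) C M (L_function b) (LN N).
  have [N0 hN0] := hc C; exists N0 => N /hN0 h M.
  have h' m : vcong (ord D) C (L_function b m) (LN N m).
    have := h m; rewrite -hL => -[h1 h2 h3].
    by split; rewrite /vge -ordC_emb ?rmorphB.
  by split=> [m|m _] //; have [] := h' m.
have L0 : L_function b 0%N = 1.
  apply: (fmorph_inj (embC D)); rewrite hL rmorph1 /L_function_Cp big_geq//.
split=> //.
  by move=> m; have [N0 /(_ N0 (leqnn _) 0%N)[/(_ m)[]]] := hs 0.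
(* Modulo the very bound to be proved, [L] may be replaced by one truncation. *)
move=> m; have [N0 /(_ N0 (leqnn _) m) h] := hs (r * m%:R - A).
have [_ /(_ m (leqnn m))[_ _]] := scong_signed (scong_iter_deltaV n h).
rewrite /LN iter_deltaVK; [|exact: q_unit|exact: signed0].
rewrite signedK// => h3; move: h3; rewrite -(vgeN KP) opprB => h3.
by apply: (vge_trans KP) h3; have [_ hg _] := hf N0; exact: hg.
Qed.

End Limit.

(** * Families, numerators and denominators *)

Section Families.
Variables (R : realType) (D : padic_setting R).
Local Notation KP := (ordKP D).
Local Notation CpP := (ordCP D).
Local Notation p1 := (p_gt1 D).
Local Notation qK := ((q D)%:R : K D).

Lemma unif_analytic_growth (E : Type) (S : set E) (f : E -> nat -> K D) (r B : R) :
  is_family S f -> (forall k, S k -> growth (ord D) r B (f k)) -> unif_analytic S f r.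
Proof.
move=> hf hg; split=> //; rewrite limn_einf_lim; apply/lee_subgt0Pr => e e0.
apply: lime_ge; first exact: is_cvg_einfs.
(* From this degree on the defect [B], divided by the degree, is at most [e]. *)
exists (Num.truncn (`|B| / e)).+1 => // m /= hm; rewrite /einfs; apply/ereal_infP => _ [l /= ml <-].
apply/ereal_infP => _ [k Sk <-].
have l0 : 0 < l%:R :> R by rewrite ltr0n; apply: leq_trans ml; apply: leq_trans hm.
have hB : B <= e * l%:R.
  apply: (le_trans (ler_norm B)); rewrite mulrC -ler_pdivrMr//.
  by apply: truncn_ge; exact: leq_trans hm ml.
have := hg k Sk l; rewrite /vge.
have [->|fl] := eqVneq (f k l) 0.
  by rewrite (vord0 KP) gt0_mulye ?lte_fin ?invr_gt0// !leey.
have [t ht] := ord_fin KP fl.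
rewrite ht lee_fin -EFinM -EFinB lee_fin ler_pdivlMr// mulrBl => h.
by lra.
Qed.

Lemma unif_continuous_scong (E : metricType R) (S : set E) (f : E -> nat -> K D) C M :
  unif_continuous_family S f -> exists2 delta : R, 0 < delta &
    forall k k', S k -> S k' -> mdist k k' < delta -> scong (ord D) C M (f k) (f k').
Proof.
move=> [hf hc].
have h : exists2 delta : R, 0 < delta & forall k k', S k -> S k' -> mdist k k' < delta ->
    forall m, (m <= M)%N -> vge (ord D) C (f k m - f k' m).
  have [e e0 he] := absv_lt_vge KP p1 C.
  elim: M => [|M [d1 d10 hd1]].
    have [d d0 hd] := hc 0%N e e0; exists d => // k k' Sk Sk' hk m.
    by rewrite leqn0 => /eqP ->; apply/he/hd.
  have [d d0 hd] := hc M.+1 e e0; exists (Num.min d d1); first by rewrite lt_min d0.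
  move=> k k' Sk Sk'; rewrite lt_min => /andP[hk1 hk2] m.
  by rewrite leq_eqVlt => /orP[/eqP ->|hm]; [apply/he/hd|exact: hd1].
have [d d0 hd] := h; exists d => // k k' Sk Sk' hk.
have i1 m : vge (ord D) 0 (f k m) by have [_] := hf k Sk; exact.
have i2 m : vge (ord D) 0 (f k' m) by have [_] := hf k' Sk'; exact.
by split=> [m|m mM]; split=> //; exact: hd.
Qed.

Lemma scong_unif_continuous (E : metricType R) (S : set E) (f : E -> nat -> K D) :
  is_family S f ->
  (forall C M, exists2 delta : R, 0 < delta &
    forall k k', S k -> S k' -> mdist k k' < delta -> scong (ord D) C M (f k) (f k')) ->
  unif_continuous_family S f.
Proof.
move=> hf h; split=> // m e e0; have [C hC] := vge_absv_lt KP p1 e0.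
have [d d0 hd] := h C m; exists d => // k k' Sk Sk' hk; apply: hC.
by have [_ /(_ m (leqnn m))[]] := hd k k' Sk Sk' hk.
Qed.

(** Makes a uniformly continuous family essentially so, with second factor 1. *)
Lemma one_unit1 c' : one_unit (@ps1 (K D)) c'.
Proof.
have ev t : eval_ps (@ps1 (K D)) t = 1 :> Cp D.
  apply: (vlim_const CpP p1 (N := 1)) => -[//|m] _.
  rewrite big_ord_recl /= /ps1 eqxx rmorph1 expr0 mulr1 big1 ?addr0// => i _.
  by rewrite rmorph0 mul0r.
have P0 : 0 < (p D)%:R :> R by rewrite ltr0n ltnW// p_gt1.
have a1 : absv (p D) (ordC D) 1 = 1.
  by rewrite /absv oner_eq0 (vord1 CpP) /= oppr0 powRr0.
split=> [|t _|].
- apply: cvg_near_cst; exists 1%N => // -[//|m] _ /=.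
  by rewrite /absv /ps1 /= eqxx mul0r.
- by rewrite ev oner_eq0.
- rewrite (_ : [set _ | _ in _] = [set 1%E]) ?ereal_sup1//.
  apply/seteqP; split=> [_ [t _ <-]|_ ->] /=; first by rewrite ev a1.
  exists 0; rewrite ?ev ?a1//; rewrite /closed_disc /= /absv eqxx.
  exact: powR_ge0.
Qed.

Variable n : nat.

(** At [f = L] this is [D(T)], obtained without an infinite determinant; it also applies to the
    factor [f1], which comes from no matrix. *)
Definition dwork_of (f : fps (K D)) : fps (K D) := signed n (iter n (deltaV qK) f).

(** Both are built on [dwork_of f], whose growth is known. For even [n] it is the inverse of the
    series to which delta is applied, so numerator and denominator trade places. *)
Definition numer (f : fps (K D)) : fps (K D) :=
  if odd n then delta_num qK n (dwork_of f) else delta_den qK n (dwork_of f).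
Definition denom (f : fps (K D)) : fps (K D) :=
  if odd n then delta_den qK n (dwork_of f) else delta_num qK n (dwork_of f).

Lemma dwork_of0 (f : fps (K D)) : f 0%N = 1 -> dwork_of f 0%N = 1.
Proof. by move=> f0; apply: signed0; exact: iter_deltaV0. Qed.

Lemma numer_denom (f : fps (K D)) : f 0%N = 1 -> f * denom f = numer f.
Proof.
move=> f0; have w0 := iter_deltaV0 qK n f0.
have e := delta_numdenE qK n w0; rewrite (iter_deltaK (@q_unit R D)) // in e.
rewrite /denom /numer /dwork_of /signed; case: odd => //.
set w := iter n _ f in w0 e *.
(* Even [n]: multiplicativity on [w * psV w = 1] shows that the numerators of [w] and of its inverse
   are mutually inverse, and likewise the denominators. *)
have [hn hd] := delta_numdenM qK n w (psV w).
have [h1 h2] := delta_numden1 qK n.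
rewrite (mulpsV w0) h1 in hn; rewrite (mulpsV w0) h2 in hd.
set v := psV w in hn hd *.
transitivity (f * delta_num qK n v * (delta_den qK n w * delta_den qK n v)).
  by rewrite -hd mulr1.
transitivity (f * delta_den qK n w * delta_num qK n v * delta_den qK n v); first by ring.
by rewrite e -hn mul1r.
Qed.

Lemma numer_denom_ind (P : fps (K D) -> Prop) f : P (dwork_of f) -> P 1 ->
  (forall g h, P g -> P h -> P (g * h)) -> (forall g, P g -> P (scale qK g)) ->
  P (numer f) /\ P (denom f).
Proof.
move=> Pf P1 PM Ps; have [] := delta_numden_ind n Pf P1 PM Ps.
by rewrite /numer /denom; case: odd.
Qed.

Lemma numer_denom_ind2 (P : fps (K D) -> fps (K D) -> Prop) f f' :
  P (dwork_of f) (dwork_of f') -> P 1 1 ->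
  (forall g h g' h', P g g' -> P h h' -> P (g * h) (g' * h')) ->
  (forall g g', P g g' -> P (scale qK g) (scale qK g')) ->
  P (numer f) (numer f') /\ P (denom f) (denom f').
Proof.
move=> Pf P1 PM Ps; have [] := delta_numden_ind2 n Pf P1 PM Ps.
by rewrite /numer /denom; case: odd.
Qed.

Lemma dwork_of_scong C M f f' : scong (ord D) C M f f' ->
  scong (ord D) C M (dwork_of f) (dwork_of f').
Proof. by move=> h; apply: scong_signed; exact: scong_iter_deltaV. Qed.

Lemma numer_denom_scong C M f f' : scong (ord D) C M f f' ->
  scong (ord D) C M (numer f) (numer f') /\ scong (ord D) C M (denom f) (denom f').
Proof.
move=> h; apply: (numer_denom_ind2 (P := scong (ord D) C M)).
- exact: dwork_of_scong.
- exact: scong1 KP C M.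
- by move=> *; exact: (scongM KP).
- by move=> *; apply: (scong_scale KP) => //; exact: vge_q.
Qed.

(** Each application of delta multiplies two series of equal defect, so the defect doubles. *)
Lemma growth_delta_numden r A k (w : fps (K D)) : growth (ord D) r A w -> 0 <= A ->
  growth (ord D) r (2 ^+ k * A) (delta_num qK k w) /\
  growth (ord D) r (2 ^+ k * A) (delta_den qK k w).
Proof.
move=> hw A0; elim: k => [|k [IHn IHd]].
  rewrite expr0 mul1r; split=> //; apply: (growthW A0); exact: growth1 KP r.
rewrite delta_numS delta_denS.
have -> : 2 ^+ k.+1 * A = 2 ^+ k * A + 2 ^+ k * A by rewrite exprS; ring.
by split; apply: (growthM KP) => //; apply: (growth_scale KP) => //; exact: vge_q.
Qed.

Lemma growth_numer_denom r A (f : fps (K D)) : growth (ord D) r A (dwork_of f) -> 0 <= A ->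
  growth (ord D) r (2 ^+ n * A) (numer f) /\ growth (ord D) r (2 ^+ n * A) (denom f).
Proof.
move=> hw A0; have [] := growth_delta_numden n hw A0.
by rewrite /numer /denom; case: odd.
Qed.

(** The contribution of [f2] has defect 0, and so has its inverse; by multiplicativity it can be
    divided out at no cost. *)
Lemma growth_dwork_factor r A (f1 f2 : fps (K D)) : f1 0%N = 1 -> f2 0%N = 1 ->
  growth (ord D) r 0 f2 -> growth (ord D) r A (dwork_of (f1 * f2)) ->
  growth (ord D) r A (dwork_of f1).
Proof.
move=> f10 f20 h2; rewrite /dwork_of /signed (iter_deltaVM (@q_unit R D))//.
have w10 := iter_deltaV0 qK n f10; have w20 := iter_deltaV0 qK n f20.
have hF : growth (ord D) r 0 (iter n (deltaV qK) f2).
  elim: n => // k IH; rewrite iterS; apply: (growth_deltaV KP) => //.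
    exact: vge_q.
  exact: ord_1Bq.
set w1 := iter n _ f1 in w10 *; set w2 := iter n _ f2 in w20 hF *.
case: odd => h.
  rewrite -[w1]mulr1 -(mulpsV w20) mulrA -[A]addr0; apply: (growthM KP) => //.
  exact: (growthV KP).
rewrite -[psV w1]mulr1 -(mulpsV w20) [w2 * _]mulrC mulrA -psVM// -[A]addr0.
exact: (growthM KP).
Qed.

Section Quotient.
Variables (E : metricType R) (S : set E) (L f1 f2 : E -> nat -> K D) (r A : R).
Hypothesis A_ge0 : 0 <= A.
Hypothesis L_growth : forall k, S k -> growth (ord D) r A (dwork_of (L k)).
Hypothesis f1_family : is_family S f1.
Hypothesis f2_family : is_family S f2.
Hypothesis f2_growth : forall k, S k -> growth (ord D) r 0 (f2 k).
Hypothesis L_factor : forall k, S k -> L k = psmul (f1 k) (f2 k).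

(** Only [f1] is turned into a quotient; [f2] is multiplied onto the numerator. Taking [f2 = 1]
    covers the cases where [L] itself is used. *)
Let g k := numer (f1 k).
Let h k := denom (f1 k).

Let gh_growth k : S k ->
  growth (ord D) r (2 ^+ n * A) (g k) /\ growth (ord D) r (2 ^+ n * A) (h k).
Proof.
move=> Sk; have [f10 _] := f1_family Sk; have [f20 _] := f2_family Sk.
apply: growth_numer_denom => //; apply: (growth_dwork_factor f10 f20); first exact: f2_growth.
by have := L_growth Sk; rewrite L_factor.
Qed.

Let gh_family : is_family S g /\ is_family S h.
Proof.
suff hk k : S k -> (g k 0%N = 1 /\ h k 0%N = 1) /\
    forall m, vge (ord D) 0 (g k m) /\ vge (ord D) 0 (h k m).
  by split=> k /hk[[g0 h0] hi]; split=> // m; have [] := hi m.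
move=> Sk; have [f10 f1i] := f1_family Sk; split.
  apply: (numer_denom_ind (P := fun f => f 0%N = 1)) => //; first exact: dwork_of0.
    by move=> f f' e e'; rewrite coefM0_ps e e' mulr1.
  by move=> f e; rewrite scale0.
have hs : scong (ord D) 0 0 (f1 k) (f1 k) by apply: (scong_refl KP) => m; exact: f1i.
have [[hg _] [hh _]] := numer_denom_scong hs.
by move=> m; split; [have [] := hg m|have [] := hh m].
Qed.

Lemma gh_analytic : unif_analytic S g r /\ unif_analytic S h r.
Proof.
have [hg hh] := gh_family.
by split; apply: (unif_analytic_growth (B := 2 ^+ n * A)) => // k /gh_growth[].
Qed.

Lemma gh_continuous : unif_continuous_family S f1 ->
  unif_continuous_family S g /\ unif_continuous_family S h.
Proof.
move=> hf; have [hg hh] := gh_family.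
split; apply: scong_unif_continuous => // C M;
  have [d d0 hd] := unif_continuous_scong C M hf; exists d => // k k' Sk Sk' hk;
  by have [] := numer_denom_scong (hd k k' Sk Sk' hk).
Qed.

Lemma gf2_analytic : unif_analytic S (fun k => psmul (g k) (f2 k)) r.
Proof.
have [hg _] := gh_family.
apply: (unif_analytic_growth (B := 2 ^+ n * A + 0)) => [k Sk|k Sk].
  have [g0 gi] := hg k Sk; have [f20 f2i] := f2_family Sk.
  split; first by rewrite psmulE coefM0_ps g0 f20 mulr1.
  by move=> m; apply: (integralM KP).
by apply: (growthM KP); [have [] := gh_growth Sk|exact: f2_growth].
Qed.

Lemma gh_quotient : is_quotient S L (fun k => psmul (g k) (f2 k)) h.
Proof.
move=> k Sk; have [f10 _] := f1_family Sk.
rewrite L_factor//; change ((f1 k : fps (K D)) * f2 k * h k = g k * (f2 k : fps (K D))).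
by rewrite mulrAC numer_denom.
Qed.

End Quotient.

End Families.

(** * From sigma-modules to the theorem *)

Lemma sigma_matrix_integral (R : realType) (D : padic_setting R) (n : nat) (I : set nat)
    (phi : formal_sum D n -> formal_sum D n) : nuclear_sigma_module I phi ->
  forall i j u, vge (ord D) 0 (sigma_matrix I phi i j u).
Proof.
move=> [hphi _ _] i j u; have KP := ordKP D.
rewrite /sigma_matrix; case: ifP => [/set_mem Ij|_]; last exact: vge0 KP _.
(* Integrality of the matrix comes from [phi] preserving the module, applied to a basis vector. *)
have hb : in_module I (@basis_elt R D n j).
  split=> [i' _|i' nIi' v].
    split=> [v|e e0]; first exact: (vge_nat KP).
    exists 1%N => v hv; rewrite /basis_elt /absv [v == 0](_ : _ = false) ?andbF ?eqxx//.
    by apply/eqP => v0; move: hv; rewrite v0 l1_0.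
  rewrite /basis_elt; case: eqP => [e|//]; by rewrite e in nIi'.
have [h1 h2] := hphi _ hb.
have [Ii|nIi] := pselect (I i); first by have [h _] := h1 i Ii; exact: h.
by rewrite h2//; exact: vge0 KP _.
Qed.

Lemma log_convergent_nuclear (R : realType) (D : padic_setting R) (n : nat) (E : Type)
    (S : set E) (b : E -> series_matrix D n) (c : R) : 0 < c ->
  (forall k, S k -> forall i j u, vge (ord D) 0 (b k i j u)) ->
  unif_log_convergent S b c -> forall k, S k -> log_nuclear (b k).
Proof.
move=> c0 b_int b_log k Sk; split; first exact: b_int.
  (* The clause on columns only speaks of positive bounds. *)
  move=> C; have [_ /(_ (Num.max C 1))] := b_log.
  case=> [|N hN]; first by rewrite lt_max ltr01 orbT.
  exists N.+1 => j Nj i u; apply: (@vgeW _ _ _ (Num.max C 1)); first by rewrite le_max lexx.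
  exact: hN.
move=> C; have c2 : 0 < c / 2 by lra.
have [N N1 hN] := @log_bound R D n E S b c b_log (c / 2) ltac:(lra).
have lq := lnq_gt0 D.
(* For [|u| >= X] the bound [(c / 2) log_q |u|] is at least [C]. *)
pose X : R := expR (C * ln (q D)%:R / (c / 2)).
exists (maxn N (Num.truncn X).+1) => u; rewrite geq_max => /andP[uN uX] i j.
apply: vgeW (hN u uN k Sk i j).
have u0 : 0 < (l1 u)%:R :> R by rewrite ltr0n; apply: leq_trans uN; exact: ltnW.
have : X <= (l1 u)%:R by exact: truncn_ge.
rewrite -ler_ln ?posrE ?expR_gt0// expRK ler_pdivrMr// => h.
by rewrite mulrA ler_pdivlMr// mulrC [c / 2 * _]mulrC (mulrC _ C).
Qed.

Theorem theorem5p7 (R : realType) (D : padic_setting R) (n : nat)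
    (n_gt0 : (0 < n)%N)
    (E : metricType R)
    (E_complete : forall F : set_system E,
       ProperFilter F -> cauchy F -> exists x : E, F --> x)
    (S : set E)
    (I : E -> set nat)
    (phi : E -> formal_sum D n -> formal_sum D n)
    (phi_nuclear : forall k, S k -> nuclear_sigma_module (I k) (phi k))
    (c : R) (c_gt0 : 0 < c)
    (B_logconv : unif_log_convergent S
       (fun k => sigma_matrix (I k) (phi k)) c)
    (eps : R) (eps_gt0 : 0 < eps) :
  let L := fun k => L_function (sigma_matrix (I k) (phi k)) in
  [/\ unif_meromorphic S L (c - eps),
      unif_continuous_family S L -> strong_family S L (c - eps) &
      ess_unif_continuous S L (c - eps) -> ess_strong_family S L (c - eps)].
Proof.
have b_int k : S k -> forall i j u, vge (ord D) 0 (sigma_matrix (I k) (phi k) i j u).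
  by move=> Sk; exact: sigma_matrix_integral (phi_nuclear k Sk).
have [A A0 hA] := dwork_growth b_int B_logconv (r := c - eps) ltac:(lra).
have hL k (Sk : S k) := L_function_props
  (log_convergent_nuclear c_gt0 b_int B_logconv Sk) (hA k Sk).
move=> L.
have L_growth k : S k -> growth (ord D) (c - eps) A (dwork_of n (L k)).
  by move=> Sk; have [] := hL k Sk.
have L_family : is_family S L.
  by move=> k Sk; have [h1 h2 _] := hL k Sk; split.
(* The first two claims use the factorization [L = L * 1]. *)
pose one (k : E) := @ps1 (K D).
have one_family : is_family S one.
  by move=> k Sk; split=> // m; exact: (vge_nat (ordKP D)).
have one_growth k : S k -> growth (ord D) (c - eps) 0 (one k).
  by move=> _; exact: growth1 (ordKP D) _.
have L1 k : S k -> L k = psmul (L k) (one k).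
  by move=> _; rewrite psmulE [RHS](mulr1 (L k : fps (K D))).
have [gan han] := gh_analytic A0 L_growth L_family one_family one_growth L1.
have quo : is_quotient S L (fun k => numer n (L k)) (fun k => denom n (L k)).
  by move=> k Sk; rewrite psmulE numer_denom//; have [] := L_family k Sk.
split=> [|hc|[f1 [f2 [f1c f2f f2u Lf]]]].
- by exists (fun k => numer n (L k)), (fun k => denom n (L k)).
- have [gc hc'] := gh_continuous n L_family hc.
  by exists (fun k => numer n (L k)), (fun k => denom n (L k)).
have f1f : is_family S f1 by case: f1c.
have f2g k : S k -> growth (ord D) (c - eps) 0 (f2 k).
  by move=> Sk; apply: one_unit_growth; exact: f2u.
have [g1an h1an] := gh_analytic A0 L_growth f1f f2f f2g Lf.
have [g1c h1c] := gh_continuous n f1f f1c.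
(* The 1-unit [f2] goes entirely to the numerator; the denominator is continuous and is paired with
   the 1-unit 1. *)
exists (fun k => psmul (numer n (f1 k)) (f2 k)), (fun k => denom n (f1 k)); split.
- split; first exact: (gf2_analytic A0 L_growth f1f f2f f2g Lf).
  by exists (fun k => numer n (f1 k)), f2.
- split; first exact: h1an.
  exists (fun k => denom n (f1 k)), one; split; last exact: h1an.
  split; [exact: h1c|exact: one_family|by move=> k Sk; exact: one_unit1|].
  by move=> k Sk; exact: esym (mulr1 (denom n (f1 k))).
- exact: gh_quotient.
Qed.
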